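(* Let $\gamma\in C^\infty([a,b];\mathbb{R}^3)$ be an arc-length parametrized curve with unit tangent $T=\gamma'$, and let $\varrho\in C^\infty([a,b];\mathbb{R}_{>0})$ be its bending stiffness. Put $$\mathcal G^{\mathcal B}:=\varrho T'''+3\varrho\langle T'',T'\rangle T+\tfrac32\varrho\langle T',T'\rangle T'+\varrho''T'+\varrho'\big(2T''+\tfrac32\langle T',T'\rangle T\big).$$ Then $\gamma$ is a holonomy constrained elastic curve with bending stiffness $\varrho$ if and only if there are a smooth function $\Lambda\colon[a,b]\to\mathbb{R}$ and a constant $\mu\in\mathbb{R}$ such that $$\mathcal G^{\mathcal B}-2\Lambda'T-2\Lambda T'-\mu\,T\times T''=0.$$ Equivalently, in terms of $T$: there are a smooth function $\Lambda\colon[a,b]\to\mathbb{R}$ and a constant $\mu\in\mathbb{R}$ such that $$\varrho T'''-\varrho\langle T''',T\rangle T+\tfrac32\varrho\langle T',T'\rangle T'+\varrho''T'+\varrho'\big(2T''+\tfrac32\langle T',T'\rangle T\big)-\Lambda'T-\Lambda T'-\mu\,T\times T''=0;$$ or equivalently, in terms of $\gamma$: there are a smooth function $\Lambda\colon[a,b]\to\mathbb{R}$ and a constant $\mu\in\mathbb{R}$ such that $$\varrho\gamma''''-\varrho\langle\gamma'''',\gamma'\rangle\gamma'+\tfrac32\varrho\langle\gamma'',\gamma''\rangle\gamma''+\varrho''\gamma''+\varrho'\big(2\gamma'''+\tfrac32\langle\gamma'',\gamma''\rangle\gamma'\big)-\Lambda'\gamma'-\Lambda\gamma''-\mu\,\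gamma'\times\gamma'''=0.$$
   Context: A curve is a map $\gamma\in C^\infty([a,b];\mathbb{R}^3)$ with $\gamma'\ne0$ everywhere; it is arc-length parametrized if $|\gamma'|\equiv1$. For a function $g$ along $\gamma$, $\frac{dg}{ds}:=g'/|\gamma'|$ and $ds=|\gamma'|\,dx$; $T:=\frac{d\gamma}{ds}$. The bending energy of $\gamma$ with bending stiffness $\varrho\in C^\infty([a,b];\mathbb{R}_{>0})$ is $\mathcal B_\varrho(\gamma):=\frac12\int_a^b\varrho\,\langle\frac{dT}{ds},\frac{dT}{ds}\rangle\,ds$ ($\varrho$ is a fixed function on $[a,b]$, not varied). Holonomy: a normal field $Z$ along $\gamma$ ($\langle Z,T\rangle=0$) is parallel if $Z'=\lambda T$ for some smooth function $\lambda$; every normal vector at $\gamma(a)$ extends uniquely to a parallel normal field, whose value at $b$ is its parallel transport along $\gamma$. For unit vectors $W_a\in T(a)^\perp$, $W_b\in T(b)^\perp$ and $W=(W_a,W_b)$, the holonomy of $\gamma$ with respect to $W$ is the unique angle $\mathcal T_W\in\mathbb{R}/2\pi\mathbb{Z}$ with $Z_b=\cos(\mathcal T_W)W_b+\sin(\mathcal T_W)\,T(b)\times W_b$, where $Z_b$ is the parallel transport of $W_a$ along $\gamma$. A smooth variation of $\gamma$ is a smooth one-parameter family $\gamma_t$, $t\in[-\epsilon,\epsilon]$, with $\gamma_0=\gamma$; its variational vector field is $\mathring\gamma:=\frac{d}{dt}|_{t=0}\gamma_t$, and for a functional $\mathcal F$, $d\mathcal F(\mathring\gamma):=\frac{d}{dt}|_{t=0}\mathcal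 F(\gamma_t)$. $C_0^\infty([a,b];\mathbb{R}^3)$ denotes the smooth maps with compact support in the interior of $[a,b]$; variations with compact support in the interior leave $\gamma$ unchanged near the end points, and $d\mathcal T_W(\mathring\gamma)$ is then independent of the choice of $W$. Variations and variational vector fields are treated as synonyms. An arc-length parametrized curve $\gamma$ with bending stiffness $\varrho$ is called holonomy constrained elastic if it is a critical point of $\mathcal B_\varrho$ under all variations $\mathring\gamma\in C_0^\infty([a,b];\mathbb{R}^3)$ constraining the arc-length and the holonomy, i.e. $d\mathcal B_\varrho(\mathring\gamma)=0$ for all $\mathring\gamma\in C_0^\infty([a,b];\mathbb{R}^3)$ satisfying pointwise $\langle\mathring\gamma',\gamma'\rangle=0$ and $d\mathcal T_W(\mathring\gamma)=0$. *)

(* Defs.v *)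
From Stdlib Require Import Reals.
From Coquelicot Require Import Coquelicot.
Open Scope R_scope.

(** Derivative relative to [a,b], i.e. Coquelicot's [is_derive] with [locally x]
    restricted to [a,b]: two-sided inside, one-sided at the end points.  For [x]
    in [a,b] it only depends on the values of [f] on [a,b]. *)
Definition is_deriv (a b : R) (f : R -> R) (x l : R) : Prop :=
  filterdiff f (within (fun y => a <= y <= b) (locally x)) (fun h => scal h l).

Definition deriv (a b : R) (f : R -> R) (x : R) : R :=
  iota (is_deriv a b f x).

Definition smooth (a b : R) (f : R -> R) : Prop :=
  forall (n : nat) (x : R), a <= x <= b ->
    exists l : R, is_deriv a b (Nat.iter n (deriv a b) f) x l.

(** [F] is C^oo on the rectangle [-e,e] x [a,b]: [P i j] is the partial derivative
    of order [i] in the first and [j] in the second variable; all of them exist and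
    are jointly continuous on the rectangle. *)
Definition smooth2 (e a b : R) (F : R -> R -> R) : Prop :=
  exists P : nat -> nat -> R -> R -> R,
    (forall t x, - e <= t <= e -> a <= x <= b -> P O O t x = F t x) /\
    (forall i j t x, - e <= t <= e -> a <= x <= b ->
       is_deriv (- e) e (fun s => P i j s x) t (P (S i) j t x) /\
       is_deriv a b (fun y => P i j t y) x (P i (S j) t x) /\
       filterlim (fun p : R * R => P i j (fst p) (snd p))
         (within (fun p : R * R => - e <= fst p <= e /\ a <= snd p <= b)
                 (locally (t, x)))
         (locally (P i j t x))).

Definition R3 : Type := (R * R * R)%type.

Definition c1 (v : R3) : R := fst (fst v).
Definition c2 (v : R3) : R := snd (fst v).
Definition c3 (v : R3) : R := snd v.

Definition zero3 : R3 := (0, 0, 0).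
Definition add3 (v w : R3) : R3 := (c1 v + c1 w, c2 v + c2 w, c3 v + c3 w).
Definition sub3 (v w : R3) : R3 := (c1 v - c1 w, c2 v - c2 w, c3 v - c3 w).
Definition scale3 (k : R) (v : R3) : R3 := (k * c1 v, k * c2 v, k * c3 v).
Definition dot (v w : R3) : R := c1 v * c1 w + c2 v * c2 w + c3 v * c3 w.
Definition cross (v w : R3) : R3 :=
  (c2 v * c3 w - c3 v * c2 w,
   c3 v * c1 w - c1 v * c3 w,
   c1 v * c2 w - c2 v * c1 w).
Definition norm3 (v : R3) : R := sqrt (dot v v).

Notation "v +v w" := (add3 v w) (at level 50, left associativity).
Notation "v -v w" := (sub3 v w) (at level 50, left associativity).
Notation "k *v v" := (scale3 k v) (at level 40, left associativity).

Definition deriv3 (a b : R) (g : R -> R3) (x : R) : R3 :=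
  (deriv a b (fun y => c1 (g y)) x,
   deriv a b (fun y => c2 (g y)) x,
   deriv a b (fun y => c3 (g y)) x).

Definition smooth3 (a b : R) (g : R -> R3) : Prop :=
  smooth a b (fun x => c1 (g x)) /\
  smooth a b (fun x => c2 (g x)) /\
  smooth a b (fun x => c3 (g x)).

Definition curve (a b : R) (gamma : R -> R3) : Prop :=
  smooth3 a b gamma /\
  forall x, a <= x <= b -> deriv3 a b gamma x <> zero3.

Definition arclength_curve (a b : R) (gamma : R -> R3) : Prop :=
  curve a b gamma /\
  forall x, a <= x <= b -> norm3 (deriv3 a b gamma x) = 1.

Definition speed (a b : R) (gamma : R -> R3) (x : R) : R :=
  norm3 (deriv3 a b gamma x).

(** [dg/ds = g' / |gamma'|] for a vector field [g] along [gamma]. *)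
Definition dds (a b : R) (gamma g : R -> R3) (x : R) : R3 :=
  / speed a b gamma x *v deriv3 a b g x.

Definition tangent (a b : R) (gamma : R -> R3) : R -> R3 :=
  dds a b gamma gamma.

Definition bending_energy (a b : R) (rho : R -> R) (gamma : R -> R3) : R :=
  / 2 * RInt (fun x =>
    rho x * dot (dds a b gamma (tangent a b gamma) x)
                (dds a b gamma (tangent a b gamma) x)
          * speed a b gamma x) a b.

Definition parallel_field (a b : R) (gamma Z : R -> R3) : Prop :=
  smooth3 a b Z /\
  (forall x, a <= x <= b -> dot (Z x) (tangent a b gamma x) = 0) /\
  exists lambda : R -> R, smooth a b lambda /\
    forall x, a <= x <= b -> deriv3 a b Z x = lambda x *v tangent a b gamma x.

Definition unit_normal (a b : R) (gamma : R -> R3) (x : R) (W : R3) : Prop :=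
  norm3 W = 1 /\ dot W (tangent a b gamma x) = 0.

(** [theta] represents the holonomy of [gamma] with respect to [(Wa, Wb)], which is
    an element of R / 2 pi Z. *)
Definition is_holonomy (a b : R) (gamma : R -> R3) (Wa Wb : R3) (theta : R) : Prop :=
  exists Z : R -> R3, parallel_field a b gamma Z /\ Z a = Wa /\
    Z b = cos theta *v Wb +v sin theta *v cross (tangent a b gamma b) Wb.

Definition smooth_compact_support (a b : R) (V : R -> R3) : Prop :=
  smooth3 a b V /\
  exists c d, a < c /\ c <= d /\ d < b /\
    forall x, a <= x <= b -> ~ (c <= x <= d) -> V x = zero3.

(** [G t], for [t] in [-e,e], is a smooth family of curves with [G 0 = gamma] and
    variational vector field [V], leaving [gamma] unchanged near the end points. *)
Definition variation (a b : R) (gamma V : R -> R3) (e : R) (G : R -> R -> R3) : Prop :=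
  0 < e /\
  (smooth2 e a b (fun t x => c1 (G t x)) /\
   smooth2 e a b (fun t x => c2 (G t x)) /\
   smooth2 e a b (fun t x => c3 (G t x))) /\
  (forall t, - e <= t <= e -> curve a b (G t)) /\
  (forall x, a <= x <= b -> G 0 x = gamma x) /\
  (forall x, a <= x <= b -> deriv3 (- e) e (fun t => G t x) 0 = V x) /\
  exists c d, a < c /\ c <= d /\ d < b /\
    forall t x, - e <= t <= e -> a <= x <= b -> ~ (c <= x <= d) -> G t x = gamma x.

(** [d B_rho (V) = l]. *)
Definition is_dbending (a b : R) (rho : R -> R) (gamma V : R -> R3) (l : R) : Prop :=
  forall (e : R) (G : R -> R -> R3), variation a b gamma V e G ->
    is_deriv (- e) e (fun t => bending_energy a b rho (G t)) 0 l.

(** [d T_W (V) = l] for [W = (Wa, Wb)].  The holonomy takes values in R / 2 pi Z, so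
    it is differentiated through a real-valued lift [theta]; lifts differentiable
    at 0 all have the same derivative there. *)
Definition is_dholonomy (a b : R) (gamma : R -> R3) (Wa Wb : R3) (V : R -> R3)
    (l : R) : Prop :=
  forall (e : R) (G : R -> R -> R3), variation a b gamma V e G ->
    exists theta : R -> R,
      (forall t, - e <= t <= e -> is_holonomy a b (G t) Wa Wb (theta t)) /\
      is_deriv (- e) e theta 0 l.

(** The derivative of the holonomy does not depend on the choice of unit normal
    vectors [Wa], [Wb] at the end points; the constraint is stated for all of them. *)
Definition holonomy_constrained_elastic (a b : R) (rho : R -> R) (gamma : R -> R3)
    : Prop :=
  forall V : R -> R3, smooth_compact_support a b V ->
    (forall x, a <= x <= b -> dot (deriv3 a b V x) (deriv3 a b gamma x) = 0) ->
    (forall Wa Wb : R3, unit_normal a b gamma a Wa -> unit_normal a b gamma b Wb ->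
       is_dholonomy a b gamma Wa Wb V 0) ->
    is_dbending a b rho gamma V 0.

(** The vector field G^B along an arc-length parametrized curve with tangent [T]. *)
Definition bending_gradient (a b : R) (rho : R -> R) (T : R -> R3) (x : R) : R3 :=
  let D := deriv a b in
  let D3 := deriv3 a b in
  let T1 := D3 T in
  let T2 := D3 T1 in
  let T3 := D3 T2 in
  rho x *v T3 x
  +v 3 * rho x * dot (T2 x) (T1 x) *v T x
  +v 3 / 2 * rho x * dot (T1 x) (T1 x) *v T1 x
  +v D (D rho) x *v T1 x
  +v D rho x *v (2 *v T2 x +v 3 / 2 * dot (T1 x) (T1 x) *v T x).

(* Main.v *)
(** Write [T = gamma'] and let [V] be a variation with [<V', T> = 0].  The first variation of
    the bending energy is [int rho <T', V''>], that of the holonomy is [- int <T x T', V'>].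
    The latter is obtained by comparing parallel transport along [gamma_t] with the frame
    [M x gamma_t'], where [M] is parallel along [gamma]; existence of parallel fields is a
    scalar Volterra equation.  The admissible derivatives [U = V'] are the compactly supported
    fields orthogonal to [T] with [int U = 0], so that [gamma] is critical iff on all compactly
    supported [U] orthogonal to [T] the functional [int <(rho T')', U>] is a combination of
    [int <T x T', U>] and of the three components of [int U].  By the fundamental lemma this
    means that [(rho T')' - f T - mu T x T'] is constant for some function [f] and number [mu];
    the three equations of the theorem are its derivative, with
    [f = 2 Lambda - 3/2 rho <T', T'>] in the first one. *)

From Stdlib Require Import Reals Lra Lia ClassicalEpsilon.
From Coquelicot Require Import Coquelicot.
Require Import Defs.
Open Scope R_scope.

(** * Calculus relative to an interval *)

(** No solution of the transport equation is ever differentiated in [t]. As [M] does not depend on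
    [t], the frame [M x gamma_t'] is algebraic in the [x]-derivatives of [gamma_t], and the holonomy
    becomes a fixed angle minus the integral of an explicit connection form; differentiation under
    the integral replaces smooth dependence of an ODE on a parameter. The price is that the frame
    may degenerate away from [t = 0]. Both differentials quantify over all variations with field
    [V]. To exploit criticality one variation must be produced: [gamma + t V] serves, since
    [<gamma' + t V', gamma'> = 1] keeps it immersed. To prove criticality, the first variation
    formulas are needed for every variation. Derivatives are relative to a closed interval, hence
    one-sided at its ends. Two devices link them to two-sided calculus: a function with a relative
    derivative at [x] agrees on the interval with one that is differentiable at [x], and continuity
    is tested after clamping the argument. Smoothness of the multiplier [f] costs nothing: it is the
    tangential component of an explicit smooth field. *)

Definition clamp (a b x : R) : R := Rmax a (Rmin b x).

Lemma clamp_bounds (a b x : R) : a <= b -> a <= clamp a b x <= b.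
Proof.
  intros H; unfold clamp; split; [apply Rmax_l|].
  apply Rmax_lub; [exact H|apply Rmin_l].
Qed.

Lemma clamp_id (a b x : R) : a <= x <= b -> clamp a b x = x.
Proof.
  intros H; unfold clamp; rewrite Rmin_right, Rmax_right; lra.
Qed.

Lemma clamp_lipschitz (a b x y : R) : Rabs (clamp a b x - clamp a b y) <= Rabs (x - y).
Proof.
  unfold clamp, Rmax, Rmin.
  repeat destruct Rle_dec; unfold Rabs; repeat destruct Rcase_abs; lra.
Qed.

Lemma clamp_continuous (a b x : R) : continuous (clamp a b) x.
Proof.
  apply filterlim_locally; intros eps.
  exists eps; intros y Hy.
  change (Rabs (y - x) < eps) in Hy.
  change (Rabs (clamp a b y - clamp a b x) < eps).
  generalize (clamp_lipschitz a b y x); lra.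
Qed.

Lemma is_deriv_eps (a b : R) (f : R -> R) (x l : R) : a <= x <= b ->
  is_deriv a b f x l <->
  forall eps : posreal, exists delta : posreal, forall y,
    Rabs (y - x) < delta -> a <= y <= b ->
    Rabs (f y - f x - (y - x) * l) <= eps * Rabs (y - x).
Proof.
  intros Hx; split.
  - intros [_ H] eps.
    destruct (H x (filter_le_within (fun y => a <= y <= b)) eps) as [d Hd].
    exists d; intros y Hy Hab; exact (Hd y Hy Hab).
  - intros H; split; [apply (is_linear_scal_l l)|].
    intros z Hz.
    (* [filterdiff] quantifies over every limit [z] of the filter. Since [x] lies in [a,b], it
       belongs to each set of the filter, which excludes limits at positive distance from [x]. *)
    assert (z = x) as ->.
    { apply NNPP; intros Hne.
      assert (Hp : 0 < Rabs (x - z)) by (apply Rabs_pos_lt; lra).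
      destruct (Hz _ (locally_ball z (mkposreal _ Hp))) as [d Hd].
      specialize (Hd x (ball_center x d) Hx).
      change (Rabs (x - z) < Rabs (x - z)) in Hd; lra. }
    intros eps; destruct (H eps) as [d Hd].
    exists d; intros y Hy Hab; exact (Hd y Hy Hab).
Qed.

Lemma is_derive_eps (g : R -> R) (x l : R) :
  is_derive g x l <->
  forall eps : posreal, exists delta : posreal, forall y,
    Rabs (y - x) < delta -> Rabs (g y - g x - (y - x) * l) <= eps * Rabs (y - x).
Proof.
  split.
  - intros [_ H] eps.
    destruct (H x (fun P HP => HP) eps) as [d Hd].
    exists d; intros y Hy; exact (Hd y Hy).
  - intros H; split; [apply (is_linear_scal_l l)|].
    intros z Hz.
    rewrite <- (is_filter_lim_locally_unique _ _ Hz).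
    intros eps; destruct (H eps) as [d Hd].
    exists d; intros y Hy; exact (Hd y Hy).
Qed.

(* Transfers the calculus of two-sided derivatives to [is_deriv]. *)
Lemma is_deriv_extension (a b : R) (f : R -> R) (x l : R) : a <= x <= b ->
  is_deriv a b f x l <->
  exists g : R -> R, (forall y, a <= y <= b -> g y = f y) /\ is_derive g x l.
Proof.
  intros Hx; rewrite is_deriv_eps by exact Hx; split.
  - intros H.
    (* Outside [a,b] the function is continued by its would-be tangent line at [x], for which the
       remainder vanishes. *)
    exists (fun y => if excluded_middle_informative (a <= y <= b)
                     then f y else f x + (y - x) * l).
    split; [intros y Hy; destruct excluded_middle_informative; tauto|].
    apply is_derive_eps; intros eps; destruct (H eps) as [d Hd]; exists d; intros y Hy.
    destruct (excluded_middle_informative (a <= x <= b)) as [_|]; [|tauto].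
    destruct (excluded_middle_informative (a <= y <= b)) as [Hab|]; [auto|].
    replace (f x + (y - x) * l - f x - (y - x) * l) with 0 by ring.
    rewrite Rabs_R0; apply Rmult_le_pos; [apply Rlt_le, cond_pos|apply Rabs_pos].
  - intros [g [Hg Hd]] eps.
    destruct (proj1 (is_derive_eps _ _ _) Hd eps) as [d H].
    exists d; intros y Hy Hab; rewrite <- !Hg by assumption; auto.
Qed.

Lemma is_derive_is_deriv (a b : R) (f : R -> R) (x l : R) :
  a <= x <= b -> is_derive f x l -> is_deriv a b f x l.
Proof.
  intros Hx H; apply is_deriv_extension; [exact Hx|]; exists f; auto.
Qed.

Lemma is_deriv_ext_loc (a b : R) (f g : R -> R) (x l : R) :
  a <= x <= b -> locally x (fun y => a <= y <= b -> f y = g y) ->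
  is_deriv a b f x l -> is_deriv a b g x l.
Proof.
  intros Hx [r Hr]; rewrite !is_deriv_eps by exact Hx; intros H eps.
  destruct (H eps) as [d Hd].
  exists (mkposreal _ (Rmin_stable_in_posreal r d)); simpl; intros y Hy Hab.
  assert (Rabs (y - x) < r /\ Rabs (y - x) < d) as [H1 H2].
  { split; eapply Rlt_le_trans; try exact Hy; [apply Rmin_l|apply Rmin_r]. }
  rewrite <- (Hr y H1 Hab), <- (Hr x (ball_center x r) Hx); auto.
Qed.

Lemma is_deriv_ext (a b : R) (f g : R -> R) (x l : R) :
  a <= x <= b -> (forall y, a <= y <= b -> f y = g y) ->
  is_deriv a b f x l -> is_deriv a b g x l.
Proof.
  intros Hx H; apply is_deriv_ext_loc; [exact Hx|].
  now apply filter_forall.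
Qed.

Lemma is_deriv_interior (a b : R) (f : R -> R) (x l : R) :
  a < x < b -> is_deriv a b f x l -> is_derive f x l.
Proof.
  intros Hx H; apply is_deriv_extension in H; [|lra].
  destruct H as [g [Hg Hd]].
  apply (is_derive_ext_loc g); [|exact Hd].
  generalize (locally_interval (fun y => a <= y <= b) x a b).
  intros HI; eapply filter_imp; [|apply HI; simpl; try lra].
  - intros y Hy; simpl in Hy; auto.
  - intros y H1 H2; simpl in *; lra.
Qed.

Lemma is_deriv_subinterval (a b a' b' : R) (f : R -> R) (x l : R) :
  a <= a' -> b' <= b -> a' <= x <= b' -> is_deriv a b f x l -> is_deriv a' b' f x l.
Proof.
  intros Ha Hb Hx H; apply is_deriv_extension in H; [|lra].
  apply is_deriv_extension; [exact Hx|].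
  destruct H as [g [Hg Hd]]; exists g; split; [|exact Hd].
  intros y Hy; apply Hg; lra.
Qed.

Lemma is_deriv_unique (a b : R) (f : R -> R) (x l l' : R) :
  a < b -> a <= x <= b -> is_deriv a b f x l -> is_deriv a b f x l' -> l = l'.
Proof.
  intros Hab Hx; rewrite !is_deriv_eps by exact Hx; intros H H'.
  apply NNPP; intros Hne.
  (* Each of the two remainders is allowed a third of [|l - l'|]; together they cannot account for
     all of it. *)
  assert (Hp : 0 < Rabs (l - l') / 3).
  { apply Rdiv_lt_0_compat; [apply Rabs_pos_lt|]; lra. }
  destruct (H (mkposreal _ Hp)) as [d Hd], (H' (mkposreal _ Hp)) as [d' Hd'].
  simpl in Hd, Hd'.
  assert (exists y, a <= y <= b /\ y <> x /\ Rabs (y - x) < d /\ Rabs (y - x) < d')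
    as [y [Hy [Hyx [H1 H2]]]].
  (* At least half of the interval lies on one side of [x], so that [x + r] or [x - r] stays in
     [a,b]. *)
  { set (r := Rmin (Rmin d d') (b - a) / 2).
    assert (0 < r /\ r < d /\ r < d' /\ r <= (b - a) / 2).
    { generalize (cond_pos d) (cond_pos d'); intros.
      unfold r, Rmin; repeat destruct Rle_dec; lra. }
    destruct (Rle_dec (x + r) b).
    - exists (x + r); replace (x + r - x) with r by ring; rewrite Rabs_right; lra.
    - exists (x - r); replace (x - r - x) with (- r) by ring.
      rewrite Rabs_Ropp, Rabs_right; lra. }
  specialize (Hd y H1 Hy); specialize (Hd' y H2 Hy).
  assert (Hz : 0 < Rabs (y - x)) by (apply Rabs_pos_lt; lra).
  assert (E : Rabs ((y - x) * (l - l')) <= 2 * (Rabs (l - l') / 3) * Rabs (y - x)).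
  { replace ((y - x) * (l - l'))
      with (f y - f x - (y - x) * l' - (f y - f x - (y - x) * l)) by ring.
    eapply Rle_trans; [apply Rabs_triang|]; rewrite Rabs_Ropp; lra. }
  rewrite Rabs_mult in E; nra.
Qed.

Lemma deriv_eq (a b : R) (f : R -> R) (x l : R) :
  a < b -> a <= x <= b -> is_deriv a b f x l -> deriv a b f x = l.
Proof.
  intros Hab Hx H; unfold deriv.
  apply (iota_unique (is_deriv a b f x : R_CompleteNormedModule -> Prop)); [|exact H].
  intros y Hy; exact (is_deriv_unique a b f x y l Hab Hx Hy H).
Qed.

(* Continuity on [a,b], expressed through the extension by constants so that the library
   results on two-sided continuity and on integrals apply. *)
Definition cont (a b : R) (f : R -> R) : Prop :=
  forall x, continuous (fun y => f (clamp a b y)) x.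

Lemma cont_ext (a b : R) (f g : R -> R) : a <= b ->
  (forall x, a <= x <= b -> f x = g x) -> cont a b f -> cont a b g.
Proof.
  intros Hab H Hf x.
  apply (continuous_ext (fun y => f (clamp a b y))); [|apply Hf].
  intros y; apply H, clamp_bounds, Hab.
Qed.

Lemma cont_const (a b c : R) : cont a b (fun _ => c).
Proof. intros x; apply continuous_const. Qed.

Lemma cont_plus (a b : R) (f g : R -> R) :
  cont a b f -> cont a b g -> cont a b (fun x => f x + g x).
Proof.
  intros Hf Hg x; exact (continuous_plus (V := R_NormedModule) _ _ x (Hf x) (Hg x)).
Qed.

Lemma cont_mult (a b : R) (f g : R -> R) :
  cont a b f -> cont a b g -> cont a b (fun x => f x * g x).
Proof.
  intros Hf Hg x; exact (continuous_mult (K := R_AbsRing) _ _ x (Hf x) (Hg x)).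
Qed.

Lemma cont_abs (a b : R) (f : R -> R) : cont a b f -> cont a b (fun x => Rabs (f x)).
Proof. intros Hf x; exact (continuous_Rabs_comp _ x (Hf x)). Qed.

Lemma is_deriv_cont (a b : R) (f f' : R -> R) : a <= b ->
  (forall x, a <= x <= b -> is_deriv a b f x (f' x)) -> cont a b f.
Proof.
  intros Hab H x.
  pose proof (clamp_bounds a b x Hab) as Hc.
  destruct (proj1 (is_deriv_extension _ _ _ _ _ Hc) (H _ Hc)) as [g [Hg Hd]].
  apply (continuous_ext (fun y => g (clamp a b y))).
  { intros y; apply Hg, clamp_bounds, Hab. }
  apply (continuous_comp (clamp a b) g); [apply clamp_continuous|].
  exact (ex_derive_continuous (V := R_NormedModule) g _ (ex_intro _ _ Hd)).
Qed.

Lemma cont_bounded (a b : R) (f : R -> R) : a <= b -> cont a b f ->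
  exists M, 0 <= M /\ forall x, a <= x <= b -> Rabs (f x) <= M.
Proof.
  intros Hab Hf.
  destruct (continuity_ab_maj (fun x => Rabs (f (clamp a b x))) a b Hab) as [m [Hm _]].
  { intros c _; apply continuity_pt_filterlim; exact (cont_abs _ _ _ Hf c). }
  exists (Rabs (f (clamp a b m))); split; [apply Rabs_pos|].
  intros x Hx; rewrite <- (clamp_id a b x) by exact Hx; auto.
Qed.

Lemma cont_ex_RInt (a b c d : R) (f : R -> R) :
  a <= c -> c <= d -> d <= b -> cont a b f -> ex_RInt f c d.
Proof.
  intros H1 H2 H3 Hf.
  apply (ex_RInt_ext (fun y => f (clamp a b y))).
  - rewrite Rmin_left, Rmax_right by lra; intros x Hx; rewrite clamp_id by lra; reflexivity.
  - apply (ex_RInt_continuous (V := R_CompleteNormedModule)); intros z _; apply Hf.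
Qed.

Lemma is_deriv_RInt (a b : R) (f : R -> R) (x : R) : a <= x <= b -> cont a b f ->
  is_deriv a b (fun y => RInt f a y) x (f x).
Proof.
  intros Hx Hf; apply is_deriv_extension; [exact Hx|].
  exists (fun y => RInt (fun z => f (clamp a b z)) a y); split.
  - intros y Hy; apply RInt_ext; rewrite Rmin_left, Rmax_right by lra.
    intros z Hz; rewrite clamp_id by lra; reflexivity.
  - replace (f x) with (f (clamp a b x)) by (rewrite clamp_id by exact Hx; reflexivity).
    apply (is_derive_RInt (V := R_NormedModule) (fun z => f (clamp a b z)) _ a x); [|apply Hf].
    apply filter_forall; intros y.
    apply (RInt_correct (V := R_CompleteNormedModule)).
    apply (ex_RInt_continuous (V := R_CompleteNormedModule)); intros z _; apply Hf.
Qed.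

Lemma is_deriv_mean_value (a b : R) (F f : R -> R) (x y : R) :
  a <= x -> x <= y -> y <= b ->
  (forall z, a <= z <= b -> is_deriv a b F z (f z)) ->
  exists c, x <= c <= y /\ F y - F x = f c * (y - x).
Proof.
  intros Hx Hxy Hy H.
  destruct (MVT_gen (fun z => F (clamp a b z)) x y f) as [c [Hc E]].
  - rewrite Rmin_left, Rmax_right by lra; intros z Hz.
    apply (is_derive_ext_loc F).
    + generalize (locally_interval (fun y => a <= y <= b) z x y).
      intros HI; eapply filter_imp; [|apply HI; simpl; try lra].
      * intros w Hw; simpl in Hw; rewrite clamp_id; auto.
      * intros w H1 H2; simpl in *; lra.
    + apply (is_deriv_interior a b); [lra|apply H; lra].
  - intros z _; apply continuity_pt_filterlim.
    apply (is_deriv_cont a b F f); [lra|exact H].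
  - rewrite Rmin_left, Rmax_right in Hc by lra.
    exists c; split; [exact Hc|].
    rewrite <- E, !clamp_id by lra; reflexivity.
Qed.

Lemma is_deriv_zero_constant (a b : R) (F : R -> R) (x y : R) :
  (forall z, a <= z <= b -> is_deriv a b F z 0) ->
  a <= x <= b -> a <= y <= b -> F x = F y.
Proof.
  intros H.
  assert (W : forall x y, a <= x -> x <= y -> y <= b -> F x = F y).
  { intros u v H1 H2 H3.
    destruct (is_deriv_mean_value a b F (fun _ => 0) u v H1 H2 H3 H) as [c [_ E]]; lra. }
  intros Hx Hy; destruct (Rle_dec x y); [|symmetry]; apply W; lra.
Qed.

(** [F] and the primitive [RInt f a] have the same relative derivative, so their difference is
    constant. This is the form of the fundamental theorem that all integrations by parts below
    use. *)
Lemma RInt_is_deriv (a b : R) (F f : R -> R) (x : R) : a <= x <= b ->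
  (forall z, a <= z <= b -> is_deriv a b F z (f z)) -> cont a b f ->
  RInt f a x = F x - F a.
Proof.
  intros Hx H Hf.
  assert (E : F x - RInt f a x = F a - RInt f a a).
  { apply (is_deriv_zero_constant a b (fun z => F z - RInt f a z)); try lra.
    intros z Hz.
    destruct (proj1 (is_deriv_extension _ _ _ _ _ Hz) (H z Hz)) as [g [Hg Dg]].
    destruct (proj1 (is_deriv_extension _ _ _ _ _ Hz) (is_deriv_RInt a b f z Hz Hf))
      as [h [Hh Dh]].
    apply is_deriv_extension; [exact Hz|].
    exists (fun y => g y - h y); split.
    - intros y Hy; rewrite Hg, Hh by exact Hy; reflexivity.
    - replace 0 with (f z - f z) by ring.
      exact (is_derive_minus (V := R_NormedModule) g h z _ _ Dg Dh). }
  rewrite RInt_point in E; change (zero : R) with 0 in E; lra.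
Qed.

(** * Smooth functions and vector fields *)

Lemma is_deriv_const (a b c x : R) : a <= x <= b -> is_deriv a b (fun _ => c) x 0.
Proof. intros Hx; apply is_derive_is_deriv; [exact Hx|apply @is_derive_const]. Qed.

Lemma is_deriv_plus (a b : R) (f g : R -> R) (x l m : R) : a <= x <= b ->
  is_deriv a b f x l -> is_deriv a b g x m ->
  is_deriv a b (fun y => f y + g y) x (l + m).
Proof.
  intros Hx; rewrite !is_deriv_extension by exact Hx.
  intros [f1 [Hf Df]] [g1 [Hg Dg]]; exists (fun y => f1 y + g1 y); split.
  - intros y Hy; rewrite Hf, Hg by exact Hy; reflexivity.
  - exact (is_derive_plus (V := R_NormedModule) _ _ _ _ _ Df Dg).
Qed.

Lemma is_deriv_mult (a b : R) (f g : R -> R) (x l m : R) : a <= x <= b ->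
  is_deriv a b f x l -> is_deriv a b g x m ->
  is_deriv a b (fun y => f y * g y) x (l * g x + f x * m).
Proof.
  intros Hx; rewrite !is_deriv_extension by exact Hx.
  intros [f1 [Hf Df]] [g1 [Hg Dg]]; exists (fun y => f1 y * g1 y); split.
  - intros y Hy; rewrite Hf, Hg by exact Hy; reflexivity.
  - rewrite <- Hf, <- Hg by exact Hx.
    exact (is_derive_mult f1 g1 x l m Df Dg Rmult_comm).
Qed.

Lemma is_deriv_comp (a b : R) (phi f : R -> R) (x l m : R) : a <= x <= b ->
  is_derive phi (f x) m -> is_deriv a b f x l ->
  is_deriv a b (fun y => phi (f y)) x (m * l).
Proof.
  intros Hx Dphi; rewrite !is_deriv_extension by exact Hx.
  intros [f1 [Hf Df]]; exists (fun y => phi (f1 y)); split.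
  - intros y Hy; rewrite Hf by exact Hy; reflexivity.
  - rewrite <- Hf in Dphi by exact Hx; rewrite Rmult_comm.
    exact (is_derive_comp (V := R_NormedModule) phi f1 x m l Dphi Df).
Qed.

Lemma is_deriv_inv (a b : R) (f : R -> R) (x l : R) : a <= x <= b -> f x <> 0 ->
  is_deriv a b f x l -> is_deriv a b (fun y => / f y) x (- / f x ^ 2 * l).
Proof.
  intros Hx Hf H; apply (is_deriv_comp a b Rinv); [exact Hx| |exact H].
  auto_derive; [exact Hf|field; exact Hf].
Qed.

Lemma is_deriv_sqrt (a b : R) (f : R -> R) (x l : R) : a <= x <= b -> 0 < f x ->
  is_deriv a b f x l -> is_deriv a b (fun y => sqrt (f y)) x (/ (2 * sqrt (f x)) * l).
Proof.
  intros Hx Hf H; apply (is_deriv_comp a b sqrt); [exact Hx| |exact H].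
  auto_derive; [exact Hf|].
  field; apply Rgt_not_eq, sqrt_lt_R0, Hf.
Qed.

(** [smooth] speaks of iterates of [deriv], for which there is no closed formula under products or
    compositions. Here any function may serve as the derivative, so closure properties follow by
    induction on the order. *)
Fixpoint Ck (a b : R) (n : nat) (f : R -> R) : Prop :=
  match n with
  | O => cont a b f
  | S n => exists f', (forall x, a <= x <= b -> is_deriv a b f x (f' x)) /\ Ck a b n f'
  end.

Lemma Ck_ext (a b : R) (n : nat) (f g : R -> R) : a <= b ->
  (forall x, a <= x <= b -> f x = g x) -> Ck a b n f -> Ck a b n g.
Proof.
  intros Hab He; destruct n as [|n]; [exact (cont_ext a b f g Hab He)|].
  intros [f' [H Hf']]; exists f'; split; [|exact Hf'].
  intros x Hx; apply (is_deriv_ext a b f); auto.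
Qed.

Lemma Ck_pred (a b : R) (n : nat) (f : R -> R) : a <= b -> Ck a b (S n) f -> Ck a b n f.
Proof.
  intros Hab; revert f; induction n as [|n IH]; intros f [f' [H Hf']].
  - exact (is_deriv_cont a b f f' Hab H).
  - exists f'; auto.
Qed.

Lemma Ck_deriv (a b : R) (n : nat) (f : R -> R) : a < b ->
  Ck a b (S n) f -> Ck a b n (deriv a b f).
Proof.
  intros Hab [f' [H Hf']]; apply (Ck_ext a b n f'); [lra| |exact Hf'].
  intros x Hx; symmetry; apply deriv_eq; auto.
Qed.

Lemma smooth_Ck (a b : R) (f : R -> R) : a < b ->
  smooth a b f <-> forall n, Ck a b n f.
Proof.
  intros Hab.
  assert (D : forall g, (forall x, a <= x <= b -> exists l, is_deriv a b g x l) ->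
    forall x, a <= x <= b -> is_deriv a b g x (deriv a b g x)).
  { intros g H x Hx; destruct (H x Hx) as [l Hl].
    rewrite (deriv_eq a b g x l); auto. }
  split.
  - intros H n.
    (* Raising the order replaces a function by its derivative, so all iterates have to be treated
       at once. *)
    cut (forall k, Ck a b n (Nat.iter k (deriv a b) f)); [intros C; exact (C O)|].
    induction n as [|n IH]; intros k.
    + apply (is_deriv_cont a b _ (deriv a b (Nat.iter k (deriv a b) f))); [lra|].
      apply D, H.
    + exists (Nat.iter (S k) (deriv a b) f); split; [apply D, H|apply IH].
  - intros H n x Hx.
    assert (C : forall k m, Ck a b (k + m) f -> Ck a b m (Nat.iter k (deriv a b) f)).
    { induction k as [|k IH]; intros m Hm; [exact Hm|].
      apply Ck_deriv; [exact Hab|]; apply IH.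
      replace (k + S m)%nat with (S k + m)%nat by lia; exact Hm. }
    destruct (C n 1%nat (H _)) as [l [Hl _]]; eauto.
Qed.

Lemma Ck_const (a b : R) (n : nat) (c : R) : a <= b -> Ck a b n (fun _ => c).
Proof.
  intros Hab; revert c; induction n as [|n IH]; intros c; [apply cont_const|].
  exists (fun _ => 0); split; [intros; apply is_deriv_const; auto|apply IH].
Qed.

Lemma Ck_plus (a b : R) (n : nat) (f g : R -> R) :
  Ck a b n f -> Ck a b n g -> Ck a b n (fun x => f x + g x).
Proof.
  revert f g; induction n as [|n IH]; intros f g; [apply cont_plus|].
  intros [f' [Df Hf]] [g' [Dg Hg]]; exists (fun x => f' x + g' x); split; [|auto].
  intros x Hx; apply is_deriv_plus; auto.
Qed.

Lemma Ck_mult (a b : R) (n : nat) (f g : R -> R) : a <= b ->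
  Ck a b n f -> Ck a b n g -> Ck a b n (fun x => f x * g x).
Proof.
  intros Hab; revert f g; induction n as [|n IH]; intros f g; [apply cont_mult|].
  intros Cf Cg; pose proof (Ck_pred _ _ _ _ Hab Cf); pose proof (Ck_pred _ _ _ _ Hab Cg).
  destruct Cf as [f' [Df Hf]], Cg as [g' [Dg Hg]].
  exists (fun x => f' x * g x + f x * g' x); split; [|apply Ck_plus; auto].
  intros x Hx; apply is_deriv_mult; auto.
Qed.

(** The derivative is a product of [f'] with factors [/ f], and these are needed one order lower
    only, which is the induction hypothesis. The square root is handled in the same way. *)
Lemma Ck_inv (a b : R) (n : nat) (f : R -> R) : a <= b ->
  (forall x, a <= x <= b -> f x <> 0) -> Ck a b n f -> Ck a b n (fun x => / f x).
Proof.
  intros Hab H0; induction n as [|n IH]; intros Cf.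
  - intros x; apply continuous_Rinv_comp; [apply Cf|apply H0, clamp_bounds, Hab].
  - pose proof (IH (Ck_pred _ _ _ _ Hab Cf)) as Ci.
    destruct Cf as [f' [Df Hf]].
    exists (fun x => -1 * (/ f x * / f x) * f' x); split.
    + intros x Hx.
      replace (-1 * (/ f x * / f x) * f' x) with (- / f x ^ 2 * f' x)
        by (field; auto).
      apply is_deriv_inv; auto.
    + repeat apply Ck_mult; auto; apply Ck_const, Hab.
Qed.

Lemma Ck_sqrt (a b : R) (n : nat) (f : R -> R) : a <= b ->
  (forall x, a <= x <= b -> 0 < f x) -> Ck a b n f -> Ck a b n (fun x => sqrt (f x)).
Proof.
  intros Hab H0; induction n as [|n IH]; intros Cf.
  - intros x; apply continuous_sqrt_comp, Cf.
  - pose proof (IH (Ck_pred _ _ _ _ Hab Cf)) as Ci.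
    destruct Cf as [f' [Df Hf]].
    exists (fun x => / (2 * sqrt (f x)) * f' x); split.
    + intros x Hx; apply is_deriv_sqrt; auto.
    + apply Ck_mult; [exact Hab| |exact Hf].
      apply Ck_inv; [exact Hab| |apply Ck_mult; auto; apply Ck_const, Hab].
      intros x Hx; apply Rmult_integral_contrapositive_currified; [lra|].
      apply Rgt_not_eq, sqrt_lt_R0; auto.
Qed.

(** Each of the two functions occurs in the derivative of the other, so the inductions run
    together. *)
Lemma Ck_cos_sin (a b : R) (n : nat) (f : R -> R) : a <= b -> Ck a b n f ->
  Ck a b n (fun x => cos (f x)) /\ Ck a b n (fun x => sin (f x)).
Proof.
  intros Hab; induction n as [|n IH]; intros Cf.
  - split; intros x.
    + apply (continuous_comp (fun y => f (clamp a b y)) cos); [apply Cf|].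
      apply continuous_cos.
    + apply (continuous_comp (fun y => f (clamp a b y)) sin); [apply Cf|].
      apply continuous_sin.
  - destruct (IH (Ck_pred _ _ _ _ Hab Cf)) as [Cc Cs].
    destruct Cf as [f' [Df Hf]].
    split.
    + exists (fun x => -1 * sin (f x) * f' x); split.
      * intros x Hx; apply (is_deriv_comp a b cos); auto.
        auto_derive; [exact I|ring].
      * repeat apply Ck_mult; auto; apply Ck_const, Hab.
    + exists (fun x => cos (f x) * f' x); split; [|apply Ck_mult; auto].
      intros x Hx; apply (is_deriv_comp a b sin); auto.
      auto_derive; [exact I|ring].
Qed.

Lemma smooth_is_deriv (a b : R) (f : R -> R) (x : R) : a < b -> a <= x <= b ->
  smooth a b f -> is_deriv a b f x (deriv a b f x).
Proof.
  intros Hab Hx H; destruct (H O x Hx) as [l Hl]; simpl in Hl.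
  rewrite (deriv_eq a b f x l); auto.
Qed.

Lemma smooth_deriv (a b : R) (f : R -> R) : smooth a b f -> smooth a b (deriv a b f).
Proof.
  intros H n x Hx; rewrite <- Nat.iter_succ_r; exact (H (S n) x Hx).
Qed.

Lemma smooth_primitive (a b : R) (f f' : R -> R) : a < b ->
  (forall x, a <= x <= b -> is_deriv a b f x (f' x)) -> smooth a b f' -> smooth a b f.
Proof.
  intros Hab H Hf; rewrite smooth_Ck in * by exact Hab.
  intros [|n]; [exact (is_deriv_cont a b f f' (Rlt_le _ _ Hab) H)|].
  exists f'; auto.
Qed.

Lemma smooth_cont (a b : R) (f : R -> R) : a < b -> smooth a b f -> cont a b f.
Proof. intros Hab H; exact (proj1 (smooth_Ck a b f Hab) H O). Qed.

Lemma smooth_ext (a b : R) (f g : R -> R) : a < b ->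
  (forall x, a <= x <= b -> f x = g x) -> smooth a b f -> smooth a b g.
Proof.
  intros Hab H; rewrite !smooth_Ck by exact Hab; intros Hf n.
  apply (Ck_ext a b n f); auto; lra.
Qed.

Lemma smooth_const (a b c : R) : a < b -> smooth a b (fun _ => c).
Proof. intros Hab; rewrite smooth_Ck by exact Hab; intros n; apply Ck_const; lra. Qed.

Lemma smooth_plus (a b : R) (f g : R -> R) : a < b ->
  smooth a b f -> smooth a b g -> smooth a b (fun x => f x + g x).
Proof. intros Hab; rewrite !smooth_Ck by exact Hab; intros; apply Ck_plus; auto. Qed.

Lemma smooth_mult (a b : R) (f g : R -> R) : a < b ->
  smooth a b f -> smooth a b g -> smooth a b (fun x => f x * g x).
Proof. intros Hab; rewrite !smooth_Ck by exact Hab; intros; apply Ck_mult; auto; lra. Qed.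

Lemma smooth_opp (a b : R) (f : R -> R) : a < b ->
  smooth a b f -> smooth a b (fun x => - f x).
Proof.
  intros Hab Hf; apply (smooth_ext a b (fun x => -1 * f x)); [exact Hab|intros; ring|].
  apply smooth_mult; auto using smooth_const.
Qed.

Lemma smooth_minus (a b : R) (f g : R -> R) : a < b ->
  smooth a b f -> smooth a b g -> smooth a b (fun x => f x - g x).
Proof. intros Hab Hf Hg; apply smooth_plus; auto using smooth_opp. Qed.

Lemma smooth_inv (a b : R) (f : R -> R) : a < b ->
  (forall x, a <= x <= b -> f x <> 0) -> smooth a b f -> smooth a b (fun x => / f x).
Proof. intros Hab H0; rewrite !smooth_Ck by exact Hab; intros; apply Ck_inv; auto; lra. Qed.

Lemma smooth_sqrt (a b : R) (f : R -> R) : a < b ->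
  (forall x, a <= x <= b -> 0 < f x) -> smooth a b f -> smooth a b (fun x => sqrt (f x)).
Proof. intros Hab H0; rewrite !smooth_Ck by exact Hab; intros; apply Ck_sqrt; auto; lra. Qed.

Lemma smooth_cos (a b : R) (f : R -> R) : a < b ->
  smooth a b f -> smooth a b (fun x => cos (f x)).
Proof. intros Hab; rewrite !smooth_Ck by exact Hab; intros; apply Ck_cos_sin; auto; lra. Qed.

Lemma smooth_sin (a b : R) (f : R -> R) : a < b ->
  smooth a b f -> smooth a b (fun x => sin (f x)).
Proof. intros Hab; rewrite !smooth_Ck by exact Hab; intros; apply Ck_cos_sin; auto; lra. Qed.

(** * Componentwise calculus of vector fields *)

Definition is_deriv3 (a b : R) (g : R -> R3) (x : R) (l : R3) : Prop :=
  is_deriv a b (fun y => c1 (g y)) x (c1 l) /\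
  is_deriv a b (fun y => c2 (g y)) x (c2 l) /\
  is_deriv a b (fun y => c3 (g y)) x (c3 l).

Lemma eq3 (v w : R3) : c1 v = c1 w -> c2 v = c2 w -> c3 v = c3 w -> v = w.
Proof.
  destruct v as [[v1 v2] v3], w as [[w1 w2] w3]; unfold c1, c2, c3; simpl.
  intros -> -> ->; reflexivity.
Qed.

Lemma deriv3_eq (a b : R) (g : R -> R3) (x : R) (l : R3) :
  a < b -> a <= x <= b -> is_deriv3 a b g x l -> deriv3 a b g x = l.
Proof.
  intros Hab Hx [H1 [H2 H3]]; apply eq3; unfold deriv3, c1, c2, c3; simpl;
    apply deriv_eq; assumption.
Qed.

Lemma smooth_is_deriv3 (a b : R) (g : R -> R3) (x : R) : a < b -> a <= x <= b ->
  smooth3 a b g -> is_deriv3 a b g x (deriv3 a b g x).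
Proof.
  intros Hab Hx [H1 [H2 H3]].
  split; [|split]; apply smooth_is_deriv; assumption.
Qed.

Lemma smooth3_deriv (a b : R) (g : R -> R3) :
  smooth3 a b g -> smooth3 a b (deriv3 a b g).
Proof.
  intros [H1 [H2 H3]]; split; [|split]; apply smooth_deriv; assumption.
Qed.

Lemma smooth3_primitive (a b : R) (g g' : R -> R3) : a < b ->
  (forall x, a <= x <= b -> is_deriv3 a b g x (g' x)) ->
  smooth3 a b g' -> smooth3 a b g.
Proof.
  intros Hab H [H1 [H2 H3]]; split; [|split];
    (eapply smooth_primitive; [exact Hab|intros x Hx; apply (H x Hx)|assumption]).
Qed.

Lemma is_deriv3_ext (a b : R) (f g : R -> R3) (x : R) (l : R3) :
  a <= x <= b -> (forall y, a <= y <= b -> f y = g y) ->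
  is_deriv3 a b f x l -> is_deriv3 a b g x l.
Proof.
  intros Hx He [H1 [H2 H3]]; split; [|split];
    [revert H1|revert H2|revert H3]; apply is_deriv_ext; try exact Hx;
    intros y Hy; rewrite He by exact Hy; reflexivity.
Qed.

Lemma smooth3_ext (a b : R) (f g : R -> R3) : a < b ->
  (forall x, a <= x <= b -> f x = g x) -> smooth3 a b f -> smooth3 a b g.
Proof.
  intros Hab He [H1 [H2 H3]]; split; [|split];
    [revert H1|revert H2|revert H3]; apply smooth_ext; try exact Hab;
    intros y Hy; rewrite He by exact Hy; reflexivity.
Qed.

Ltac split3 := split; [|split].

Lemma is_deriv3_const (a b : R) (v : R3) (x : R) : a <= x <= b ->
  is_deriv3 a b (fun _ => v) x zero3.
Proof. intros Hx; split3; apply (is_deriv_const a b _ x Hx). Qed.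

Lemma is_deriv3_add (a b : R) (f g : R -> R3) (x : R) (l m : R3) : a <= x <= b ->
  is_deriv3 a b f x l -> is_deriv3 a b g x m ->
  is_deriv3 a b (fun y => f y +v g y) x (l +v m).
Proof.
  intros Hx [F1 [F2 F3]] [G1 [G2 G3]]; split3;
    [exact (is_deriv_plus a b _ _ x _ _ Hx F1 G1)
    |exact (is_deriv_plus a b _ _ x _ _ Hx F2 G2)
    |exact (is_deriv_plus a b _ _ x _ _ Hx F3 G3)].
Qed.

Lemma is_deriv3_scale (a b : R) (k : R -> R) (g : R -> R3) (x l : R) (m : R3) :
  a <= x <= b -> is_deriv a b k x l -> is_deriv3 a b g x m ->
  is_deriv3 a b (fun y => k y *v g y) x (l *v g x +v k x *v m).
Proof.
  intros Hx K [G1 [G2 G3]]; split3;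
    [exact (is_deriv_mult a b _ _ x _ _ Hx K G1)
    |exact (is_deriv_mult a b _ _ x _ _ Hx K G2)
    |exact (is_deriv_mult a b _ _ x _ _ Hx K G3)].
Qed.

Lemma is_deriv_opp (a b : R) (f : R -> R) (x l : R) : a <= x <= b ->
  is_deriv a b f x l -> is_deriv a b (fun y => - f y) x (- l).
Proof.
  intros Hx H; replace (- l) with (0 * f x + -1 * l) by ring.
  apply (is_deriv_ext a b (fun y => -1 * f y)); [exact Hx|intros; ring|].
  apply is_deriv_mult; auto using is_deriv_const.
Qed.

Lemma is_deriv_minus (a b : R) (f g : R -> R) (x l m : R) : a <= x <= b ->
  is_deriv a b f x l -> is_deriv a b g x m ->
  is_deriv a b (fun y => f y - g y) x (l - m).
Proof. intros Hx Hf Hg; apply is_deriv_plus; auto using is_deriv_opp. Qed.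

Lemma is_deriv3_sub (a b : R) (f g : R -> R3) (x : R) (l m : R3) : a <= x <= b ->
  is_deriv3 a b f x l -> is_deriv3 a b g x m ->
  is_deriv3 a b (fun y => f y -v g y) x (l -v m).
Proof.
  intros Hx [F1 [F2 F3]] [G1 [G2 G3]]; split3;
    [exact (is_deriv_minus a b _ _ x _ _ Hx F1 G1)
    |exact (is_deriv_minus a b _ _ x _ _ Hx F2 G2)
    |exact (is_deriv_minus a b _ _ x _ _ Hx F3 G3)].
Qed.

Lemma is_deriv_dot (a b : R) (f g : R -> R3) (x : R) (l m : R3) : a <= x <= b ->
  is_deriv3 a b f x l -> is_deriv3 a b g x m ->
  is_deriv a b (fun y => dot (f y) (g y)) x (dot l (g x) + dot (f x) m).
Proof.
  intros Hx [F1 [F2 F3]] [G1 [G2 G3]]; unfold dot.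
  match goal with |- is_deriv _ _ _ _ ?r => replace r with
    (c1 l * c1 (g x) + c1 (f x) * c1 m + (c2 l * c2 (g x) + c2 (f x) * c2 m)
     + (c3 l * c3 (g x) + c3 (f x) * c3 m)) by ring end.
  apply is_deriv_plus; [exact Hx|apply is_deriv_plus; [exact Hx| |]|].
  - exact (is_deriv_mult a b _ _ x _ _ Hx F1 G1).
  - exact (is_deriv_mult a b _ _ x _ _ Hx F2 G2).
  - exact (is_deriv_mult a b _ _ x _ _ Hx F3 G3).
Qed.

Lemma is_deriv3_cross (a b : R) (f g : R -> R3) (x : R) (l m : R3) : a <= x <= b ->
  is_deriv3 a b f x l -> is_deriv3 a b g x m ->
  is_deriv3 a b (fun y => cross (f y) (g y)) x (cross l (g x) +v cross (f x) m).
Proof.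
  intros Hx [F1 [F2 F3]] [G1 [G2 G3]].
  assert (E : forall p q r s p' q' r' s', is_deriv a b p x p' -> is_deriv a b q x q' ->
    is_deriv a b r x r' -> is_deriv a b s x s' ->
    is_deriv a b (fun y => p y * q y - r y * s y) x
      (p' * q x - r' * s x + (p x * q' - r x * s'))).
  { intros p q r s p' q' r' s' Hp Hq Hr Hs.
    replace (p' * q x - r' * s x + (p x * q' - r x * s'))
      with (p' * q x + p x * q' - (r' * s x + r x * s')) by ring.
    apply is_deriv_minus; auto; apply is_deriv_mult; auto. }
  split3; [exact (E _ _ _ _ _ _ _ _ F2 G3 F3 G2)
          |exact (E _ _ _ _ _ _ _ _ F3 G1 F1 G3)
          |exact (E _ _ _ _ _ _ _ _ F1 G2 F2 G1)].
Qed.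

Lemma smooth3_const (a b : R) (v : R3) : a < b -> smooth3 a b (fun _ => v).
Proof. intros Hab; split3; apply smooth_const, Hab. Qed.

Lemma smooth3_add (a b : R) (f g : R -> R3) : a < b ->
  smooth3 a b f -> smooth3 a b g -> smooth3 a b (fun x => f x +v g x).
Proof.
  intros Hab [F1 [F2 F3]] [G1 [G2 G3]]; split3;
    [exact (smooth_plus a b _ _ Hab F1 G1)
    |exact (smooth_plus a b _ _ Hab F2 G2)
    |exact (smooth_plus a b _ _ Hab F3 G3)].
Qed.

Lemma smooth3_sub (a b : R) (f g : R -> R3) : a < b ->
  smooth3 a b f -> smooth3 a b g -> smooth3 a b (fun x => f x -v g x).
Proof.
  intros Hab [F1 [F2 F3]] [G1 [G2 G3]]; split3;
    [exact (smooth_minus a b _ _ Hab F1 G1)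
    |exact (smooth_minus a b _ _ Hab F2 G2)
    |exact (smooth_minus a b _ _ Hab F3 G3)].
Qed.

Lemma smooth3_scale (a b : R) (k : R -> R) (g : R -> R3) : a < b ->
  smooth a b k -> smooth3 a b g -> smooth3 a b (fun x => k x *v g x).
Proof.
  intros Hab K [G1 [G2 G3]]; split3;
    [exact (smooth_mult a b _ _ Hab K G1)
    |exact (smooth_mult a b _ _ Hab K G2)
    |exact (smooth_mult a b _ _ Hab K G3)].
Qed.

Lemma smooth_dot (a b : R) (f g : R -> R3) : a < b ->
  smooth3 a b f -> smooth3 a b g -> smooth a b (fun x => dot (f x) (g x)).
Proof.
  intros Hab [F1 [F2 F3]] [G1 [G2 G3]]; unfold dot.
  apply smooth_plus; [exact Hab|apply smooth_plus; [exact Hab| |]|];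
    apply smooth_mult; assumption.
Qed.

Lemma smooth3_cross (a b : R) (f g : R -> R3) : a < b ->
  smooth3 a b f -> smooth3 a b g -> smooth3 a b (fun x => cross (f x) (g x)).
Proof.
  intros Hab [F1 [F2 F3]] [G1 [G2 G3]].
  split3; unfold cross, c1 at 1, c2 at 1, c3 at 1; simpl;
    (apply smooth_minus; [exact Hab| |]; apply smooth_mult; assumption).
Qed.

(** * Parallel transport *)

Lemma geometric_small (L eps : R) : 0 < eps -> exists n, L * (1 / 2) ^ n < eps.
Proof.
  intros He.
  destruct (pow_lt_1_zero (1 / 2)) with (y := eps / (Rabs L + 1)) as [n Hn].
  - rewrite Rabs_right; lra.
  - apply Rdiv_lt_0_compat; [exact He|generalize (Rabs_pos L); lra].
  - exists n; specialize (Hn n (le_n n)).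
    assert (Hp : 0 < (1 / 2) ^ n) by (apply pow_lt; lra).
    rewrite Rabs_right in Hn by lra.
    pose proof (Rabs_pos L); pose proof (Rle_abs L).
    apply (Rmult_lt_compat_l (Rabs L + 1)) in Hn; [|lra].
    replace ((Rabs L + 1) * (eps / (Rabs L + 1))) with eps in Hn by (field; lra).
    nra.
Qed.

(* Picard iteration contracts by the factor [1/2] in the norm weighted by [exp (- c (x - a))]. *)
Lemma volterra_fixed_point (a b C : R) (Op : (R -> R) -> R -> R) :
  a < b -> 0 <= C ->
  (forall f, cont a b f -> cont a b (Op f)) ->
  (forall f g x, cont a b f -> cont a b g -> a <= x <= b ->
     Rabs (Op f x - Op g x) <= C * RInt (fun y => Rabs (f y - g y)) a x) ->
  exists f, cont a b f /\ forall x, a <= x <= b -> Op f x = f x.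
Proof.
  intros Hab HC Hcont Hlip.
  (* Integrating [exp (c * (y - a))] yields a factor [1 / c], and [C / c <= 1 / 2]; the summand 1
     keeps [c] positive when [C = 0]. *)
  set (c := 2 * C + 1).
  set (u := fun n => Nat.iter n Op (fun _ => 0)).
  assert (Hu : forall n, cont a b (u n)).
  { induction n as [|n IH]; [exact (cont_const a b 0)|exact (Hcont _ IH)]. }
  assert (Hsub : forall f g, cont a b f -> cont a b g ->
                 cont a b (fun y => Rabs (f y - g y))).
  { intros f g Hf Hg; apply cont_abs.
    apply (cont_ext a b (fun y => f y + -1 * g y)); [lra|intros; ring|].
    apply cont_plus; [exact Hf|apply cont_mult; [apply cont_const|exact Hg]]. }
  destruct (cont_bounded a b (u 1%nat) (Rlt_le _ _ Hab) (Hu 1%nat)) as [M [HM0 HM]].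
  assert (Hexp : forall x, a <= x -> 1 <= exp (c * (x - a))).
  { intros x Hx; rewrite <- exp_0; destruct Hx as [Hx| <-].
    - left; apply exp_increasing, Rmult_lt_0_compat; [unfold c; lra|lra].
    - apply Req_le; f_equal; ring. }
  assert (Hstep : forall n x, a <= x <= b ->
    Rabs (u (S n) x - u n x) <= M * (1 / 2) ^ n * exp (c * (x - a))).
  { induction n as [|n IH]; intros x Hx.
    - specialize (HM x Hx); specialize (Hexp x (proj1 Hx)).
      change (u 0%nat x) with 0; simpl; rewrite Rminus_0_r.
      replace (M * 1 * exp (c * (x - a))) with (M + M * (exp (c * (x - a)) - 1)) by ring.
      assert (0 <= M * (exp (c * (x - a)) - 1)) by (apply Rmult_le_pos; lra).
      change (Op (fun _ : R => 0) x) with (u 1%nat x); lra.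
    - change (u (S (S n)) x - u (S n) x) with (Op (u (S n)) x - Op (u n) x).
      eapply Rle_trans; [apply Hlip; auto|].
      assert (Hp : 0 < (1 / 2) ^ n) by (apply pow_lt; lra).
      assert (Hi : is_RInt (fun y => M * (1 / 2) ^ n * exp (c * (y - a))) a x
                     (M * (1 / 2) ^ n * exp (c * (x - a)) / c
                      - M * (1 / 2) ^ n * exp (c * (a - a)) / c)).
      { apply (is_RInt_derive (V := R_CompleteNormedModule)
                 (fun y => M * (1 / 2) ^ n * exp (c * (y - a)) / c)); intros y _.
        - auto_derive; [exact I|fold (y - a); field; unfold c; lra].
        - apply (ex_derive_continuous (V := R_NormedModule)); auto_derive; exact I. }
      assert (Hle : RInt (fun y => Rabs (u (S n) y - u n y)) a x
                <= M * (1 / 2) ^ n * exp (c * (x - a)) / c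
                   - M * (1 / 2) ^ n * exp (c * (a - a)) / c).
      { rewrite <- (is_RInt_unique _ _ _ _ Hi).
        apply RInt_le; [lra| |eexists; exact Hi|intros y Hy; apply IH; lra].
        apply (cont_ex_RInt a b); try lra; apply Hsub; apply Hu. }
      assert (0 <= M * (1 / 2) ^ n * exp (c * (a - a)) / c).
      { apply Rmult_le_pos; [|left; apply Rinv_0_lt_compat; unfold c; lra].
        apply Rmult_le_pos; [nra|left; apply exp_pos]. }
      apply Rle_trans with (C * (M * (1 / 2) ^ n * exp (c * (x - a)) / c)).
      { apply Rmult_le_compat_l; lra. }
      assert (0 <= M * (1 / 2) ^ n * exp (c * (x - a))).
      { apply Rmult_le_pos; [nra|left; apply exp_pos]. }
      replace (C * (M * (1 / 2) ^ n * exp (c * (x - a)) / c))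
        with (C / c * (M * (1 / 2) ^ n * exp (c * (x - a)))) by (field; unfold c; lra).
      replace (M * (1 / 2) ^ S n * exp (c * (x - a)))
        with (1 / 2 * (M * (1 / 2) ^ n * exp (c * (x - a)))) by (simpl; ring).
      apply Rmult_le_compat_r; [assumption|].
      apply (Rmult_le_reg_r c); [unfold c; lra|].
      unfold Rdiv at 1; rewrite Rmult_assoc, Rinv_l; unfold c; lra. }
  set (K := M * exp (c * (b - a))).
  (* The partial sum of the geometric series is kept exact, because its limit [2 * K * (1 / 2) ^ n]
     alone would not survive the induction on [k]. *)
  assert (HK : forall n k x, a <= x <= b ->
            Rabs (u (n + k)%nat x - u n x) <= 2 * K * (1 / 2) ^ n * (1 - (1 / 2) ^ k)).
  { intros n; induction k as [|k IH]; intros x Hx.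
    - rewrite Nat.add_0_r, Rminus_diag, Rabs_R0; simpl; lra.
    - rewrite Nat.add_succ_r.
      replace (u (S (n + k)) x - u n x)
        with (u (S (n + k)) x - u (n + k)%nat x + (u (n + k)%nat x - u n x)) by ring.
      eapply Rle_trans; [apply Rabs_triang|].
      assert (E : Rabs (u (S (n + k)) x - u (n + k)%nat x) <= K * (1 / 2) ^ (n + k)).
      { eapply Rle_trans; [apply Hstep, Hx|].
        unfold K; replace (M * exp (c * (b - a)) * (1 / 2) ^ (n + k))
          with (M * (1 / 2) ^ (n + k) * exp (c * (b - a))) by ring.
        apply Rmult_le_compat_l.
        - apply Rmult_le_pos; [exact HM0|apply pow_le; lra].
        - destruct (proj2 Hx) as [Hlt| ->]; [|lra].
          left; apply exp_increasing, Rmult_lt_compat_l; unfold c; lra. }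
      rewrite pow_add in E; specialize (IH x Hx); rewrite <- tech_pow_Rmult.
      revert E IH; generalize ((1 / 2) ^ n) ((1 / 2) ^ k); intros p q E IH; lra. }
  assert (HK0 : 0 <= K).
  { apply Rmult_le_pos; [exact HM0|left; apply exp_pos]. }
  assert (HK2 : forall n m x, (n <= m)%nat -> a <= x <= b ->
            Rabs (u m x - u n x) <= 2 * K * (1 / 2) ^ n).
  { intros n m x Hnm Hx; replace m with (n + (m - n))%nat by lia.
    eapply Rle_trans; [apply HK, Hx|].
    assert (0 < (1 / 2) ^ n) by (apply pow_lt; lra).
    assert (0 < (1 / 2) ^ (m - n)) by (apply pow_lt; lra).
    assert (0 <= 2 * K * (1 / 2) ^ n) by (apply Rmult_le_pos; lra).
    nra. }
  set (f := fun x => real (Lim_seq (fun n => u n x))).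
  assert (Hf : forall n x, a <= x <= b -> Rabs (f x - u n x) <= 2 * K * (1 / 2) ^ n).
  { intros n x Hx.
    assert (HL : is_lim_seq (fun m => u m x) (f x)).
    { apply Lim_seq_correct', ex_lim_seq_cauchy_corr; intros eps.
      destruct (geometric_small (4 * K) eps (cond_pos eps)) as [N HN].
      exists N; intros m p Hm Hp.
      replace (u m x - u p x) with (u m x - u N x - (u p x - u N x)) by ring.
      eapply Rle_lt_trans; [apply Rabs_triang|]; rewrite Rabs_Ropp.
      pose proof (HK2 N m x Hm Hx); pose proof (HK2 N p x Hp Hx); lra. }
    apply (is_lim_seq_le_loc (fun m => Rabs (u m x - u n x)) (fun _ => 2 * K * (1 / 2) ^ n)
             (Rabs (f x - u n x)) (2 * K * (1 / 2) ^ n)).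
    - exists n; intros m Hm; apply HK2; assumption.
    - apply (is_lim_seq_abs (fun m => u m x - u n x) (Finite (f x - u n x))).
      apply is_lim_seq_minus'; [exact HL|apply is_lim_seq_const].
    - apply is_lim_seq_const. }
  (* A uniform limit of continuous functions: one third of [eps] for the iterate and one for each of
     the two approximation errors. *)
  assert (Cf : cont a b f).
  { intros x; apply filterlim_locally; intros eps.
    destruct (geometric_small (2 * K) (eps / 3)) as [n Hn].
    { generalize (cond_pos eps); lra. }
    assert (He : 0 < eps / 3) by (generalize (cond_pos eps); lra).
    destruct (proj1 (filterlim_locally _ _) (Hu n x) (mkposreal _ He)) as [d Hd].
    exists d; intros y Hy; specialize (Hd y Hy).
    change (Rabs (u n (clamp a b y) - u n (clamp a b x)) < eps / 3) in Hd.
    change (Rabs (f (clamp a b y) - f (clamp a b x)) < eps).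
    assert (Hab' : a <= b) by lra.
    pose proof (Hf n _ (clamp_bounds a b y Hab')) as H1.
    pose proof (Hf n _ (clamp_bounds a b x Hab')) as H2.
    set (y' := clamp a b y) in *; set (x' := clamp a b x) in *.
    replace (f y' - f x')
      with ((f y' - u n y') + ((u n y' - u n x') - (f x' - u n x'))) by ring.
    eapply Rle_lt_trans; [apply Rabs_triang|].
    eapply Rle_lt_trans; [apply Rplus_le_compat_l, Rabs_triang|].
    rewrite Rabs_Ropp; lra. }
  exists f; split; [exact Cf|intros x Hx].
  apply Rminus_diag_uniq, NNPP; intros Hne; apply Rabs_pos_lt in Hne.
  (* [Op f] is close to [Op (u n) = u (S n)] by the Lipschitz bound and [f] is close to [u (S n)] by
     convergence; the factor [C * (b - a) + 1] collects both errors. *)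
  destruct (geometric_small ((C * (b - a) + 1) * (2 * K)) _ Hne) as [n Hn].
  assert (H1 : Rabs (Op f x - u (S n) x) <= C * ((b - a) * (2 * K * (1 / 2) ^ n))).
  { eapply Rle_trans; [apply (Hlip f (u n)); auto|].
    apply Rmult_le_compat_l; [exact HC|].
    assert (H0 : ex_RInt (fun y => Rabs (f y - u n y)) a x).
    { apply (cont_ex_RInt a b); try lra; apply Hsub; auto. }
    assert (0 <= 2 * K * (1 / 2) ^ n).
    { apply Rmult_le_pos; [lra|apply pow_le; lra]. }
    apply Rle_trans with ((x - a) * (2 * K * (1 / 2) ^ n)); [|nra].
    eapply Rle_trans; [apply Rle_abs|].
    apply abs_RInt_le_const; [lra|exact H0|].
    intros y Hy; rewrite Rabs_Rabsolu; apply Hf; lra. }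
  pose proof (Hf (S n) x Hx) as H2; simpl in H2.
  replace (Op f x - f x) with (Op f x - u (S n) x - (f x - u (S n) x)) in Hn by ring.
  pose proof (Rabs_triang (Op f x - u (S n) x) (- (f x - u (S n) x))) as H3.
  rewrite Rabs_Ropp in H3.
  assert (0 <= K * (1 / 2) ^ n) by (apply Rmult_le_pos; [lra|apply pow_le; lra]).
  change (Op (u n) x) with (u (S n) x) in *.
  unfold Rminus in *; lra.
Qed.

Ltac unfold3 := unfold dot, cross, add3, sub3, scale3, zero3, c1, c2, c3 in *; simpl in *.

Lemma dot_pos (v : R3) : v <> zero3 -> 0 < dot v v.
Proof.
  destruct v as [[x y] z]; unfold3; intros Hv.
  apply Rnot_le_lt; intros H; apply Hv; repeat f_equal; nra.
Qed.

Lemma norm3_eq_1 (v : R3) : norm3 v = 1 <-> dot v v = 1.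
Proof.
  unfold norm3; split; intros H.
  - assert (H0 : 0 <= dot v v) by (unfold dot; nra).
    rewrite <- (sqrt_sqrt _ H0), H; ring.
  - rewrite H; apply sqrt_1.
Qed.

(** The kernel [p x * q y] is bounded by the product of bounds for [p] and [q]. Up to sign and an
    inhomogeneous term, the operator of parallel transport is a sum of three such terms, one for
    each coordinate. *)
Lemma integral_operator_lipschitz (a b : R) (p q : R -> R) :
  a < b -> cont a b p -> cont a b q ->
  exists C, 0 <= C /\ forall f g x, cont a b f -> cont a b g -> a <= x <= b ->
    Rabs (p x * RInt (fun y => f y * q y) a x - p x * RInt (fun y => g y * q y) a x)
    <= C * RInt (fun y => Rabs (f y - g y)) a x.
Proof.
  intros Hab Hp Hq.
  destruct (cont_bounded a b p (Rlt_le _ _ Hab) Hp) as [P [HP0 HP]].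
  destruct (cont_bounded a b q (Rlt_le _ _ Hab) Hq) as [Q [HQ0 HQ]].
  exists (P * Q); split; [apply Rmult_le_pos; assumption|].
  intros f g x Hf Hg Hx.
  assert (If : ex_RInt (fun y => f y * q y) a x).
  { apply (cont_ex_RInt a b); try lra; apply cont_mult; assumption. }
  assert (Ig : ex_RInt (fun y => g y * q y) a x).
  { apply (cont_ex_RInt a b); try lra; apply cont_mult; assumption. }
  assert (Hd : cont a b (fun y => f y - g y)).
  { apply (cont_ext a b (fun y => f y + -1 * g y)); [lra|intros; ring|].
    apply cont_plus; [exact Hf|apply cont_mult; [apply cont_const|exact Hg]]. }
  assert (Id : ex_RInt (fun y => Rabs (f y - g y)) a x).
  { apply (cont_ex_RInt a b); try lra; apply cont_abs, Hd. }
  rewrite <- Rmult_minus_distr_l, Rabs_mult, Rmult_assoc.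
  apply Rmult_le_compat; [apply Rabs_pos|apply Rabs_pos|apply HP, Hx|].
  replace (RInt (fun y => f y * q y) a x - RInt (fun y => g y * q y) a x)
    with (RInt (fun y => minus (f y * q y) (g y * q y)) a x)
    by exact (RInt_minus (V := R_CompleteNormedModule) _ _ a x If Ig).
  replace (Q * RInt (fun y => Rabs (f y - g y)) a x)
    with (RInt (fun y => scal Q (Rabs (f y - g y))) a x)
    by exact (RInt_scal (V := R_CompleteNormedModule) _ a x Q Id).
  assert (Im : ex_RInt (fun y => minus (f y * q y) (g y * q y)) a x)
    by exact (ex_RInt_minus (V := R_NormedModule) _ _ a x If Ig).
  eapply Rle_trans; [apply abs_RInt_le; [lra|exact Im]|].
  apply RInt_le; [lra| | |].
  - exact (ex_RInt_norm _ _ _ Im).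
  - exact (ex_RInt_scal (V := R_NormedModule) _ _ _ Q Id).
  - intros y Hy; change (Rabs (f y * q y - g y * q y) <= Q * Rabs (f y - g y)).
    rewrite <- Rmult_minus_distr_r, Rabs_mult, Rmult_comm.
    apply Rmult_le_compat_r; [apply Rabs_pos|apply HQ; lra].
Qed.

(* A parallel field [Z] with [Z' = lambda T] and [Z a = W] amounts to the scalar Volterra
   equation [lambda x = - <W + int_a^x lambda T, T' x>]. *)
Lemma parallel_transport_exists (a b : R) (T : R -> R3) (W : R3) :
  a < b -> smooth3 a b T -> (forall x, a <= x <= b -> dot (T x) (T x) = 1) ->
  dot W (T a) = 0 ->
  exists (Z : R -> R3) (lambda : R -> R),
    smooth3 a b Z /\ smooth a b lambda /\ Z a = W /\
    forall x, a <= x <= b ->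
      is_deriv3 a b Z x (lambda x *v T x) /\ dot (Z x) (T x) = 0 /\
      dot (Z x) (Z x) = dot W W.
Proof.
  intros Hab HT HT1 HW.
  set (T' := deriv3 a b T).
  pose proof (smooth3_deriv a b T HT) as HT'; fold T' in HT'.
  pose proof HT as [Q1 [Q2 Q3]]; pose proof HT' as [P1 [P2 P3]].
  apply smooth_cont in Q1, Q2, Q3, P1, P2, P3; try exact Hab.
  set (J := fun (c : R3 -> R) f x => RInt (fun y => f y * c (T y)) a x).
  set (Op := fun f x => - dot W (T' x) - (c1 (T' x) * J c1 f x + c2 (T' x) * J c2 f x
                                          + c3 (T' x) * J c3 f x)).
  assert (HJ : forall c f x, cont a b (fun y => c (T y)) -> cont a b f -> a <= x <= b ->
            is_deriv a b (J c f) x (f x * c (T x))).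
  { intros c f x Hc Hf Hx; apply (is_deriv_RInt a b (fun y => f y * c (T y)) x Hx).
    apply cont_mult; assumption. }
  destruct (integral_operator_lipschitz a b _ _ Hab P1 Q1) as [C1 [HC1 L1]].
  destruct (integral_operator_lipschitz a b _ _ Hab P2 Q2) as [C2 [HC2 L2]].
  destruct (integral_operator_lipschitz a b _ _ Hab P3 Q3) as [C3 [HC3 L3]].
  destruct (volterra_fixed_point a b (C1 + C2 + C3) Op Hab) as [l [Cl El]].
  { lra. }
  { intros f Hf.
    assert (HcJ : forall c, cont a b (fun y => c (T y)) -> cont a b (J c f)).
    { intros c Hc; apply (is_deriv_cont a b _ (fun x => f x * c (T x))); [lra|auto]. }
    apply (cont_ext a b (fun x => -1 * (dot W (T' x) + (c1 (T' x) * J c1 f x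
             + c2 (T' x) * J c2 f x + c3 (T' x) * J c3 f x)))).
    { lra. }
    { intros; unfold Op; ring. }
    apply cont_mult; [apply cont_const|].
    apply cont_plus; (apply cont_plus; [apply cont_plus|]).
    - exact (cont_mult a b _ _ (cont_const a b (c1 W)) P1).
    - exact (cont_mult a b _ _ (cont_const a b (c2 W)) P2).
    - exact (cont_mult a b _ _ (cont_const a b (c3 W)) P3).
    - exact (cont_mult a b _ _ P1 (HcJ c1 Q1)).
    - exact (cont_mult a b _ _ P2 (HcJ c2 Q2)).
    - exact (cont_mult a b _ _ P3 (HcJ c3 Q3)). }
  { intros f g x Hf Hg Hx.
    specialize (L1 f g x Hf Hg Hx); specialize (L2 f g x Hf Hg Hx);
      specialize (L3 f g x Hf Hg Hx).
    fold T' in L1, L2, L3.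
    change (RInt (fun y => f y * c1 (T y)) a x) with (J c1 f x) in L1.
    change (RInt (fun y => f y * c2 (T y)) a x) with (J c2 f x) in L2.
    change (RInt (fun y => f y * c3 (T y)) a x) with (J c3 f x) in L3.
    change (RInt (fun y => g y * c1 (T y)) a x) with (J c1 g x) in L1.
    change (RInt (fun y => g y * c2 (T y)) a x) with (J c2 g x) in L2.
    change (RInt (fun y => g y * c3 (T y)) a x) with (J c3 g x) in L3.
    unfold Op.
    match type of L1 with Rabs ?u1 <= _ => match type of L2 with Rabs ?u2 <= _ =>
      match type of L3 with Rabs ?u3 <= _ => match goal with |- Rabs ?v <= _ =>
        replace v with (- (u1 + u2 + u3)) by ring;
        rewrite Rabs_Ropp;
        pose proof (Rabs_triang (u1 + u2) u3); pose proof (Rabs_triang u1 u2)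
      end end end end.
    lra. }
  set (Z := fun x => (c1 W + J c1 l x, c2 W + J c2 l x, c3 W + J c3 l x) : R3).
  assert (DZ : forall x, a <= x <= b -> is_deriv3 a b Z x (l x *v T x)).
  { assert (D : forall (w : R) c x, cont a b (fun y => c (T y)) -> a <= x <= b ->
              is_deriv a b (fun y => w + J c l y) x (l x * c (T x))).
    { intros w c x Hc Hx; rewrite <- (Rplus_0_l (l x * c (T x))).
      apply is_deriv_plus; auto using is_deriv_const. }
    intros x Hx; split3; [apply (D _ c1)|apply (D _ c2)|apply (D _ c3)]; assumption. }
  assert (Ez : forall x, a <= x <= b -> l x = - dot (Z x) (T' x)).
  { intros x Hx; rewrite <- El by exact Hx.
    unfold Op, dot, Z, c1 at 4, c2 at 4, c3 at 4; simpl; unfold c1, c2, c3; simpl; ring. }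
  (* Bootstrapping: if [l] is of class C^n, then [Z' = l T] makes [Z] of class C^(n+1), and
     [l = - <Z, T'>] passes this regularity back to [l]. *)
  assert (Sl : smooth a b l).
  { rewrite smooth_Ck by exact Hab; intros n; induction n as [|n IH]; [exact Cl|].
    destruct HT as [S1 [S2 S3]], HT' as [S1' [S2' S3']].
    rewrite smooth_Ck in S1, S2, S3, S1', S2', S3' by exact Hab.
    assert (Hab' : a <= b) by lra.
    assert (CZ : forall (c : R3 -> R) (Zc : R -> R),
              (forall m, Ck a b m (fun x => c (T x))) ->
              (forall x, a <= x <= b -> is_deriv a b Zc x (l x * c (T x))) ->
              Ck a b (S n) Zc).
    { intros c Zc Hc Hd; exists (fun x => l x * c (T x)); split; [exact Hd|].
      apply Ck_mult; auto. }
    apply (Ck_ext a b (S n) (fun x => -1 * dot (Z x) (T' x))); [lra| |].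
    { intros x Hx; rewrite Ez by exact Hx; ring. }
    unfold dot; apply Ck_mult; [exact Hab'|apply Ck_const, Hab'|].
    repeat apply Ck_plus; (apply Ck_mult; [exact Hab'| |auto]);
      [apply (CZ c1)|apply (CZ c2)|apply (CZ c3)]; auto; intros x Hx; apply DZ, Hx. }
  assert (SZ : smooth3 a b Z).
  { apply (smooth3_primitive a b Z (fun x => l x *v T x)); auto using smooth3_scale. }
  assert (Za : Z a = W).
  { unfold Z, J; rewrite !RInt_point; change (zero : R) with 0.
    rewrite !Rplus_0_r; now destruct W as [[? ?] ?]. }
  (* The Volterra equation [l = - <Z, T'>] says precisely that [<Z, T>' = l <T, T> + <Z, T'>]
     vanishes. *)
  assert (ZT : forall x, a <= x <= b -> dot (Z x) (T x) = 0).
  { intros x Hx; rewrite <- HW, <- Za.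
    apply (is_deriv_zero_constant a b (fun y => dot (Z y) (T y))); try lra.
    intros y Hy.
    replace 0 with (dot (l y *v T y) (T y) + dot (Z y) (T' y)).
    - apply is_deriv_dot; auto; apply smooth_is_deriv3; assumption.
    - replace (dot (l y *v T y) (T y)) with (l y * dot (T y) (T y)) by (unfold3; ring).
      rewrite HT1, Ez by exact Hy; ring. }
  exists Z, l; split; [exact SZ|split; [exact Sl|split; [exact Za|]]].
  intros x Hx; split; [apply DZ, Hx|split; [apply ZT, Hx|]].
  rewrite <- Za.
  apply (is_deriv_zero_constant a b (fun y => dot (Z y) (Z y))); try lra.
  intros y Hy.
  replace 0 with (dot (l y *v T y) (Z y) + dot (Z y) (l y *v T y)).
  - apply is_deriv_dot; auto.
  - replace (dot (l y *v T y) (Z y) + dot (Z y) (l y *v T y))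
      with (2 * l y * dot (Z y) (T y)) by (unfold3; ring).
    rewrite ZT by exact Hy; ring.
Qed.

(** * Normal frames and the holonomy angle *)

Lemma curve_tangent (a b : R) (g : R -> R3) : a < b -> curve a b g ->
  smooth a b (speed a b g) /\ smooth3 a b (tangent a b g) /\
  forall x, a <= x <= b ->
    0 < speed a b g x /\ dot (tangent a b g x) (tangent a b g x) = 1.
Proof.
  intros Hab [Hg H0].
  pose proof (smooth3_deriv a b g Hg) as Hg'.
  assert (Hp : forall x, a <= x <= b -> 0 < dot (deriv3 a b g x) (deriv3 a b g x)).
  { intros x Hx; apply dot_pos, H0, Hx. }
  assert (Hs : smooth a b (speed a b g)).
  { apply smooth_sqrt; auto using smooth_dot. }
  assert (Hsp : forall x, a <= x <= b -> 0 < speed a b g x).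
  { intros x Hx; apply sqrt_lt_R0, Hp, Hx. }
  split; [exact Hs|split].
  - apply smooth3_scale; [exact Hab| |exact Hg'].
    apply smooth_inv; [exact Hab| |exact Hs].
    intros x Hx; apply Rgt_not_eq, Hsp, Hx.
  - intros x Hx; split; [apply Hsp, Hx|].
    specialize (Hsp x Hx); specialize (Hp x Hx).
    unfold tangent, dds.
    transitivity (/ speed a b g x ^ 2 * dot (deriv3 a b g x) (deriv3 a b g x)).
    + unfold dot, scale3, c1, c2, c3; simpl; field; lra.
    + replace (speed a b g x ^ 2) with (dot (deriv3 a b g x) (deriv3 a b g x)).
      * field; lra.
      * unfold speed, norm3; rewrite pow2_sqrt; lra.
Qed.

Lemma dot_comm (v w : R3) : dot v w = dot w v.
Proof. unfold dot; ring. Qed.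

(* The vectors dual to [T, u, T x u] are proportional to their pairwise cross products. *)
Lemma orthonormal_expansion (T u z : R3) :
  dot T T = 1 -> dot u u = 1 -> dot u T = 0 ->
  z = dot z T *v T +v dot z u *v u +v dot z (cross T u) *v cross T u.
Proof.
  intros HT Hu HuT.
  set (c := cross T u).
  assert (Hc : dot c c = 1).
  { replace (dot c c) with (dot T T * dot u u - dot u T ^ 2) by (unfold c; unfold3; ring).
    rewrite HT, Hu, HuT; ring. }
  assert (H1 : cross u c = T).
  { replace (cross u c) with (dot u u *v T -v dot u T *v u)
      by (apply eq3; unfold c; unfold3; ring).
    rewrite Hu, HuT; apply eq3; unfold3; ring. }
  assert (H2 : cross c T = u).
  { replace (cross c T) with (dot T T *v u -v dot u T *v T)
      by (apply eq3; unfold c; unfold3; ring).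
    rewrite HT, HuT; apply eq3; unfold3; ring. }
  assert (H : dot c c *v z
     = dot z (cross u c) *v T +v dot z (cross c T) *v u +v dot z c *v c).
  { apply eq3; unfold c; unfold3; ring. }
  rewrite Hc, H1, H2 in H; rewrite <- H; apply eq3; unfold3; ring.
Qed.

Lemma unit_normal_angle (T W Z : R3) :
  dot T T = 1 -> dot W W = 1 -> dot W T = 0 -> dot Z Z = 1 -> dot Z T = 0 ->
  exists theta, Z = cos theta *v W +v sin theta *v cross T W.
Proof.
  intros HT HW HWT HZ HZT.
  pose proof (orthonormal_expansion T W Z HT HW HWT) as E; rewrite HZT in E.
  set (p := dot Z W) in *; set (q := dot Z (cross T W)) in *.
  assert (Hpq : p * p + q * q = 1).
  { assert (HZ' : dot Z Z = dot Z (0 *v T +v p *v W +v q *v cross T W)).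
    { rewrite <- E; reflexivity. }
    rewrite <- HZ, HZ'; unfold p, q; unfold3; ring. }
  assert (Hp : -1 <= p <= 1) by nra.
  assert (Hs : sin (acos p) = Rabs q).
  { rewrite sin_acos by exact Hp.
    replace (1 - p²) with (q²) by (unfold Rsqr; lra); apply sqrt_Rsqr_abs. }
  (* [acos] only reaches the upper half of the circle, so the sign of [q] decides between an angle
     and its negative. *)
  assert (exists theta, cos theta = p /\ sin theta = q) as [theta [Hcos Hsin]].
  { destruct (Rle_dec 0 q).
    - exists (acos p); rewrite cos_acos, Hs, Rabs_right by lra; auto.
    - exists (- acos p).
      rewrite cos_neg, sin_neg, cos_acos, Hs, Rabs_left by lra; split; ring. }
  exists theta; rewrite Hcos, Hsin, E; apply eq3; unfold3; ring.
Qed.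

(** Parallel transport preserves length and normality, so it ends on the unit circle spanned by [Wb]
    and [T x Wb]. This supplies holonomy values at those parameters of a variation where the
    explicit frame may vanish. *)
Lemma holonomy_exists (a b : R) (g : R -> R3) (Wa Wb : R3) : a < b -> curve a b g ->
  unit_normal a b g a Wa -> unit_normal a b g b Wb ->
  exists theta, is_holonomy a b g Wa Wb theta.
Proof.
  intros Hab Hg [Ha1 Ha2] [Hb1 Hb2]; apply norm3_eq_1 in Ha1, Hb1.
  destruct (curve_tangent a b g Hab Hg) as [_ [HT HT1]].
  destruct (parallel_transport_exists a b _ Wa Hab HT (fun x Hx => proj2 (HT1 x Hx)) Ha2)
    as [Z [l [SZ [Sl [Za H]]]]].
  destruct (unit_normal_angle (tangent a b g b) Wb (Z b)) as [theta Htheta]; auto.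
  - apply HT1; lra.
  - rewrite (proj2 (proj2 (H b (conj (Rlt_le _ _ Hab) (Rle_refl b))))); exact Ha1.
  - apply H; lra.
  - exists theta, Z; split; [|split; assumption].
    split; [exact SZ|split; [intros x Hx; apply H, Hx|]].
    exists l; split; [exact Sl|intros x Hx; apply deriv3_eq; auto; apply H, Hx].
Qed.

(** The difference of two parallel fields is normal while its derivative is tangential, so its
    length is constant. *)
Lemma parallel_field_unique (a b : R) (g Z Z' : R -> R3) (x : R) : a < b ->
  parallel_field a b g Z -> parallel_field a b g Z' -> Z a = Z' a ->
  a <= x <= b -> Z x = Z' x.
Proof.
  intros Hab [SZ [NZ [l [_ DZ]]]] [SZ' [NZ' [l' [_ DZ']]]] Ha Hx.
  set (T := tangent a b g) in *.
  set (w := fun y => Z y -v Z' y).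
  assert (E : dot (w x) (w x) = 0).
  { transitivity (dot (w a) (w a)).
    - apply (is_deriv_zero_constant a b (fun y => dot (w y) (w y))); try lra.
      intros y Hy.
      assert (Dw : is_deriv3 a b w y (l y *v T y -v l' y *v T y)).
      { rewrite <- DZ, <- DZ' by exact Hy.
        apply is_deriv3_sub; [exact Hy| |]; apply smooth_is_deriv3; assumption. }
      replace 0 with (dot (l y *v T y -v l' y *v T y) (w y)
                      + dot (w y) (l y *v T y -v l' y *v T y)).
      + apply is_deriv_dot; assumption.
      + specialize (NZ y Hy); specialize (NZ' y Hy).
        transitivity (2 * (l y - l' y) * (dot (Z y) (T y) - dot (Z' y) (T y))).
        * unfold w; unfold3; ring.
        * rewrite NZ, NZ'; ring.
    - unfold w; rewrite Ha; unfold3; ring. }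
  assert (w x = zero3) as Hw.
  { apply NNPP; intros Hn; apply dot_pos in Hn; lra. }
  unfold w in Hw; apply eq3;
    [apply (f_equal c1) in Hw|apply (f_equal c2) in Hw|apply (f_equal c3) in Hw];
    unfold3; lra.
Qed.

(* Rotating a unit normal field [u] by minus the integral of its connection form
   [<u', T x u>] makes it parallel. *)
Lemma parallel_of_frame (a b : R) (g u : R -> R3) :
  let T := tangent a b g in
  let alpha x := - RInt (fun y => dot (deriv3 a b u y) (cross (T y) (u y))) a x in
  a < b -> curve a b g -> smooth3 a b u ->
  (forall x, a <= x <= b -> dot (u x) (u x) = 1 /\ dot (u x) (T x) = 0) ->
  parallel_field a b g
    (fun x => cos (alpha x) *v u x +v sin (alpha x) *v cross (T x) (u x)).
Proof.
  intros T alpha Hab Hg Su Hu.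
  destruct (curve_tangent a b g Hab Hg) as [_ [ST HT]]; fold T in ST, HT.
  set (omega := fun y => dot (deriv3 a b u y) (cross (T y) (u y))) in *.
  pose proof (smooth3_deriv a b u Su) as Su'.
  set (v := fun x => cross (T x) (u x)).
  assert (Sv : smooth3 a b v) by (apply smooth3_cross; assumption).
  assert (Som : smooth a b omega) by (apply smooth_dot; assumption).
  assert (Da : forall x, a <= x <= b -> is_deriv a b alpha x (- omega x)).
  { intros x Hx; apply is_deriv_opp; [exact Hx|].
    apply is_deriv_RInt; [exact Hx|apply smooth_cont; assumption]. }
  assert (Sa : smooth a b alpha).
  { apply (smooth_primitive a b alpha (fun x => - omega x)); auto using smooth_opp. }
  set (Z := fun x => cos (alpha x) *v u x +v sin (alpha x) *v v x).
  assert (SZ : smooth3 a b Z).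
  { apply smooth3_add; [exact Hab| |]; apply smooth3_scale; auto using smooth_cos, smooth_sin. }
  assert (Hv : forall x, a <= x <= b -> dot (v x) (v x) = 1).
  { intros x Hx; destruct (Hu x Hx) as [H1 H2]; destruct (HT x Hx) as [_ H3].
    replace (dot (v x) (v x)) with (dot (T x) (T x) * dot (u x) (u x) - dot (u x) (T x) ^ 2)
      by (unfold v; unfold3; ring).
    rewrite H1, H2, H3; ring. }
  assert (Hunit : forall w, smooth3 a b w -> (forall x, a <= x <= b -> dot (w x) (w x) = 1) ->
            forall x, a <= x <= b -> dot (deriv3 a b w x) (w x) = 0).
  { intros w Sw Hw x Hx.
    pose proof (smooth_is_deriv3 a b w x Hab Hx Sw) as Dw.
    assert (E : dot (deriv3 a b w x) (w x) + dot (w x) (deriv3 a b w x) = 0).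
    { apply (is_deriv_unique a b (fun y => dot (w y) (w y)) x); try assumption.
      - apply is_deriv_dot; assumption.
      - apply (is_deriv_ext a b (fun _ => 1)); [exact Hx|intros; symmetry; auto|].
        apply is_deriv_const, Hx. }
    rewrite (dot_comm (w x)) in E; lra. }
  split; [exact SZ|split].
  - intros x Hx; fold T; destruct (Hu x Hx) as [_ H2].
    transitivity (cos (alpha x) * dot (u x) (T x)); [unfold v; unfold3; ring|].
    rewrite H2; ring.
  (* Pairing [Z' = lambda T] with the unit vector [T] leaves this as the only candidate for
     [lambda]. *)
  - exists (fun x => dot (deriv3 a b Z x) (T x)); split.
    { apply smooth_dot; auto using smooth3_deriv. }
    intros x Hx; change (deriv3 a b Z x = dot (deriv3 a b Z x) (T x) *v T x).
    destruct (Hu x Hx) as [H1 H2]; destruct (HT x Hx) as [_ H3].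
    pose proof (Hunit u Su (fun y Hy => proj1 (Hu y Hy)) x Hx) as Hu'.
    pose proof (Hunit v Sv Hv x Hx) as Hv'.
    pose proof (Hv x Hx) as Hvv.
    pose proof (smooth_is_deriv3 a b u x Hab Hx Su) as Du.
    pose proof (smooth_is_deriv3 a b v x Hab Hx Sv) as Dv.
    assert (Huv : dot (deriv3 a b v x) (u x) = - omega x).
    { assert (E : dot (deriv3 a b v x) (u x) + dot (v x) (deriv3 a b u x) = 0).
      { apply (is_deriv_unique a b (fun y => dot (v y) (u y)) x); try assumption.
        - apply is_deriv_dot; assumption.
        - apply (is_deriv_ext a b (fun _ => 0)); [exact Hx|intros; unfold v; unfold3; ring|].
          apply is_deriv_const, Hx. }
      unfold omega; fold (v x); rewrite (dot_comm (v x)) in E; lra. }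
    assert (Huv0 : dot (v x) (u x) = 0) by (unfold v; unfold3; ring).
    assert (Ev : dot (deriv3 a b u x) (v x) = omega x) by reflexivity.
    set (u' := deriv3 a b u x) in *; set (v' := deriv3 a b v x) in *.
    set (c := cos (alpha x)); set (s := sin (alpha x)).
    assert (EZ : deriv3 a b Z x
              = (- s * - omega x) *v u x +v c *v u' +v ((c * - omega x) *v v x +v s *v v')).
    { apply deriv3_eq; [exact Hab|exact Hx|].
      apply is_deriv3_add; [exact Hx| |]; apply is_deriv3_scale; try assumption.
      - apply (is_deriv_comp a b cos); [exact Hx|apply is_derive_cos|apply Da, Hx].
      - apply (is_deriv_comp a b sin); [exact Hx|apply is_derive_sin|apply Da, Hx]. }
    etransitivity; [apply (orthonormal_expansion (T x) (u x)); assumption|].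
    fold (v x).
    (* The rotation contributes [s * omega] along [u] and [- c * omega] along [v]. Since
       [<u', v> = omega = - <v', u>], the motion of the frame itself contributes the opposite
       amounts. *)
    assert (E1 : dot (deriv3 a b Z x) (u x) = 0).
    { rewrite EZ.
      match goal with |- ?l = _ => replace l with
        ((- s * - omega x) * dot (u x) (u x) + c * dot u' (u x)
         + (c * - omega x) * dot (v x) (u x) + s * dot v' (u x))
        by (unfold dot, add3, scale3, c1, c2, c3; simpl; ring) end.
      rewrite H1, Hu', Huv0, Huv; ring. }
    assert (E2 : dot (deriv3 a b Z x) (v x) = 0).
    { rewrite EZ.
      match goal with |- ?l = _ => replace l with
        ((- s * - omega x) * dot (v x) (u x) + c * dot u' (v x)
         + (c * - omega x) * dot (v x) (v x) + s * dot v' (v x))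
        by (unfold dot, add3, scale3, c1, c2, c3; simpl; ring) end.
      rewrite Huv0, Ev, Hvv, Hv'; ring. }
    rewrite E1, E2; cbv beta; generalize (dot (deriv3 a b Z x) (T x)); intros d.
    apply eq3; unfold add3, scale3, c1, c2, c3; simpl; ring.
Qed.

(** * Smooth families *)

(** The two-dimensional counterpart of [cont]: both arguments are clamped, so that the results on
    [continuity_2d_pt] hold at every point of the plane, the boundary of the rectangle included. *)
Definition cont2 (e a b : R) (F : R -> R -> R) : Prop :=
  forall t x, continuity_2d_pt (fun s y => F (clamp (- e) e s) (clamp a b y)) t x.

Lemma cont2_of_filterlim (e a b : R) (F : R -> R -> R) : 0 <= e -> a <= b ->
  (forall t x, - e <= t <= e -> a <= x <= b ->
    filterlim (fun p : R * R => F (fst p) (snd p))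
      (within (fun p : R * R => - e <= fst p <= e /\ a <= snd p <= b) (locally (t, x)))
      (locally (F t x))) ->
  cont2 e a b F.
Proof.
  intros He Hab H t x; apply continuity_2d_pt_filterlim.
  assert (He' : - e <= e) by lra.
  pose proof (clamp_bounds (- e) e t He') as Ht; pose proof (clamp_bounds a b x Hab) as Hx.
  refine (filterlim_comp _ _ _ (fun z : R * R => (clamp (- e) e (fst z), clamp a b (snd z)))
    (fun p => F (fst p) (snd p)) _ _ _ _ (H _ _ Ht Hx)).
  intros Q [d Hd]; exists d; intros [s y] [Hs Hy].
  apply Hd; simpl.
  - split.
    + change (Rabs (clamp (- e) e s - clamp (- e) e t) < d).
      eapply Rle_lt_trans; [apply clamp_lipschitz|exact Hs].
    + change (Rabs (clamp a b y - clamp a b x) < d).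
      eapply Rle_lt_trans; [apply clamp_lipschitz|exact Hy].
  - split; apply clamp_bounds; assumption.
Qed.

Lemma cont2_ext (e a b : R) (F G : R -> R -> R) : 0 <= e -> a <= b ->
  (forall t x, - e <= t <= e -> a <= x <= b -> F t x = G t x) ->
  cont2 e a b F -> cont2 e a b G.
Proof.
  intros He Hab H HF t x.
  eapply continuity_2d_pt_ext; [|apply HF].
  intros s y; apply H; apply clamp_bounds; lra.
Qed.

Lemma cont2_const (e a b c : R) : cont2 e a b (fun _ _ => c).
Proof. intros t x; apply continuity_2d_pt_const. Qed.

Lemma cont2_space (e a b : R) (f : R -> R) : cont a b f -> cont2 e a b (fun _ x => f x).
Proof.
  intros Hf t x; apply continuity_2d_pt_filterlim.
  refine (filterlim_comp _ _ _ snd (fun y => f (clamp a b y)) _ _ _ _ (Hf x)).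
  apply continuous_snd.
Qed.

Lemma cont2_plus (e a b : R) (F G : R -> R -> R) :
  cont2 e a b F -> cont2 e a b G -> cont2 e a b (fun t x => F t x + G t x).
Proof. intros HF HG t x; exact (continuity_2d_pt_plus _ _ t x (HF t x) (HG t x)). Qed.

Lemma cont2_minus (e a b : R) (F G : R -> R -> R) :
  cont2 e a b F -> cont2 e a b G -> cont2 e a b (fun t x => F t x - G t x).
Proof. intros HF HG t x; exact (continuity_2d_pt_minus _ _ t x (HF t x) (HG t x)). Qed.

Lemma cont2_mult (e a b : R) (F G : R -> R -> R) :
  cont2 e a b F -> cont2 e a b G -> cont2 e a b (fun t x => F t x * G t x).
Proof. intros HF HG t x; exact (continuity_2d_pt_mult _ _ t x (HF t x) (HG t x)). Qed.

Lemma cont2_inv (e a b : R) (F : R -> R -> R) : 0 <= e -> a <= b ->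
  (forall t x, - e <= t <= e -> a <= x <= b -> F t x <> 0) ->
  cont2 e a b F -> cont2 e a b (fun t x => / F t x).
Proof.
  intros He Hab H0 HF t x; refine (continuity_2d_pt_inv _ t x (HF t x) _).
  apply H0; apply clamp_bounds; lra.
Qed.

Lemma cont2_sqrt (e a b : R) (F : R -> R -> R) : 0 <= e -> a <= b ->
  cont2 e a b F -> cont2 e a b (fun t x => sqrt (F t x)).
Proof.
  intros He Hab HF t x; refine (continuity_1d_2d_pt_comp sqrt _ t x _ (HF t x)).
  apply continuity_pt_filterlim, continuous_sqrt.
Qed.

Lemma cont2_subinterval (e e' a b : R) (F : R -> R -> R) : 0 <= e' <= e ->
  cont2 e a b F -> cont2 e' a b F.
Proof.
  intros He HF t x; apply continuity_2d_pt_filterlim.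
  assert (E : forall s, clamp (- e) e (clamp (- e') e' s) = clamp (- e') e' s).
  { intros s; apply clamp_id.
    assert (He' : - e' <= e') by lra; pose proof (clamp_bounds _ _ s He'); lra. }
  rewrite <- (E t).
  pose proof (proj1 (continuity_2d_pt_filterlim _ _ _) (HF (clamp (- e') e' t) x)) as H.
  apply (filterlim_ext (fun z : R * R =>
    F (clamp (- e) e (clamp (- e') e' (fst z))) (clamp a b (snd z)))).
  { intros z; rewrite E; reflexivity. }
  refine (filterlim_comp _ _ _ (fun z : R * R => (clamp (- e') e' (fst z), snd z))
    (fun z => F (clamp (- e) e (fst z)) (clamp a b (snd z))) _ _ _ _ H).
  intros Q [d Hd]; exists d; intros [s y] [Hs Hy]; apply Hd; split; [|exact Hy].
  change (Rabs (clamp (- e') e' s - clamp (- e') e' t) < d).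
  eapply Rle_lt_trans; [apply clamp_lipschitz|exact Hs].
Qed.

Lemma cont2_slice (e a b : R) (F : R -> R -> R) (t : R) : - e <= t <= e ->
  cont2 e a b F -> cont a b (F t).
Proof.
  intros Ht HF x; apply filterlim_locally; intros eps.
  destruct (HF t x eps) as [d Hd]; exists d; intros y Hy.
  specialize (Hd t y); rewrite Rminus_diag, Rabs_R0, clamp_id in Hd by exact Ht.
  apply Hd; [apply cond_pos|exact Hy].
Qed.

(** Uniform continuity over the compact interval [a,b] turns a positive lower bound on the slice
    [t = 0] into positivity on a strip. It keeps the frame [M x gamma_t'] away from zero for small
    [t]. *)
Lemma cont2_uniformly_pos (e a b m : R) (F : R -> R -> R) :
  0 < e -> 0 < m -> cont2 e a b F -> (forall x, a <= x <= b -> m <= F 0 x) ->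
  exists d, 0 < d <= e /\
    forall t x, - d <= t <= d -> a <= x <= b -> 0 < F t x.
Proof.
  intros He Hm HF H0.
  destruct (uniform_continuity_2d_1d
    (fun y s => F (clamp (- e) e s) (clamp a b y)) a b 0) with (eps := mkposreal m Hm)
    as [d Hd].
  { intros x _ eps; destruct (HF 0 x eps) as [d Hd]; exists d; auto. }
  simpl in Hd; pose proof (cond_pos d) as Hdp.
  exists (Rmin d e); split; [split; [apply Rmin_glb_lt; assumption|apply Rmin_r]|].
  intros t x Ht Hx.
  pose proof (Rmin_l d e); pose proof (Rmin_r d e).
  specialize (Hd x 0 x t Hx).
  rewrite !(clamp_id a b), !(clamp_id (- e) e), Rminus_diag, Rabs_R0 in Hd by lra.
  assert (Hlt : Rabs (F t x - F 0 x) < m) by (apply Hd; lra).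
  apply Rabs_def2 in Hlt; specialize (H0 x Hx); lra.
Qed.

(** Differentiation under the integral sign. Clamping [x] makes the integrand differentiable in [t]
    for every real [x], and for [t] inside (-e,e) the relative derivative is two-sided, as
    [is_derive_RInt_param] demands. *)
Lemma is_derive_RInt_parameter (e a b : R) (f ft : R -> R -> R) : 0 < e -> a < b ->
  (forall t x, - e <= t <= e -> a <= x <= b ->
     is_deriv (- e) e (fun s => f s x) t (ft t x)) ->
  (forall t, - e <= t <= e -> cont a b (f t)) -> cont2 e a b ft ->
  is_derive (fun t => RInt (f t) a b) 0 (RInt (ft 0) a b).
Proof.
  intros He Hab Hd Hc Hft.
  set (g := fun t x => f t (clamp a b x)).
  assert (Hloc : locally 0 (fun t => - e < t < e)).
  { apply (locally_interval (fun t => - e < t < e) 0 (- e) e); simpl; try lra.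
    intros; split; assumption. }
  assert (Hg : forall t x, - e < t < e ->
            is_derive (fun s => g s x) t (ft t (clamp a b x))).
  { intros t x Ht; apply (is_deriv_interior (- e) e); [exact Ht|].
    apply Hd; [lra|apply clamp_bounds; lra]. }
  assert (E : forall h : R -> R, RInt (fun x => h (clamp a b x)) a b = RInt h a b).
  { intros h; apply RInt_ext; rewrite Rmin_left, Rmax_right by lra.
    intros x Hx; rewrite clamp_id by lra; reflexivity. }
  apply (is_derive_ext (fun t => RInt (g t) a b)).
  { intros t; apply (E (f t)). }
  rewrite <- (E (ft 0)).
  replace (RInt (fun x => ft 0 (clamp a b x)) a b)
    with (RInt (fun x => Derive (fun u => g u x) 0) a b).
  2: { apply RInt_ext; intros x _; apply is_derive_unique, Hg; lra. }
  apply (is_derive_RInt_param g a b 0).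
  - apply (filter_imp _ _ (fun t Ht => fun x _ => ex_intro _ _ (Hg t x Ht)) Hloc).
  - intros x _; eapply continuity_2d_pt_ext_loc; [|apply (Hft 0 x)].
    exists (mkposreal e He); simpl; intros t y Ht _.
    rewrite Rminus_0_r in Ht; apply Rabs_def2 in Ht.
    rewrite clamp_id by lra; symmetry; apply is_derive_unique, Hg; lra.
  - eapply filter_imp; [|exact Hloc]; intros t Ht.
    apply (ex_RInt_continuous (V := R_CompleteNormedModule)); intros x _.
    apply Hc; lra.
Qed.

Definition cont2_3 (e a b : R) (F : R -> R -> R3) : Prop :=
  cont2 e a b (fun t x => c1 (F t x)) /\ cont2 e a b (fun t x => c2 (F t x)) /\
  cont2 e a b (fun t x => c3 (F t x)).

Lemma cont2_3_space (e a b : R) (f : R -> R3) : a < b -> smooth3 a b f ->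
  cont2_3 e a b (fun _ x => f x).
Proof.
  intros Hab [F1 [F2 F3]]; split3; apply cont2_space, smooth_cont; assumption.
Qed.

Lemma cont2_dot (e a b : R) (F G : R -> R -> R3) :
  cont2_3 e a b F -> cont2_3 e a b G -> cont2 e a b (fun t x => dot (F t x) (G t x)).
Proof.
  intros [F1 [F2 F3]] [G1 [G2 G3]].
  exact (cont2_plus _ _ _ _ _ (cont2_plus _ _ _ _ _ (cont2_mult _ _ _ _ _ F1 G1)
    (cont2_mult _ _ _ _ _ F2 G2)) (cont2_mult _ _ _ _ _ F3 G3)).
Qed.

Lemma cont2_3_cross (e a b : R) (F G : R -> R -> R3) :
  cont2_3 e a b F -> cont2_3 e a b G -> cont2_3 e a b (fun t x => cross (F t x) (G t x)).
Proof.
  intros [F1 [F2 F3]] [G1 [G2 G3]]; split3;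
    [exact (cont2_minus _ _ _ _ _ (cont2_mult _ _ _ _ _ F2 G3) (cont2_mult _ _ _ _ _ F3 G2))
    |exact (cont2_minus _ _ _ _ _ (cont2_mult _ _ _ _ _ F3 G1) (cont2_mult _ _ _ _ _ F1 G3))
    |exact (cont2_minus _ _ _ _ _ (cont2_mult _ _ _ _ _ F1 G2) (cont2_mult _ _ _ _ _ F2 G1))].
Qed.

(* [P i j] plays the role of [d^(i+j) G / dt^i dx^j]. *)
Definition jet (e a b : R) (P : nat -> nat -> R -> R -> R3) : Prop :=
  forall i j, cont2_3 e a b (P i j) /\
    forall t x, - e <= t <= e -> a <= x <= b ->
      is_deriv3 (- e) e (fun s => P i j s x) t (P (S i) j t x) /\
      is_deriv3 a b (P i j t) x (P i (S j) t x).

Lemma jet_of_smooth2 (e a b : R) (G : R -> R -> R3) : 0 < e -> a < b ->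
  smooth2 e a b (fun t x => c1 (G t x)) ->
  smooth2 e a b (fun t x => c2 (G t x)) ->
  smooth2 e a b (fun t x => c3 (G t x)) ->
  exists P, jet e a b P /\
    forall t x, - e <= t <= e -> a <= x <= b -> P O O t x = G t x.
Proof.
  intros He Hab [P1 [E1 H1]] [P2 [E2 H2]] [P3 [E3 H3]].
  exists (fun i j t x => (P1 i j t x, P2 i j t x, P3 i j t x)); split.
  - intros i j; split.
    + split3; unfold c1, c2, c3; simpl; apply cont2_of_filterlim; try lra;
        intros t x Ht Hx; [apply H1|apply H2|apply H3]; assumption.
    + intros t x Ht Hx.
      destruct (H1 i j t x Ht Hx) as [A1 [B1 _]], (H2 i j t x Ht Hx) as [A2 [B2 _]],
        (H3 i j t x Ht Hx) as [A3 [B3 _]].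
      split; split3; unfold c1, c2, c3; simpl; assumption.
  - intros t x Ht Hx; apply eq3; [exact (E1 t x Ht Hx)|exact (E2 t x Ht Hx)|exact (E3 t x Ht Hx)].
Qed.

Lemma jet_smooth3 (e a b : R) (P : nat -> nat -> R -> R -> R3) (i j : nat) (t : R) :
  a < b -> - e <= t <= e -> jet e a b P -> smooth3 a b (P i j t).
Proof.
  intros Hab Ht H.
  split3; apply smooth_Ck; try exact Hab; intros n; revert j;
    induction n as [|n IH]; intros j.
  - exact (cont2_slice e a b _ t Ht (proj1 (proj1 (H i j)))).
  - exists (fun x => c1 (P i (S j) t x)); split; [|apply IH].
    intros x Hx; apply (H i j); assumption.
  - exact (cont2_slice e a b _ t Ht (proj1 (proj2 (proj1 (H i j))))).
  - exists (fun x => c2 (P i (S j) t x)); split; [|apply IH].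
    intros x Hx; apply (H i j); assumption.
  - exact (cont2_slice e a b _ t Ht (proj2 (proj2 (proj1 (H i j))))).
  - exists (fun x => c3 (P i (S j) t x)); split; [|apply IH].
    intros x Hx; apply (H i j); assumption.
Qed.

Lemma jet_subinterval (e e' a b : R) (P : nat -> nat -> R -> R -> R3) :
  0 <= e' <= e -> jet e a b P -> jet e' a b P.
Proof.
  intros He H i j; destruct (H i j) as [[C1 [C2 C3]] D]; split.
  - split3; apply (cont2_subinterval e); assumption.
  - intros t x Ht Hx.
    assert (Ht' : - e <= t <= e) by lra.
    destruct (D t x Ht' Hx) as [[D1 [D2 D3]] Dx]; split; [|exact Dx].
    split3; apply (is_deriv_subinterval (- e) e); (assumption || lra).
Qed.

(** * First variation of the bending energy *)

(** The exchange of the two derivatives is built into the family: [P 1 1] is the [t]-derivative of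
    [P 0 1] and also the [x]-derivative of [P 1 0]. Hence at [t = 0] the velocity of [gamma_t'] is
    [V'], and that of [gamma_t''] is [V'']. *)
Lemma variation_jet (a b : R) (gamma V : R -> R3) (e : R) (G : R -> R -> R3) :
  a < b -> variation a b gamma V e G ->
  exists P, jet e a b P /\
    (forall t x, - e <= t <= e -> a <= x <= b ->
       P O O t x = G t x /\ deriv3 a b (G t) x = P O 1%nat t x /\
       0 < dot (P O 1%nat t x) (P O 1%nat t x)) /\
    (forall x, a <= x <= b ->
       P O 1%nat 0 x = deriv3 a b gamma x /\
       P O 2%nat 0 x = deriv3 a b (deriv3 a b gamma) x /\
       P 1%nat 1%nat 0 x = deriv3 a b V x /\
       P 1%nat 2%nat 0 x = deriv3 a b (deriv3 a b V) x).
Proof.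
  intros Hab [He [[S1 [S2 S3]] [Hc [H0 [HV _]]]]].
  destruct (jet_of_smooth2 e a b G He Hab S1 S2 S3) as [P [HP EP]].
  assert (H00 : - e <= 0 <= e) by lra.
  assert (Hd : forall i j t x, - e <= t <= e -> a <= x <= b ->
            is_deriv3 a b (P i j t) x (P i (S j) t x)).
  { intros i j t x Ht Hx; apply (HP i j); assumption. }
  assert (E1 : forall t x, - e <= t <= e -> a <= x <= b -> deriv3 a b (G t) x = P O 1%nat t x).
  { intros t x Ht Hx; apply deriv3_eq; [exact Hab|exact Hx|].
    apply (is_deriv3_ext a b (P O O t)); auto. }
  exists P; split; [exact HP|split].
  - intros t x Ht Hx; split; [auto|split; [auto|]].
    apply dot_pos; rewrite <- E1 by assumption; apply (Hc t Ht), Hx.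
  - assert (A1 : forall x, a <= x <= b -> P O 1%nat 0 x = deriv3 a b gamma x).
    { intros x Hx; symmetry; apply deriv3_eq; [exact Hab|exact Hx|].
      apply (is_deriv3_ext a b (P O O 0)); auto.
      intros y Hy; rewrite EP, H0 by assumption; reflexivity. }
    assert (A2 : forall x, a <= x <= b -> P 1%nat 1%nat 0 x = deriv3 a b V x).
    { intros x Hx; symmetry; apply deriv3_eq; [exact Hab|exact Hx|].
      apply (is_deriv3_ext a b (P 1%nat O 0)); auto.
      intros y Hy; rewrite <- HV by exact Hy; symmetry.
      apply deriv3_eq; [lra|exact H00|].
      apply (is_deriv3_ext (- e) e (fun t => P O O t y)); [exact H00|auto|].
      apply (HP O O); assumption. }
    intros x Hx; split; [auto|split; [|split; [auto|]]]; symmetry;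
      (apply deriv3_eq; [exact Hab|exact Hx|]).
    + apply (is_deriv3_ext a b (P O 1%nat 0)); auto.
    + apply (is_deriv3_ext a b (P 1%nat 1%nat 0)); auto.
Qed.

Lemma is_deriv_eq_value (a b : R) (f : R -> R) (x l m : R) :
  is_deriv a b f x l -> l = m -> is_deriv a b f x m.
Proof. intros H <-; exact H. Qed.

Lemma is_deriv_inv_norm (a b : R) (f : R -> R3) (x : R) (l : R3) : a <= x <= b ->
  0 < dot (f x) (f x) -> is_deriv3 a b f x l ->
  is_deriv a b (fun y => / sqrt (dot (f y) (f y))) x
    (- dot (f x) l * (/ sqrt (dot (f x) (f x))) ^ 3).
Proof.
  intros Hx Hp H.
  pose proof (sqrt_lt_R0 _ Hp) as Hs.
  eapply is_deriv_eq_value.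
  - apply is_deriv_inv; [exact Hx|apply Rgt_not_eq, Hs|].
    apply is_deriv_sqrt; [exact Hx|exact Hp|].
    apply is_deriv_dot; [exact Hx|exact H|exact H].
  - rewrite (dot_comm l); field; lra.
Qed.

(** Squared curvature times speed is [|A x B|^2 / |A|^5], and Lagrange's identity expands it into
    the integrand on the right. It holds for any regular parametrization, as variations need not
    keep arc length. *)
Lemma bending_energy_eq (a b : R) (rho : R -> R) (g A B : R -> R3) :
  let r x := / sqrt (dot (A x) (A x)) in
  a < b ->
  (forall x, a <= x <= b -> 0 < dot (A x) (A x)) ->
  (forall x, a <= x <= b -> deriv3 a b g x = A x) ->
  (forall x, a <= x <= b -> is_deriv3 a b A x (B x)) ->
  bending_energy a b rho g
  = / 2 * RInt (fun x => rho x * (dot (B x) (B x) * r x ^ 3 - dot (A x) (B x) ^ 2 * r x ^ 5)) a b.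
Proof.
  intros r Hab Hp HA HB; unfold bending_energy; f_equal.
  apply RInt_ext; rewrite Rmin_left, Rmax_right by lra; intros x Hx'.
  assert (Hx : a <= x <= b) by lra.
  assert (Hs : forall y, a <= y <= b -> speed a b g y = sqrt (dot (A y) (A y))).
  { intros y Hy; unfold speed; rewrite HA by exact Hy; reflexivity. }
  pose proof (Hp x Hx) as Hpx; pose proof (sqrt_lt_R0 _ Hpx) as Hsx.
  assert (ET : deriv3 a b (tangent a b g) x
            = (- dot (A x) (B x) * r x ^ 3) *v A x +v r x *v B x).
  { apply deriv3_eq; [exact Hab|exact Hx|].
    apply (is_deriv3_ext a b (fun y => r y *v A y)); [exact Hx| |].
    - intros y Hy; unfold tangent, dds; rewrite Hs, HA by exact Hy; reflexivity.
    - apply is_deriv3_scale; [exact Hx| |apply HB, Hx].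
      apply is_deriv_inv_norm; [exact Hx|exact Hpx|apply HB, Hx]. }
  unfold dds at 1 2; rewrite ET, (Hs x Hx).
  assert (Er : dot (A x) (A x) = / r x ^ 2).
  { unfold r; rewrite <- (sqrt_sqrt (dot (A x) (A x))) at 1 by lra; field; lra. }
  assert (Es : sqrt (dot (A x) (A x)) = / r x) by (unfold r; field; lra).
  assert (Hr : 0 < r x) by (apply Rinv_0_lt_compat, Hsx).
  rewrite Es, Rinv_inv.
  set (k := - dot (A x) (B x) * r x ^ 3).
  match goal with |- _ * dot ?v ?v * _ = _ => replace (dot v v) with
    (r x ^ 2 * (k ^ 2 * dot (A x) (A x) + 2 * k * r x * dot (A x) (B x)
                + r x ^ 2 * dot (B x) (B x)))
    by (unfold dot, add3, scale3, c1, c2, c3; simpl; ring) end.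
  rewrite Er; unfold k.
  match goal with |- ?u = ?v => change (u = v :> R) end; field; lra.
Qed.

(** In the notation of the proof the integrand is [rho (p r^3 - w^2 r^5)]. At [t = 0] one has
    [r = 1], [r' = - <T, V'> = 0] and [w = <T, T'> = 0], so only [rho p' = 2 rho <T', V''>]
    survives, and the 2 cancels the factor of the energy. *)
Lemma bending_first_variation (a b : R) (rho : R -> R) (gamma V : R -> R3) (e : R)
    (G : R -> R -> R3) :
  a < b -> arclength_curve a b gamma -> smooth a b rho -> variation a b gamma V e G ->
  (forall x, a <= x <= b -> dot (deriv3 a b V x) (deriv3 a b gamma x) = 0) ->
  is_deriv (- e) e (fun t => bending_energy a b rho (G t)) 0
    (RInt (fun x => rho x * dot (deriv3 a b (deriv3 a b gamma) x)
                                (deriv3 a b (deriv3 a b V) x)) a b).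
Proof.
  intros Hab [[Sg _] Hg1] Srho HG HV.
  pose proof (proj1 HG) as He.
  destruct (variation_jet a b gamma V e G Hab HG) as [P [HP [H1 H2]]].
  set (A := P O 1%nat); set (B := P O 2%nat); set (A' := P 1%nat 1%nat); set (B' := P 1%nat 2%nat).
  set (r := fun t x => / sqrt (dot (A t x) (A t x))).
  set (r' := fun t x => - dot (A t x) (A' t x) * (r t x * (r t x * r t x))).
  set (p := fun t x => dot (B t x) (B t x)).
  set (p' := fun t x => dot (B' t x) (B t x) + dot (B t x) (B' t x)).
  set (w := fun t x => dot (A t x) (B t x)).
  set (w' := fun t x => dot (A' t x) (B t x) + dot (A t x) (B' t x)).
  (* Powers are spelled out as nested products so that continuity and derivatives follow from the
     product rules alone. *)
  set (r3 := fun t x => r t x * (r t x * r t x)).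
  set (r3' := fun t x => 3 * (r t x * r t x) * r' t x).
  set (f := fun t x => rho x * (p t x * r3 t x - w t x * w t x * (r3 t x * (r t x * r t x)))).
  set (ft := fun t x => rho x * (p' t x * r3 t x + p t x * r3' t x
    - (2 * (w t x * w' t x) * (r3 t x * (r t x * r t x))
       + w t x * w t x * (r3' t x * (r t x * r t x) + r3 t x * (2 * (r t x * r' t x)))))).
  apply is_derive_is_deriv; [lra|].
  apply (is_derive_ext_loc (fun t => / 2 * RInt (f t) a b)).
  { apply (locally_interval _ 0 (- e) e); simpl; try lra; intros t Ht1 Ht2; simpl in Ht1, Ht2.
    assert (Ht : - e <= t <= e) by lra.
    rewrite (bending_energy_eq a b rho (G t) (A t) (B t)); auto.
    - f_equal; apply RInt_ext; intros x _; unfold f, r3, p, w, r.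
      match goal with |- ?u = ?v => change (u = v :> R) end; ring.
    - intros x Hx; apply H1; assumption.
    - intros x Hx; apply H1; assumption.
    - intros x Hx; apply (HP O 1%nat); assumption. }
  assert (CA : cont2_3 e a b A) by apply HP.
  assert (CB : cont2_3 e a b B) by apply HP.
  assert (CA' : cont2_3 e a b A') by apply HP.
  assert (CB' : cont2_3 e a b B') by apply HP.
  assert (Cr : cont2 e a b r).
  { apply cont2_inv; [lra|lra| |apply cont2_sqrt; [lra|lra|apply cont2_dot; assumption]].
    intros t x Ht Hx; apply Rgt_not_eq, sqrt_lt_R0, H1; assumption. }
  assert (Crho : cont2 e a b (fun _ x => rho x)) by (apply cont2_space, smooth_cont; assumption).
  assert (Crr : cont2 e a b (fun t x => r t x * r t x)) by (apply cont2_mult; assumption).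
  assert (Cr3 : cont2 e a b r3) by (apply cont2_mult; assumption).
  assert (Cr' : cont2 e a b r').
  { apply cont2_mult; [|exact Cr3].
    apply (cont2_ext e a b (fun t x => -1 * dot (A t x) (A' t x))); [lra|lra|intros; ring|].
    apply cont2_mult; [apply cont2_const|apply cont2_dot; assumption]. }
  assert (Cp : cont2 e a b p) by (apply cont2_dot; assumption).
  assert (Cw : cont2 e a b w) by (apply cont2_dot; assumption).
  assert (Cp' : cont2 e a b p') by (apply cont2_plus; apply cont2_dot; assumption).
  assert (Cw' : cont2 e a b w') by (apply cont2_plus; apply cont2_dot; assumption).
  assert (Cr3' : cont2 e a b r3').
  { apply cont2_mult; [apply cont2_mult; [apply cont2_const|exact Crr]|exact Cr']. }
  assert (Cf : cont2 e a b f).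
  { apply cont2_mult; [exact Crho|apply cont2_minus; [apply cont2_mult; assumption|]].
    repeat apply cont2_mult; assumption. }
  assert (Cft : cont2 e a b ft).
  { apply cont2_mult; [exact Crho|].
    apply cont2_minus; [apply cont2_plus; apply cont2_mult; assumption|].
    apply cont2_plus.
    - apply cont2_mult; [|apply cont2_mult; assumption].
      apply cont2_mult; [apply cont2_const|apply cont2_mult; assumption].
    - apply cont2_mult; [apply cont2_mult; assumption|].
      apply cont2_plus; [apply cont2_mult; assumption|].
      apply cont2_mult; [assumption|].
      apply cont2_mult; [apply cont2_const|apply cont2_mult; assumption]. }
  assert (Df : is_derive (fun t => RInt (f t) a b) 0 (RInt (ft 0) a b)).
  { apply (is_derive_RInt_parameter e); try assumption.
    - intros t x Ht Hx.
      assert (DA : is_deriv3 (- e) e (fun s => A s x) t (A' t x)) by (apply (HP O 1%nat); assumption).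
      assert (DB : is_deriv3 (- e) e (fun s => B s x) t (B' t x)) by (apply (HP O 2%nat); assumption).
      assert (Dr : is_deriv (- e) e (fun s => r s x) t (r' t x)).
      { eapply is_deriv_eq_value; [apply is_deriv_inv_norm; [exact Ht|apply H1; assumption|exact DA]|].
        unfold r', r; ring. }
      assert (Dp : is_deriv (- e) e (fun s => p s x) t (p' t x))
        by exact (is_deriv_dot _ _ _ _ _ _ _ Ht DB DB).
      assert (Dw : is_deriv (- e) e (fun s => w s x) t (w' t x))
        by exact (is_deriv_dot _ _ _ _ _ _ _ Ht DA DB).
      assert (Drr : is_deriv (- e) e (fun s => r s x * r s x) t (r' t x * r t x + r t x * r' t x))
        by exact (is_deriv_mult _ _ _ _ _ _ _ Ht Dr Dr).
      assert (Dr3 : is_deriv (- e) e (fun s => r3 s x) t (r3' t x)).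
      { eapply is_deriv_eq_value; [exact (is_deriv_mult _ _ _ _ _ _ _ Ht Dr Drr)|].
        unfold r3'; ring. }
      eapply is_deriv_eq_value.
      + exact (is_deriv_mult _ _ _ _ _ _ _ Ht (is_deriv_const _ _ (rho x) _ Ht)
          (is_deriv_minus _ _ _ _ _ _ _ Ht (is_deriv_mult _ _ _ _ _ _ _ Ht Dp Dr3)
            (is_deriv_mult _ _ _ _ _ _ _ Ht (is_deriv_mult _ _ _ _ _ _ _ Ht Dw Dw)
              (is_deriv_mult _ _ _ _ _ _ _ Ht Dr3 Drr)))).
      + unfold ft; ring.
    - intros t Ht; apply (cont2_slice e); assumption. }
  set (h := fun x => rho x * dot (deriv3 a b (deriv3 a b gamma) x)
                                 (deriv3 a b (deriv3 a b V) x)).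
  assert (E0 : RInt (ft 0) a b = 2 * RInt h a b).
  { assert (SV : smooth3 a b (deriv3 a b V)).
    { apply (smooth3_ext a b (A' 0)); [exact Hab|intros; apply H2; assumption|].
      apply (jet_smooth3 e); (assumption || lra). }
    assert (Ih : ex_RInt h a b).
    { apply (cont_ex_RInt a b); try lra; apply smooth_cont; [exact Hab|].
      apply smooth_mult; [exact Hab|exact Srho|].
      apply smooth_dot; [exact Hab| |]; apply smooth3_deriv; [|exact SV].
      apply smooth3_deriv, Sg. }
    transitivity (RInt (fun x => scal 2 (h x)) a b);
      [|exact (RInt_scal (V := R_CompleteNormedModule) h a b 2 Ih)].
    apply RInt_ext; rewrite Rmin_left, Rmax_right by lra; intros x Hx'.
    assert (Hx : a <= x <= b) by lra.
    destruct (H2 x Hx) as [EA [EB [EA' EB']]].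
    fold A in EA; fold B in EB; fold A' in EA'; fold B' in EB'.
    assert (HA1 : dot (A 0 x) (A 0 x) = 1) by (rewrite EA; apply norm3_eq_1, Hg1, Hx).
    assert (Er : r 0 x = 1) by (unfold r; rewrite HA1, sqrt_1; field).
    assert (Er' : r' 0 x = 0).
    { unfold r'; rewrite EA, EA', dot_comm, HV by exact Hx; ring. }
    assert (Ew : w 0 x = 0).
    { assert (E : dot (B 0 x) (A 0 x) + dot (A 0 x) (B 0 x) = 0).
      { apply (is_deriv_unique a b (fun y => dot (A 0 y) (A 0 y)) x); try assumption.
        - apply is_deriv_dot; try assumption; apply (HP O 1%nat); (assumption || lra).
        - apply (is_deriv_ext a b (fun _ => 1)); [exact Hx| |apply is_deriv_const, Hx].
          intros y Hy; destruct (H2 y Hy) as [Ey _]; unfold A; rewrite Ey.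
          symmetry; apply norm3_eq_1, Hg1, Hy. }
      unfold w; rewrite (dot_comm (B 0 x)) in E; lra. }
    change (ft 0 x = 2 * h x).
    unfold ft, r3', r3, p', h; rewrite Er, Er', Ew, EB, EB'.
    rewrite (dot_comm (deriv3 a b (deriv3 a b V) x)); ring. }
  replace (RInt h a b) with (/ 2 * RInt (ft 0) a b) by (rewrite E0; field).
  exact (is_derive_scal _ _ _ _ Df).
Qed.

(** * First variation of the holonomy *)

Lemma is_deriv3_eq_value (a b : R) (f : R -> R3) (x : R) (l m : R3) :
  is_deriv3 a b f x l -> l = m -> is_deriv3 a b f x m.
Proof. intros H <-; exact H. Qed.

Lemma is_deriv3_ext_loc (a b : R) (f g : R -> R3) (x : R) (l : R3) :
  a <= x <= b -> locally x (fun y => a <= y <= b -> f y = g y) ->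
  is_deriv3 a b f x l -> is_deriv3 a b g x l.
Proof.
  intros Hx He [H1 [H2 H3]]; split3; [revert H1|revert H2|revert H3];
    apply is_deriv_ext_loc; try exact Hx; revert He; apply filter_imp;
    intros y Hy Hab; rewrite (Hy Hab); reflexivity.
Qed.

(** Relative to [a,b], the sets [a,c) and (d,b] are neighbourhoods of the end points, and a relative
    derivative sees nothing else. So a variation keeps the tangents at both ends. *)
Lemma deriv3_eq_near_ends (a b c d : R) (f g : R -> R3) : a < c -> c <= d -> d < b ->
  smooth3 a b f -> (forall x, a <= x <= b -> ~ (c <= x <= d) -> g x = f x) ->
  deriv3 a b g a = deriv3 a b f a /\ deriv3 a b g b = deriv3 a b f b.
Proof.
  intros Hac Hcd Hdb Sf H.
  assert (Hab : a < b) by lra.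
  split; (apply deriv3_eq; [exact Hab|lra|]);
    (eapply is_deriv3_ext_loc; [lra| |apply smooth_is_deriv3; [exact Hab|lra|exact Sf]]).
  - assert (Hp : 0 < c - a) by lra.
    exists (mkposreal _ Hp); intros y Hy Hyab; symmetry; apply H; [exact Hyab|].
    change (Rabs (y - a) < c - a) in Hy; apply Rabs_def2 in Hy; lra.
  - assert (Hp : 0 < b - d) by lra.
    exists (mkposreal _ Hp); intros y Hy Hyab; symmetry; apply H; [exact Hyab|].
    change (Rabs (y - b) < b - d) in Hy; apply Rabs_def2 in Hy; lra.
Qed.

Lemma tangent_arclength (a b : R) (g : R -> R3) (x : R) :
  norm3 (deriv3 a b g x) = 1 -> tangent a b g x = deriv3 a b g x.
Proof.
  intros H; unfold tangent, dds, speed; rewrite H.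
  apply eq3; unfold scale3, c1 at 1, c2 at 1, c3 at 1; simpl; field.
Qed.

(* The linear relation between the four vectors [t], [t'], [u], [w] of R^3, paired with [w]. *)
Lemma plucker_identity (t t' u w : R3) :
  dot (cross (- dot w t' *v t) u) w - dot u w * dot (cross w t') t
  = dot w w * dot (cross t t') u - dot w t * dot (cross t' u) w.
Proof. unfold3; ring. Qed.

(* With [n = M x gamma_t'], where [M] is parallel along [gamma], the connection form of the
   frame [n / |n|] vanishes at [t = 0] together with its numerator, so that the derivative of
   the holonomy only sees the derivative of this numerator. *)
Lemma holonomy_first_variation (a b : R) (gamma V : R -> R3) (e : R) (G : R -> R -> R3)
    (Wa Wb : R3) :
  a < b -> arclength_curve a b gamma -> variation a b gamma V e G ->
  unit_normal a b gamma a Wa -> unit_normal a b gamma b Wb ->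
  exists theta : R -> R,
    (forall t, - e <= t <= e -> is_holonomy a b (G t) Wa Wb (theta t)) /\
    is_deriv (- e) e theta 0
      (- RInt (fun x => dot (cross (deriv3 a b gamma x) (deriv3 a b (deriv3 a b gamma) x))
                            (deriv3 a b V x)) a b).
Proof.
  intros Hab [[Sg Rg] Hg1] HG [Ha1 Ha2] [Hb1 Hb2].
  pose proof (proj1 HG) as He.
  destruct (variation_jet a b gamma V e G Hab HG) as [P [HP [H1 H2]]].
  destruct HG as [_ [_ [Hcurve [_ [_ [c [d [Hac [Hcd [Hdb Hends]]]]]]]]]].
  apply norm3_eq_1 in Ha1, Hb1.
  assert (Ia : a <= a <= b) by lra; assert (Ib : a <= b <= b) by lra.
  rewrite (tangent_arclength a b gamma a) in Ha2 by auto.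
  rewrite (tangent_arclength a b gamma b) in Hb2 by auto.
  set (T := deriv3 a b gamma) in *; set (T' := deriv3 a b T) in *; set (U := deriv3 a b V) in *.
  pose proof (smooth3_deriv a b gamma Sg) as ST; fold T in ST.
  assert (HT : forall x, a <= x <= b -> dot (T x) (T x) = 1).
  { intros x Hx; apply norm3_eq_1, Hg1, Hx. }
  (* With this initial value [M x T] equals [Wa] at [a]. As the tangent at [a] is fixed, the frame
     starts at [Wa] for all [t]. *)
  destruct (parallel_transport_exists a b T (cross (T a) Wa) Hab ST HT)
    as [M [l [SM [Sl [Ma HM]]]]]; [unfold3; ring|].
  assert (HMT : forall x, a <= x <= b -> dot (M x) (T x) = 0) by (intros; apply HM; assumption).
  assert (HMM : forall x, a <= x <= b -> dot (M x) (M x) = 1).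
  { intros x Hx; rewrite (proj2 (proj2 (HM x Hx))).
    replace (dot (cross (T a) Wa) (cross (T a) Wa))
      with (dot (T a) (T a) * dot Wa Wa - dot Wa (T a) ^ 2) by (unfold3; ring).
    rewrite HT, Ha1, Ha2 by exact Ia; ring. }
  assert (Hl : forall x, a <= x <= b -> l x = - dot (M x) (T' x)).
  { intros x Hx.
    assert (E : dot (l x *v T x) (T x) + dot (M x) (T' x) = 0).
    { apply (is_deriv_unique a b (fun y => dot (M y) (T y)) x); try assumption.
      - apply is_deriv_dot; [exact Hx|apply HM, Hx|apply smooth_is_deriv3; assumption].
      - apply (is_deriv_ext a b (fun _ => 0)); [exact Hx| |apply is_deriv_const, Hx].
        intros y Hy; symmetry; apply HMT, Hy. }
    replace (dot (l x *v T x) (T x)) with (l x * dot (T x) (T x)) in E by (unfold3; ring).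
    rewrite HT in E by exact Hx; lra. }
  set (m := fun x => l x *v T x).
  assert (Sm : smooth3 a b m) by (apply smooth3_scale; assumption).
  set (A := P O 1%nat) in *; set (B := P O 2%nat) in *;
    set (A' := P 1%nat 1%nat) in *; set (B' := P 1%nat 2%nat) in *.
  assert (H00 : - e <= 0 <= e) by lra.
  assert (HA : forall t x, - e <= t <= e -> a <= x <= b -> deriv3 a b (G t) x = A t x).
  { intros t x Ht Hx; apply H1; assumption. }
  assert (HAp : forall t x, - e <= t <= e -> a <= x <= b -> 0 < dot (A t x) (A t x)).
  { intros t x Ht Hx; apply H1; assumption. }
  assert (Aends : forall t, - e <= t <= e -> A t a = T a /\ A t b = T b).
  { intros t Ht; rewrite <- !HA by assumption.
    apply (deriv3_eq_near_ends a b c d); auto. }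
  set (r := fun t x => / sqrt (dot (A t x) (A t x))).
  assert (Htan : forall t x, - e <= t <= e -> a <= x <= b ->
            tangent a b (G t) x = r t x *v A t x).
  { intros t x Ht Hx; unfold tangent, dds, speed, norm3; rewrite HA by assumption; reflexivity. }
  assert (Tends : forall t, - e <= t <= e ->
            tangent a b (G t) a = T a /\ tangent a b (G t) b = T b).
  { intros t Ht; rewrite !Htan by assumption; unfold r; destruct (Aends t Ht) as [-> ->].
    rewrite !HT, sqrt_1 by assumption.
    split; apply eq3; unfold scale3, c1 at 1, c2 at 1, c3 at 1; simpl; field. }
  set (n := fun t x => cross (M x) (A t x)).
  set (n' := fun t x => cross (m x) (A t x) +v cross (M x) (B t x)).
  assert (C3 : forall i j, cont2_3 e a b (P i j)) by (intros i j; apply HP).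
  assert (CM : cont2_3 e a b (fun _ x => M x)) by (apply cont2_3_space; assumption).
  assert (Cn : cont2_3 e a b n) by (apply cont2_3_cross; [exact CM|apply C3]).
  (* At [t = 0] the frame [M x T] has length 1, so it can be normalized for [|t| <= delta]. *)
  destruct (cont2_uniformly_pos e a b 1 (fun t x => dot (n t x) (n t x)) He Rlt_0_1)
    as [delta [Hdelta Hn]].
  { apply cont2_dot; exact Cn. }
  { intros x Hx; unfold n; fold A; rewrite (proj1 (H2 x Hx)).
    replace (dot (cross (M x) (T x)) (cross (M x) (T x)))
      with (dot (M x) (M x) * dot (T x) (T x) - dot (M x) (T x) ^ 2) by (unfold3; ring).
    rewrite HMM, HT, HMT by exact Hx; lra. }
  set (q := fun t x => / sqrt (dot (n t x) (n t x))).
  (* This is [<n', A x n>] with [A x (M x A) = <A, A> M - <A, M> A] and [n' = m x A + M x B], where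
     [<M x B, M>] and [<m x A, A>] drop out. In the connection form of [u = q n] the derivative of
     [q] disappears as [n] is orthogonal to [A x n], which leaves [q^2 r num]. *)
  set (num := fun t x => dot (A t x) (A t x) * dot (cross (m x) (A t x)) (M x)
                         - dot (A t x) (M x) * dot (cross (M x) (B t x)) (A t x)).
  set (omega := fun t x => q t x * q t x * r t x * num t x).
  (* The end value of the frame is [N] for all [t]; [theta0] is its angle against [Wb], and the
     rotation that makes the frame parallel adds minus the integral of [omega]. *)
  set (N := cross (M b) (T b)).
  destruct (unit_normal_angle (T b) Wb N) as [theta0 Htheta0]; auto.
  { unfold N.
    replace (dot (cross (M b) (T b)) (cross (M b) (T b)))
      with (dot (M b) (M b) * dot (T b) (T b) - dot (M b) (T b) ^ 2) by (unfold3; ring).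
    rewrite HMM, HT, HMT by assumption; ring. }
  { unfold N; unfold3; ring. }
  assert (Hnear : forall t, - delta <= t <= delta ->
            is_holonomy a b (G t) Wa Wb (theta0 + - RInt (omega t) a b)).
  { intros t Ht.
    assert (Hte : - e <= t <= e) by lra.
    assert (SA : smooth3 a b (A t)) by (apply (jet_smooth3 e); assumption).
    assert (Sn : smooth3 a b (n t)) by (apply smooth3_cross; assumption).
    assert (DA : forall x, a <= x <= b -> is_deriv3 a b (A t) x (B t x)).
    { intros x Hx; apply (HP O 1%nat); assumption. }
    assert (Dn : forall x, a <= x <= b -> is_deriv3 a b (n t) x (n' t x)).
    { intros x Hx; apply is_deriv3_cross; [exact Hx|apply HM, Hx|apply DA, Hx]. }
    assert (Sq : smooth a b (q t)).
    { apply smooth_inv; [exact Hab| |].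
      - intros x Hx; apply Rgt_not_eq, sqrt_lt_R0, Hn; assumption.
      - apply smooth_sqrt; [exact Hab| |apply smooth_dot; assumption].
        intros x Hx; apply Hn; assumption. }
    set (u := fun x => q t x *v n t x).
    assert (Su : smooth3 a b u) by (apply smooth3_scale; assumption).
    assert (Hu : forall x, a <= x <= b ->
              dot (u x) (u x) = 1 /\ dot (u x) (tangent a b (G t) x) = 0).
    { intros x Hx; split.
      - pose proof (Hn t x Ht Hx) as Hp; pose proof (sqrt_lt_R0 _ Hp) as Hs.
        transitivity (q t x ^ 2 * dot (n t x) (n t x));
          [unfold u, dot, scale3, c1, c2, c3; simpl; ring|].
        unfold q; rewrite <- (sqrt_sqrt (dot (n t x) (n t x))) at 2 by lra; field; lra.
      - rewrite Htan by assumption; unfold u, n; generalize (q t x) (r t x); intros.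
        unfold3; ring. }
    pose proof (parallel_of_frame a b (G t) u Hab (Hcurve t Hte) Su Hu) as HZ.
    cbv zeta in HZ.
    set (alpha := fun x => - RInt (fun y =>
      dot (deriv3 a b u y) (cross (tangent a b (G t) y) (u y))) a x) in HZ.
    assert (Ealpha : alpha b = - RInt (omega t) a b).
    { unfold alpha; f_equal; apply RInt_ext; rewrite Rmin_left, Rmax_right by lra; intros x Hx'.
      assert (Hx : a <= x <= b) by lra.
      assert (Du : is_deriv3 a b u x
                     ((- dot (n t x) (n' t x) * q t x ^ 3) *v n t x +v q t x *v n' t x)).
      { apply is_deriv3_scale; [exact Hx| |apply Dn, Hx].
        apply is_deriv_inv_norm; [exact Hx|apply Hn; assumption|apply Dn, Hx]. }
      rewrite (deriv3_eq a b u x _ Hab Hx Du), Htan by assumption.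
      unfold omega, num, u, n', n.
      generalize (- dot (cross (M x) (A t x))
        (cross (m x) (A t x) +v cross (M x) (B t x)) * q t x ^ 3) (q t x) (r t x)
        (M x) (m x) (A t x) (B t x); intros.
      match goal with |- ?v = ?w => change (v = w :> R) end.
      unfold3; ring. }
    assert (Ealpha0 : alpha a = 0).
    { unfold alpha; rewrite RInt_point; apply Ropp_0. }
    destruct (Aends t Hte) as [EAa EAb]; destruct (Tends t Hte) as [ETa ETb].
    exists (fun x => cos (alpha x) *v u x +v sin (alpha x) *v cross (tangent a b (G t) x) (u x)).
    split; [exact HZ|split].
    - rewrite Ealpha0, cos_0, sin_0.
      assert (En : n t a = Wa).
      { unfold n; rewrite EAa, Ma.
        transitivity (dot (T a) (T a) *v Wa -v dot Wa (T a) *v T a);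
          [apply eq3; unfold3; ring|].
        rewrite HT, Ha2 by exact Ia; apply eq3; unfold3; ring. }
      generalize (cross (tangent a b (G t) a) (u a)); intros w.
      unfold u, q; rewrite En, Ha1, sqrt_1, Rinv_1.
      apply eq3; unfold add3, scale3, c1, c2, c3; simpl; ring.
    - assert (Enb : n t b = N) by (unfold n; rewrite EAb; reflexivity).
      assert (HNN : dot N N = 1).
      { unfold N.
        replace (dot (cross (M b) (T b)) (cross (M b) (T b)))
          with (dot (M b) (M b) * dot (T b) (T b) - dot (M b) (T b) ^ 2) by (unfold3; ring).
        rewrite HMM, HT, HMT by assumption; ring. }
      assert (Eu : u b = N).
      { unfold u, q; rewrite Enb, HNN, sqrt_1, Rinv_1.
        apply eq3; unfold scale3, c1, c2, c3; simpl; ring. }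
      (* Rotations about [T b] compose by adding angles because [T x (T x Wb) = - Wb]. *)
      rewrite Eu, ETb, Ealpha, cos_plus, sin_plus, Htheta0.
      transitivity ((cos (- RInt (omega t) a b)) *v (cos theta0 *v Wb +v sin theta0 *v cross (T b) Wb)
        +v sin (- RInt (omega t) a b) *v
           (cos theta0 *v cross (T b) Wb
            +v sin theta0 *v (dot Wb (T b) *v T b -v dot (T b) (T b) *v Wb))).
      { apply eq3; unfold add3, sub3, scale3, cross, dot, c1, c2, c3; simpl; ring. }
      rewrite Hb2, HT by exact Ib.
      apply eq3; unfold add3, sub3, scale3, cross, c1, c2, c3; simpl; ring. }
  assert (Hfar : forall t, - e <= t <= e -> exists theta, is_holonomy a b (G t) Wa Wb theta).
  { intros t Ht; destruct (Tends t Ht) as [ETa ETb].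
    apply holonomy_exists; [exact Hab|apply Hcurve, Ht| |];
      (split; [apply norm3_eq_1; assumption|]); [rewrite ETa|rewrite ETb]; assumption. }
  (* A lift is required on all of [-e,e] but differentiated at 0 only, so beyond [delta] any choice
     of holonomy values will do. *)
  exists (fun t => if Rle_dec (Rabs t) delta then theta0 + - RInt (omega t) a b
                   else epsilon (inhabits 0) (is_holonomy a b (G t) Wa Wb)).
  split.
  { intros t Ht; destruct (Rle_dec (Rabs t) delta) as [Hd|_].
    - apply Hnear, Rabs_le_between, Hd.
    - apply epsilon_spec, Hfar, Ht. }
  apply is_derive_is_deriv; [exact H00|].
  apply (is_derive_ext_loc (fun t => theta0 + - RInt (omega t) a b)).
  { exists (mkposreal _ (proj1 Hdelta)); intros t Ht.
    change (Rabs (t - 0) < delta) in Ht; rewrite Rminus_0_r in Ht.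
    destruct (Rle_dec (Rabs t) delta) as [_|Hd]; [reflexivity|exfalso; lra]. }
  set (r' := fun t x => - dot (A t x) (A' t x) * (r t x * (r t x * r t x))).
  set (nt := fun t x => cross (M x) (A' t x)).
  set (q' := fun t x => - dot (n t x) (nt t x) * (q t x * (q t x * q t x))).
  set (num' := fun t x =>
    (dot (A' t x) (A t x) + dot (A t x) (A' t x)) * dot (cross (m x) (A t x)) (M x)
    + dot (A t x) (A t x) * dot (cross (m x) (A' t x)) (M x)
    - (dot (A' t x) (M x) * dot (cross (M x) (B t x)) (A t x)
       + dot (A t x) (M x) * (dot (cross (M x) (B' t x)) (A t x)
                              + dot (cross (M x) (B t x)) (A' t x)))).
  set (omega' := fun t x =>
    ((q' t x * q t x + q t x * q' t x) * r t x + q t x * q t x * r' t x) * num t x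
    + q t x * q t x * r t x * num' t x).
  (* The factor [q] is controlled only where the frame does not vanish, hence the smaller parameter
     interval. *)
  assert (HPd : jet delta a b P) by (apply (jet_subinterval e); [lra|exact HP]).
  assert (Cd : forall i j, cont2_3 delta a b (P i j)) by (intros i j; apply HPd).
  assert (CMd : cont2_3 delta a b (fun _ x => M x)) by (apply cont2_3_space; assumption).
  assert (Cmd : cont2_3 delta a b (fun _ x => m x)) by (apply cont2_3_space; assumption).
  pose proof (Cd O 1%nat) as CA; pose proof (Cd O 2%nat) as CB;
    pose proof (Cd 1%nat 1%nat) as CA'; pose proof (Cd 1%nat 2%nat) as CB'.
  fold A in CA; fold B in CB; fold A' in CA'; fold B' in CB'.
  assert (Cnd : cont2_3 delta a b n) by (apply cont2_3_cross; assumption).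
  assert (Cnt : cont2_3 delta a b nt) by (apply cont2_3_cross; assumption).
  assert (Cinv : forall F : R -> R -> R3, cont2_3 delta a b F ->
    (forall t x, - delta <= t <= delta -> a <= x <= b -> 0 < dot (F t x) (F t x)) ->
    cont2 delta a b (fun t x => / sqrt (dot (F t x) (F t x)))).
  { intros F CF HF; apply cont2_inv; [lra|lra| |].
    - intros t x Ht Hx; apply Rgt_not_eq, sqrt_lt_R0, HF; assumption.
    - apply cont2_sqrt; [lra|lra|apply cont2_dot; assumption]. }
  assert (Cr : cont2 delta a b r).
  { apply Cinv; [exact CA|intros t x Ht Hx; apply HAp; [lra|exact Hx]]. }
  assert (Cq : cont2 delta a b q) by (apply Cinv; [exact Cnd|intros; apply Hn; assumption]).
  assert (Copp : forall F, cont2 delta a b F -> cont2 delta a b (fun t x => - F t x)).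
  { intros F CF; apply (cont2_ext delta a b (fun t x => -1 * F t x)); [lra|lra|intros; ring|].
    apply cont2_mult; [apply cont2_const|exact CF]. }
  assert (Cr' : cont2 delta a b r').
  { apply cont2_mult; [apply Copp, cont2_dot; assumption|repeat apply cont2_mult; assumption]. }
  assert (Cq' : cont2 delta a b q').
  { apply cont2_mult; [apply Copp, cont2_dot; assumption|repeat apply cont2_mult; assumption]. }
  assert (Cdet : forall F1 F2 F3, cont2_3 delta a b F1 -> cont2_3 delta a b F2 ->
    cont2_3 delta a b F3 -> cont2 delta a b (fun t x => dot (cross (F1 t x) (F2 t x)) (F3 t x))).
  { intros F1 F2 F3 K1 K2 K3.
    exact (cont2_dot _ _ _ _ _ (cont2_3_cross _ _ _ _ _ K1 K2) K3). }
  assert (Cnum : cont2 delta a b num).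
  { apply cont2_minus; apply cont2_mult.
    - exact (cont2_dot _ _ _ _ _ CA CA).
    - exact (Cdet _ _ _ Cmd CA CMd).
    - exact (cont2_dot _ _ _ _ _ CA CMd).
    - exact (Cdet _ _ _ CMd CB CA). }
  assert (Cnum' : cont2 delta a b num').
  { apply cont2_minus; apply cont2_plus; apply cont2_mult.
    - exact (cont2_plus _ _ _ _ _ (cont2_dot _ _ _ _ _ CA' CA) (cont2_dot _ _ _ _ _ CA CA')).
    - exact (Cdet _ _ _ Cmd CA CMd).
    - exact (cont2_dot _ _ _ _ _ CA CA).
    - exact (Cdet _ _ _ Cmd CA' CMd).
    - exact (cont2_dot _ _ _ _ _ CA' CMd).
    - exact (Cdet _ _ _ CMd CB CA).
    - exact (cont2_dot _ _ _ _ _ CA CMd).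
    - exact (cont2_plus _ _ _ _ _ (Cdet _ _ _ CMd CB' CA) (Cdet _ _ _ CMd CB CA')). }
  assert (Cqq : cont2 delta a b (fun t x => q t x * q t x)) by (apply cont2_mult; assumption).
  assert (Com : cont2 delta a b omega).
  { apply cont2_mult; [apply cont2_mult|]; assumption. }
  assert (Com' : cont2 delta a b omega').
  { apply cont2_plus; apply cont2_mult; try assumption.
    - apply cont2_plus; apply cont2_mult; try assumption.
      apply cont2_plus; apply cont2_mult; assumption.
    - apply cont2_mult; assumption. }
  assert (Dom : is_derive (fun t => RInt (omega t) a b) 0 (RInt (omega' 0) a b)).
  { apply (is_derive_RInt_parameter delta); [lra|exact Hab| | |exact Com'].
    2: { intros t Ht; apply (cont2_slice delta); assumption. }
    intros t x Ht Hx.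
    assert (DA : is_deriv3 (- delta) delta (fun s => A s x) t (A' t x))
      by (apply (HPd O 1%nat); assumption).
    assert (DB : is_deriv3 (- delta) delta (fun s => B s x) t (B' t x))
      by (apply (HPd O 2%nat); assumption).
    assert (Dcst : forall v, is_deriv3 (- delta) delta (fun _ => v) t zero3)
      by (intros v; apply is_deriv3_const, Ht).
    assert (Dcross : forall (v : R3) F F', is_deriv3 (- delta) delta F t F' ->
              is_deriv3 (- delta) delta (fun s => cross v (F s)) t (cross v F')).
    { intros v F F' DF; eapply is_deriv3_eq_value.
      - exact (is_deriv3_cross _ _ _ _ _ _ _ Ht (Dcst v) DF).
      - apply eq3; unfold3; ring. }
    assert (Ddot : forall (v : R3) F F', is_deriv3 (- delta) delta F t F' ->
              is_deriv (- delta) delta (fun s => dot (F s) v) t (dot F' v)).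
    { intros v F F' DF; eapply is_deriv_eq_value.
      - exact (is_deriv_dot _ _ _ _ _ _ _ Ht DF (Dcst v)).
      - unfold3; ring. }
    assert (Dr : is_deriv (- delta) delta (fun s => r s x) t (r' t x)).
    { eapply is_deriv_eq_value;
        [apply is_deriv_inv_norm; [exact Ht|apply HAp; [lra|exact Hx]|exact DA]|].
      unfold r', r; ring. }
    assert (Dq : is_deriv (- delta) delta (fun s => q s x) t (q' t x)).
    { eapply is_deriv_eq_value.
      - apply (is_deriv_inv_norm _ _ (fun s => n s x)); [exact Ht|apply Hn; assumption|].
        exact (Dcross (M x) _ _ DA).
      - unfold q', q, nt; ring. }
    assert (Dnum : is_deriv (- delta) delta (fun s => num s x) t (num' t x)).
    { exact (is_deriv_minus _ _ _ _ _ _ _ Ht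
        (is_deriv_mult _ _ _ _ _ _ _ Ht (is_deriv_dot _ _ _ _ _ _ _ Ht DA DA)
           (Ddot (M x) _ _ (Dcross (m x) _ _ DA)))
        (is_deriv_mult _ _ _ _ _ _ _ Ht (Ddot (M x) _ _ DA)
           (is_deriv_dot _ _ _ _ _ _ _ Ht (Dcross (M x) _ _ DB) DA))). }
    exact (is_deriv_mult _ _ _ _ _ _ _ Ht (is_deriv_mult _ _ _ _ _ _ _ Ht
      (is_deriv_mult _ _ _ _ _ _ _ Ht Dq Dq) Dr) Dnum). }
  replace (RInt (fun x => dot (cross (T x) (T' x)) (U x)) a b) with (RInt (omega' 0) a b).
  { replace (- RInt (omega' 0) a b) with (0 + - RInt (omega' 0) a b) by ring.
    apply (is_derive_plus (V := R_NormedModule) (fun _ => theta0)).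
    - apply @is_derive_const.
    - exact (is_derive_opp (V := R_NormedModule) _ _ _ Dom). }
  apply RInt_ext; rewrite Rmin_left, Rmax_right by lra; intros x Hx'.
  assert (Hx : a <= x <= b) by lra.
  destruct (H2 x Hx) as [EA [EB [EA' _]]].
  assert (EAA : dot (A 0 x) (A 0 x) = 1) by (rewrite EA; apply HT, Hx).
  assert (Enn : dot (n 0 x) (n 0 x) = 1).
  { unfold n; rewrite EA.
    replace (dot (cross (M x) (T x)) (cross (M x) (T x)))
      with (dot (M x) (M x) * dot (T x) (T x) - dot (M x) (T x) ^ 2) by (unfold3; ring).
    rewrite HMM, HT, HMT by exact Hx; ring. }
  assert (Er : r 0 x = 1) by (unfold r; rewrite EAA, sqrt_1; field).
  assert (Eq : q 0 x = 1) by (unfold q; rewrite Enn, sqrt_1; field).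
  assert (E1 : dot (cross (m x) (A 0 x)) (M x) = 0).
  { unfold m; rewrite EA; generalize (l x) (T x) (M x); intros; unfold3; ring. }
  assert (E2 : dot (A 0 x) (M x) = 0) by (rewrite EA, dot_comm; apply HMT, Hx).
  change (omega' 0 x = dot (cross (T x) (T' x)) (U x)).
  unfold omega', num, num'.
  rewrite E1, E2, Er, Eq, EAA, EA, EB, EA'.
  pose proof (HMM x Hx) as F1; pose proof (HMT x Hx) as F2.
  unfold m; rewrite (Hl x Hx).
  (* At [t = 0] both terms of [num] vanish, as [m] is a multiple of [T] and [M] is orthogonal to
     [T]. So [omega'] reduces to [num'], whose surviving part is the left side of [plucker_identity]
     with [w = M]. *)
  transitivity (dot (cross (- dot (M x) (T' x) *v T x) (U x)) (M x)
                - dot (U x) (M x) * dot (cross (M x) (T' x)) (T x)); [ring|].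
  rewrite plucker_identity, F1, F2; ring.
Qed.

(** * Test functions *)

Lemma variation_tangent_ends (a b : R) (gamma V : R -> R3) (e : R) (G : R -> R -> R3)
    (t : R) :
  smooth3 a b gamma -> variation a b gamma V e G -> - e <= t <= e ->
  tangent a b (G t) a = tangent a b gamma a /\ tangent a b (G t) b = tangent a b gamma b.
Proof.
  intros Sg [_ [_ [_ [_ [_ [c [d [Hac [Hcd [Hdb H]]]]]]]]]] Ht.
  destruct (deriv3_eq_near_ends a b c d gamma (G t)) as [Ea Eb]; auto.
  unfold tangent, dds, speed; rewrite Ea, Eb; split; reflexivity.
Qed.

(* Two lifts of the holonomy differ by multiples of [2 pi], so that the sine of their
   difference vanishes identically. *)
Lemma holonomy_lift_derivative (a b : R) (gamma V : R -> R3) (e : R) (G : R -> R -> R3)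
    (Wa Wb : R3) (theta : R -> R) (l : R) :
  a < b -> arclength_curve a b gamma -> variation a b gamma V e G ->
  unit_normal a b gamma a Wa -> unit_normal a b gamma b Wb ->
  (forall t, - e <= t <= e -> is_holonomy a b (G t) Wa Wb (theta t)) ->
  is_deriv (- e) e theta 0 l ->
  l = - RInt (fun x => dot (cross (deriv3 a b gamma x) (deriv3 a b (deriv3 a b gamma) x))
                           (deriv3 a b V x)) a b.
Proof.
  intros Hab Hg HG HWa HWb Htheta Dtheta.
  destruct (holonomy_first_variation a b gamma V e G Wa Wb Hab Hg HG HWa HWb)
    as [psi [Hpsi Dpsi]].
  match type of Dpsi with is_deriv _ _ _ _ ?v => set (l' := v) in * end.
  pose proof (proj1 HG) as He; assert (H00 : - e <= 0 <= e) by lra.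
  (* By uniqueness of parallel transport both angles describe the same vector at [b]; pairing it
     with [Wb] and [T x Wb] recovers cosine and sine. *)
  assert (E : forall t, - e <= t <= e ->
            cos (theta t) = cos (psi t) /\ sin (theta t) = sin (psi t)).
  { intros t Ht.
    destruct (Htheta t Ht) as [Z [HZ [Za Zb]]], (Hpsi t Ht) as [Z' [HZ' [Za' Zb']]].
    assert (Eb : Z b = Z' b).
    { apply (parallel_field_unique a b (G t)); try assumption; [congruence|lra]. }
    rewrite Zb, Zb' in Eb.
    destruct HWb as [Wb1 Wb2]; apply norm3_eq_1 in Wb1.
    rewrite <- (proj2 (variation_tangent_ends a b gamma V e G t (proj1 (proj1 Hg)) HG Ht)) in Wb2.
    assert (HT : dot (tangent a b (G t) b) (tangent a b (G t) b) = 1).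
    { assert (Hc : curve a b (G t)) by (apply HG, Ht).
      apply (curve_tangent a b (G t) Hab Hc); lra. }
    revert Eb Wb2 HT; generalize (tangent a b (G t) b); intros T Eb Wb2 HT.
    assert (F : forall s, dot (cos s *v Wb +v sin s *v cross T Wb) Wb = cos s * dot Wb Wb)
      by (intros; unfold3; ring).
    assert (F' : forall s, dot (cos s *v Wb +v sin s *v cross T Wb) (cross T Wb)
              = sin s * (dot T T * dot Wb Wb - dot Wb T ^ 2)) by (intros; unfold3; ring).
    rewrite Wb1 in F, F'; rewrite HT, Wb2 in F'.
    split.
    - apply (f_equal (fun v => dot v Wb)) in Eb; rewrite !F in Eb; lra.
    - apply (f_equal (fun v => dot v (cross T Wb))) in Eb; rewrite !F' in Eb; lra. }
  apply Rminus_diag_uniq.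
  apply (is_deriv_unique (- e) e (fun t => sin (theta t - psi t)) 0); [lra|exact H00| |].
  - eapply is_deriv_eq_value.
    + apply (is_deriv_comp (- e) e sin); [exact H00|apply is_derive_sin|].
      apply is_deriv_minus; [exact H00|exact Dtheta|exact Dpsi].
    + destruct (E 0 H00) as [Ec Es]; rewrite cos_minus, Ec, Es.
      pose proof (sin2_cos2 (psi 0)) as H2; unfold Rsqr in H2.
      replace (cos (psi 0) * cos (psi 0) + sin (psi 0) * sin (psi 0)) with 1 by lra; ring.
  - apply (is_deriv_ext (- e) e (fun _ => 0)); [exact H00| |apply is_deriv_const, H00].
    intros t Ht; destruct (E t Ht) as [Ec Es]; rewrite sin_minus, Ec, Es; ring.
Qed.

(** Rotate the horizontal part of [T] by a right angle, or take a coordinate vector if that part is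
    zero. This provides end vectors with which to instantiate the holonomy constraint. *)
Lemma exists_unit_orthogonal (T : R3) : exists W, norm3 W = 1 /\ dot W T = 0.
Proof.
  destruct T as [[x y] z].
  destruct (Req_dec (x * x + y * y) 0) as [H|H].
  - exists (1, 0, 0); split; [apply norm3_eq_1|]; unfold3; nra.
  - assert (Hp : 0 < x * x + y * y) by nra.
    pose proof (sqrt_lt_R0 _ Hp) as Hs.
    exists (/ sqrt (x * x + y * y) *v (- y, x, 0)); split; [apply norm3_eq_1|].
    + transitivity ((x * x + y * y) / (sqrt (x * x + y * y) * sqrt (x * x + y * y))).
      * unfold3; field; lra.
      * rewrite sqrt_sqrt by lra; field; lra.
    + unfold3; ring.
Qed.

(* The functions [y^-k exp (-1/y)], extended by 0, are closed under differentiation up to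
   linear combinations. *)
Definition flat (k : nat) (y : R) : R :=
  if Rle_dec y 0 then 0 else / y ^ k * exp (- / y).

(** [exp (1 / y)] dominates its Taylor term of order [k + 2]. Two orders beyond [k] leave a factor
    [y ^ 2], which yields derivative 0 at the origin. *)
Lemma flat_quadratic_bound (k : nat) (y : R) : 0 <= flat k y <= INR (Factorial.fact (k + 2)) * y ^ 2.
Proof.
  unfold flat; destruct (Rle_dec y 0) as [_|Hy].
  - split; [lra|apply Rmult_le_pos; [apply pos_INR|apply pow2_ge_0]].
  - apply Rnot_le_lt in Hy.
    assert (Hz : 0 < / y) by (apply Rinv_0_lt_compat, Hy).
    assert (Hk : 0 < / y ^ k) by (apply Rinv_0_lt_compat, pow_lt, Hy).
    split; [apply Rmult_le_pos; [lra|left; apply exp_pos]|].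
    assert (Hf : 0 < INR (Factorial.fact (k + 2))) by (apply INR_fact_lt_0).
    assert (He : (/ y) ^ (k + 2) / INR (Factorial.fact (k + 2)) <= exp (/ y)).
    { eapply Rle_trans; [|apply (exp_ge_taylor (/ y) (k + 2)); lra].
      replace (k + 2)%nat with (S (k + 1)) by lia; rewrite tech5.
      rewrite <- (Rplus_0_l (_ / _)) at 1; apply Rplus_le_compat_r.
      apply cond_pos_sum; intros j.
      apply Rmult_le_pos; [apply pow_le; lra|left; apply Rinv_0_lt_compat, INR_fact_lt_0]. }
    rewrite exp_Ropp.
    assert (Hq : 0 < (/ y) ^ (k + 2) / INR (Factorial.fact (k + 2))).
    { apply Rdiv_lt_0_compat; [apply pow_lt, Hz|exact Hf]. }
    apply Rinv_le_contravar in He; [|exact Hq].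
    eapply Rle_trans; [apply Rmult_le_compat_l; [lra|exact He]|].
    apply Req_le; rewrite pow_add, !pow_inv; field.
    repeat split; try (apply pow_nonzero); lra.
Qed.

Lemma is_derive_flat (k : nat) (y : R) :
  is_derive (flat k) y (flat (k + 2) y - INR k * flat (k + 1) y).
Proof.
  destruct (Rtotal_order y 0) as [Hy|[->|Hy]].
  - apply (is_derive_ext_loc (fun _ => 0)).
    + apply (locally_interval _ y m_infty 0); simpl; try tauto.
      intros z _ Hz; unfold flat; destruct (Rle_dec z 0); [reflexivity|lra].
    + unfold flat; destruct (Rle_dec y 0); [|lra].
      replace (0 - INR k * 0) with 0 by ring; apply @is_derive_const.
  - replace (flat (k + 2) 0 - INR k * flat (k + 1) 0) with 0.
    2: { unfold flat; destruct (Rle_dec 0 0); [ring|lra]. }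
    apply is_derive_eps; intros eps.
    set (C := INR (Factorial.fact (k + 2))).
    assert (HC : 0 < C) by apply INR_fact_lt_0.
    (* For [|y| < eps / C] the bound [C * y ^ 2] is at most [eps * |y|]. *)
    assert (Hd : 0 < eps / C) by (apply Rdiv_lt_0_compat; [apply cond_pos|exact HC]).
    exists (mkposreal _ Hd); intros y Hy; simpl in Hy; rewrite Rminus_0_r in *.
    replace (flat k y - flat k 0 - y * 0) with (flat k y).
    2: { unfold flat at 3; destruct (Rle_dec 0 0); [ring|lra]. }
    destruct (flat_quadratic_bound k y) as [H0 H1]; fold C in H1.
    rewrite Rabs_right by lra.
    eapply Rle_trans; [exact H1|].
    replace (y ^ 2) with (Rabs y * Rabs y)
      by (rewrite <- Rabs_mult, Rabs_right; [ring|apply Rle_ge; nra]).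
    rewrite <- Rmult_assoc; apply Rmult_le_compat_r; [apply Rabs_pos|].
    apply (Rmult_lt_compat_l C) in Hy; [|exact HC].
    replace (C * (eps / C)) with (pos eps) in Hy by (field; lra); lra.
  - apply (is_derive_ext_loc (fun z => / z ^ k * exp (- / z))).
    + apply (locally_interval _ y 0 p_infty); simpl; try tauto.
      intros z Hz _; unfold flat; destruct (Rle_dec z 0); [lra|reflexivity].
    + unfold flat; destruct (Rle_dec y 0); [lra|].
      assert (Hk : y ^ k <> 0) by (apply pow_nonzero; lra).
      auto_derive; [repeat split; (exact Hk || lra)|].
      destruct k as [|k].
      * simpl; field; lra.
      * rewrite !pow_add; simpl pred; rewrite <- !tech_pow_Rmult.
        rewrite <- tech_pow_Rmult in Hk; apply Rmult_neq_0_reg in Hk.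
        simpl (y ^ 0); field; lra.
Qed.

Lemma smooth_flat_affine (a b s t : R) (k : nat) : a < b ->
  smooth a b (fun x => flat k (s * x + t)).
Proof.
  intros Hab; apply smooth_Ck; [exact Hab|].
  assert (Hab' : a <= b) by lra.
  assert (D : forall k x, a <= x <= b -> is_deriv a b (fun x => flat k (s * x + t)) x
    ((flat (k + 2) (s * x + t) + -1 * (INR k * flat (k + 1) (s * x + t))) * s)).
  { intros j x Hx; apply (is_deriv_comp a b (flat j)); [exact Hx| |].
    - replace (flat (j + 2) (s * x + t) + -1 * (INR j * flat (j + 1) (s * x + t)))
        with (flat (j + 2) (s * x + t) - INR j * flat (j + 1) (s * x + t)) by ring.
      apply is_derive_flat.
    - apply is_derive_is_deriv; [exact Hx|auto_derive; [exact I|ring]]. }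
  intros n; revert k; induction n as [|n IH]; intros k.
  - exact (is_deriv_cont a b _ _ Hab' (D k)).
  - exists (fun x => (flat (k + 2) (s * x + t) + -1 * (INR k * flat (k + 1) (s * x + t))) * s).
    split; [apply D|].
    apply Ck_mult; [exact Hab'| |apply Ck_const, Hab'].
    apply Ck_plus; [apply IH|].
    apply Ck_mult; [exact Hab'|apply Ck_const, Hab'|].
    apply Ck_mult; [exact Hab'|apply Ck_const, Hab'|apply IH].
Qed.

Lemma bump_exists (a b c d : R) : a < b -> exists phi : R -> R,
  smooth a b phi /\ (forall x, 0 <= phi x) /\ (forall x, c < x < d -> 0 < phi x) /\
  (forall x, ~ (c <= x <= d) -> phi x = 0).
Proof.
  intros Hab.
  assert (P : forall y, 0 <= flat 0 y) by (intros y; apply flat_quadratic_bound).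
  exists (fun x => flat 0 (1 * x + - c) * flat 0 (-1 * x + d)).
  split; [|split; [|split]].
  - apply smooth_mult; auto using smooth_flat_affine.
  - intros x; apply Rmult_le_pos; apply P.
  - assert (Pp : forall y, 0 < y -> 0 < flat 0 y).
    { intros y Hy; unfold flat; destruct (Rle_dec y 0); [lra|].
      simpl; rewrite Rinv_1, Rmult_1_l; apply exp_pos. }
    intros x Hx; apply Rmult_lt_0_compat; apply Pp; lra.
  - assert (P0 : forall y, y <= 0 -> flat 0 y = 0).
    { intros y Hy; unfold flat; destruct (Rle_dec y 0); [reflexivity|lra]. }
    intros x Hx; destruct (Rle_dec c x).
    + rewrite (P0 (-1 * x + d)); [ring|].
      destruct (Rle_dec x d); [exfalso; lra|lra].
    + rewrite (P0 (1 * x + - c)); [ring|lra].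
Qed.

(** The primitive of [f] vanishes on all of [a,b] and has relative derivative [f] there, the end
    points included. *)
Lemma cont_zero_interior (a b : R) (f : R -> R) (x : R) : a < b -> cont a b f ->
  (forall y, a < y < b -> f y = 0) -> a <= x <= b -> f x = 0.
Proof.
  intros Hab Cf H Hx.
  apply (is_deriv_unique a b (fun y => RInt f a y) x); try assumption.
  - apply is_deriv_RInt; assumption.
  - apply (is_deriv_ext a b (fun _ => 0)); [exact Hx| |apply is_deriv_const, Hx].
    intros y Hy; symmetry; transitivity (RInt (fun _ : R => 0) a y).
    + apply RInt_ext; rewrite Rmin_left, Rmax_right by lra; intros z Hz; apply H; lra.
    + rewrite RInt_const; apply (scal_zero_r (V := R_NormedModule)).
Qed.

(** Both partial integrals are nonnegative and add up to 0, so the primitive vanishes identically,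
    and with it its derivative [f]. *)
Lemma RInt_nonneg_eq_0 (a b : R) (f : R -> R) (x : R) : a < b -> cont a b f ->
  (forall y, a <= y <= b -> 0 <= f y) -> RInt f a b = 0 -> a <= x <= b -> f x = 0.
Proof.
  intros Hab Cf Hf H Hx.
  apply (is_deriv_unique a b (fun y => RInt f a y) x); try assumption.
  - apply is_deriv_RInt; assumption.
  - apply (is_deriv_ext a b (fun _ => 0)); [exact Hx| |apply is_deriv_const, Hx].
    intros y Hy.
    assert (I1 : ex_RInt f a y) by (apply (cont_ex_RInt a b); (assumption || lra)).
    assert (I2 : ex_RInt f y b) by (apply (cont_ex_RInt a b); (assumption || lra)).
    pose proof (RInt_Chasles (V := R_CompleteNormedModule) f a y b I1 I2) as E.
    change (RInt f a y + RInt f y b = RInt f a b) in E.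
    assert (0 <= RInt f a y) by (apply RInt_ge_0; [lra|exact I1|intros; apply Hf; lra]).
    assert (0 <= RInt f y b) by (apply RInt_ge_0; [lra|exact I2|intros; apply Hf; lra]).
    lra.
Qed.

(** The Lagrange multiplier rule for one linear constraint: a functional that vanishes on the kernel
    of [L] is a multiple of [L]. The operation [comb] stands for [x + k y] and the predicate [D] for
    a linear subspace, so that no vector space of test fields has to be built. *)
Lemma functional_multiple (X : Type) (comb : X -> X -> R -> X) (D : X -> Prop)
    (L0 L : X -> R) :
  (forall x y k, D x -> D y -> D (comb x y k)) ->
  (forall x y k, D x -> D y -> L0 (comb x y k) = L0 x + k * L0 y) ->
  (forall x y k, D x -> D y -> L (comb x y k) = L x + k * L y) ->
  (forall x, D x -> L x = 0 -> L0 x = 0) ->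
  exists c, forall x, D x -> L0 x - c * L x = 0.
Proof.
  intros HD HL0 HL H.
  destruct (classic (exists y, D y /\ L y <> 0)) as [[y [Dy Hy]]|Hn].
  - exists (L0 y / L y); intros x Dx.
    (* Subtracting this multiple of [y] projects [x] onto the kernel of [L]. *)
    assert (E : L0 (comb x y (- L x / L y)) = 0).
    { apply H; [auto|]; rewrite HL by assumption; field; exact Hy. }
    rewrite HL0 in E by assumption; rewrite <- E; field; exact Hy.
  - exists 0; intros x Dx; rewrite (H x Dx); [ring|].
    apply NNPP; intros Hx; apply Hn; eauto.
Qed.

(** * The Euler-Lagrange equation *)

Lemma cont2_filterlim (e a b : R) (F : R -> R -> R) (t x : R) :
  - e <= t <= e -> a <= x <= b -> cont2 e a b F ->
  filterlim (fun p : R * R => F (fst p) (snd p))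
    (within (fun p : R * R => - e <= fst p <= e /\ a <= snd p <= b) (locally (t, x)))
    (locally (F t x)).
Proof.
  intros Ht Hx HF.
  pose proof (proj1 (continuity_2d_pt_filterlim _ _ _) (HF t x)) as H.
  cbv beta in H; rewrite !clamp_id in H by assumption.
  intros Q HQ; destruct (H Q HQ) as [d Hd]; exists d; intros [s y] Hsy [Hs Hy].
  specialize (Hd _ Hsy); simpl in *; rewrite !clamp_id in Hd by assumption; exact Hd.
Qed.

Lemma smooth2_affine (e a b : R) (f g : R -> R) : 0 < e -> a < b ->
  smooth a b f -> smooth a b g -> smooth2 e a b (fun t x => f x + t * g x).
Proof.
  intros He Hab Sf Sg.
  set (D := fun j h => Nat.iter j (deriv a b) h : R -> R).
  assert (SD : forall j h, smooth a b h -> smooth a b (D j h)).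
  { induction j as [|j IH]; intros h Sh; [exact Sh|apply smooth_deriv, IH, Sh]. }
  assert (DD : forall j h x, smooth a b h -> a <= x <= b ->
            is_deriv a b (D j h) x (D (S j) h x)).
  { intros j h x Sh Hx; apply smooth_is_deriv; auto. }
  exists (fun i j t x => match i with
    | O => D j f x + t * D j g x | 1%nat => D j g x | _ => 0 end).
  split; [reflexivity|].
  intros i j t x Ht Hx; split; [|split].
  - destruct i as [|[|i]]; [|apply is_deriv_const, Ht|apply is_deriv_const, Ht].
    apply is_derive_is_deriv; [exact Ht|auto_derive; [exact I|ring]].
  - destruct i as [|[|i]]; [|apply DD; assumption|apply is_deriv_const, Hx].
    apply is_deriv_plus; [exact Hx|apply DD; assumption|].
    eapply is_deriv_eq_value.
    + apply is_deriv_mult; [exact Hx|apply is_deriv_const, Hx|apply DD; assumption].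
    + cbv beta; ring.
  - apply (cont2_filterlim e a b (fun t x => match i with
      | O => D j f x + t * D j g x | 1%nat => D j g x | _ => 0 end) t x Ht Hx).
    assert (Cg : cont2 e a b (fun _ x => D j g x)).
    { apply cont2_space, smooth_cont; auto. }
    destruct i as [|[|i]]; [|exact Cg|apply cont2_const].
    apply cont2_plus; [apply cont2_space, smooth_cont; auto|].
    apply cont2_mult; [|exact Cg].
    intros s y; apply continuity_2d_pt_filterlim.
    refine (filterlim_comp _ _ _ fst (clamp (- e) e) _ _ _ _ (clamp_continuous (- e) e s)).
    apply continuous_fst.
Qed.

(** Orthogonality of [V'] and [gamma'] gives [<gamma' + t V', gamma'> = 1], so the derivative never
    vanishes, whatever the size of [t]; the parameter bound 1 is arbitrary. *)
Lemma linear_variation (a b : R) (gamma V : R -> R3) :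
  a < b -> arclength_curve a b gamma -> smooth_compact_support a b V ->
  (forall x, a <= x <= b -> dot (deriv3 a b V x) (deriv3 a b gamma x) = 0) ->
  variation a b gamma V 1 (fun t x => gamma x +v t *v V x).
Proof.
  intros Hab [[Sg _] Hg1] [SV [c [d [Hac [Hcd [Hdb HV0]]]]]] HV.
  pose proof Sg as [G1 [G2 G3]]; pose proof SV as [V1 [V2 V3]].
  assert (I0 : - (1) <= 0 <= 1) by lra.
  split; [lra|split; [|split; [|split; [|split]]]].
  - split3; [exact (smooth2_affine 1 a b _ _ Rlt_0_1 Hab G1 V1)
            |exact (smooth2_affine 1 a b _ _ Rlt_0_1 Hab G2 V2)
            |exact (smooth2_affine 1 a b _ _ Rlt_0_1 Hab G3 V3)].
  - intros t _; split.
    + apply smooth3_add; [exact Hab|exact Sg|].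
      apply smooth3_scale; [exact Hab|apply smooth_const, Hab|exact SV].
    + intros x Hx.
      rewrite (deriv3_eq a b _ x (deriv3 a b gamma x +v t *v deriv3 a b V x) Hab Hx).
      * intros E; apply (f_equal (fun v => dot v (deriv3 a b gamma x))) in E.
        specialize (HV x Hx); specialize (Hg1 x Hx); apply norm3_eq_1 in Hg1.
        revert E HV Hg1; generalize (deriv3 a b gamma x) (deriv3 a b V x); intros v w E HV Hg1.
        replace (dot (v +v t *v w) v) with (dot v v + t * dot w v) in E by (unfold3; ring).
        rewrite HV, Hg1 in E; unfold3; lra.
      * eapply is_deriv3_eq_value.
        -- apply is_deriv3_add; [exact Hx|apply smooth_is_deriv3; assumption|].
           apply is_deriv3_scale;
             [exact Hx|apply is_deriv_const, Hx|apply smooth_is_deriv3; assumption].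
        -- apply eq3; unfold add3, scale3, c1, c2, c3; simpl; ring.
  - intros x Hx; apply eq3; unfold add3, scale3, c1, c2, c3; simpl; ring.
  - intros x Hx; apply deriv3_eq; [lra|exact I0|].
    split3; apply is_derive_is_deriv; try exact I0;
      unfold add3, scale3, c1, c2, c3; simpl; auto_derive; try exact I; ring.
  - exists c, d; split; [exact Hac|split; [exact Hcd|split; [exact Hdb|]]].
    intros t x _ Hx Hn; rewrite HV0 by assumption.
    apply eq3; unfold add3, scale3, zero3, c1, c2, c3; simpl; ring.
Qed.

Lemma smooth_compact_support_ends (a b : R) (V : R -> R3) :
  smooth_compact_support a b V ->
  V a = zero3 /\ V b = zero3 /\ deriv3 a b V a = zero3 /\ deriv3 a b V b = zero3.
Proof.
  intros [SV [c [d [Hac [Hcd [Hdb H]]]]]].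
  assert (Hab : a < b) by lra.
  split; [apply H; lra|split; [apply H; lra|]].
  destruct (deriv3_eq_near_ends a b c d (fun _ => zero3) V) as [Ea Eb];
    auto using smooth3_const.
  rewrite Ea, Eb; split; (apply deriv3_eq; [exact Hab|lra|apply is_deriv3_const; lra]).
Qed.

(** Outside the support of [U] the primitive is constant: zero on the left because it starts at [a],
    zero on the right because the total integrals vanish. This is where the three components of the
    integral of [U] become constraints. *)
Lemma primitive_compact_support (a b : R) (U : R -> R3) :
  smooth_compact_support a b U ->
  RInt (fun x => c1 (U x)) a b = 0 -> RInt (fun x => c2 (U x)) a b = 0 ->
  RInt (fun x => c3 (U x)) a b = 0 ->
  exists V, smooth_compact_support a b V /\
    forall x, a <= x <= b -> is_deriv3 a b V x (U x).
Proof.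
  intros [SU [c [d [Hac [Hcd [Hdb HU]]]]]] E1 E2 E3.
  assert (Hab : a < b) by lra.
  set (J := fun (f : R -> R) x => RInt f a x : R).
  set (V := fun x => (J (fun y => c1 (U y)) x, J (fun y => c2 (U y)) x, J (fun y => c3 (U y)) x) : R3).
  pose proof SU as [S1 [S2 S3]].
  assert (DJ : forall f x, smooth a b f -> a <= x <= b -> is_deriv a b (J f) x (f x)).
  { intros f x Sf Hx; apply is_deriv_RInt; [exact Hx|apply smooth_cont; assumption]. }
  assert (DV : forall x, a <= x <= b -> is_deriv3 a b V x (U x)).
  { intros x Hx; split3; [apply (DJ (fun y => c1 (U y)))|apply (DJ (fun y => c2 (U y)))
      |apply (DJ (fun y => c3 (U y)))]; assumption. }
  exists V; split; [|exact DV]; split; [apply (smooth3_primitive a b V U); assumption|].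
  exists c, d; split; [exact Hac|split; [exact Hcd|split; [exact Hdb|]]].
  assert (J0 : forall f x, smooth a b f -> RInt f a b = 0 ->
    (forall y, a <= y <= b -> ~ (c <= y <= d) -> f y = 0) ->
    a <= x <= b -> ~ (c <= x <= d) -> J f x = 0).
  { intros f x Sf Eb Hf Hx Hn; unfold J.
    destruct (Rlt_dec x c) as [Hxc|Hxc].
    - destruct (is_deriv_mean_value a b (J f) f a x) as [y [Hy E]]; try lra.
      { intros z Hz; apply DJ; assumption. }
      rewrite Hf in E by lra; unfold J in E.
      rewrite (RInt_point (V := R_CompleteNormedModule) a f) in E; change (zero : R) with 0 in E; lra.
    - destruct (is_deriv_mean_value a b (J f) f x b) as [y [Hy E]]; try lra.
      { intros z Hz; apply DJ; assumption. }
      rewrite Hf in E by lra; unfold J in E; lra. }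
  intros x Hx Hn; apply eq3;
    [apply (J0 (fun y => c1 (U y)))|apply (J0 (fun y => c2 (U y)))
      |apply (J0 (fun y => c3 (U y)))]; auto; intros y Hy Hny; rewrite HU by assumption; reflexivity.
Qed.

Lemma RInt_dot_comb (a b k : R) (F F' U : R -> R3) : a < b ->
  smooth3 a b F -> smooth3 a b F' -> smooth3 a b U ->
  RInt (fun x => dot (F x +v k *v F' x) (U x)) a b
  = RInt (fun x => dot (F x) (U x)) a b + k * RInt (fun x => dot (F' x) (U x)) a b.
Proof.
  intros Hab SF SF' SU.
  assert (I1 : forall H, smooth3 a b H -> ex_RInt (fun x => dot (H x) (U x)) a b).
  { intros H SH; apply (cont_ex_RInt a b); try lra.
    apply smooth_cont; auto using smooth_dot. }
  transitivity (RInt (fun x => plus (dot (F x) (U x)) (scal k (dot (F' x) (U x)))) a b).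
  { apply RInt_ext; intros x _; change (dot (F x +v k *v F' x) (U x)
      = dot (F x) (U x) + k * dot (F' x) (U x)).
    unfold dot, add3, scale3, c1, c2, c3; simpl; ring. }
  rewrite (RInt_plus (V := R_CompleteNormedModule)); auto.
  - change (RInt (fun x => dot (F x) (U x)) a b + RInt (fun x => scal k (dot (F' x) (U x))) a b
      = RInt (fun x => dot (F x) (U x)) a b + k * RInt (fun x => dot (F' x) (U x)) a b).
    f_equal; exact (RInt_scal (V := R_CompleteNormedModule) _ a b k (I1 F' SF')).
  - exact (ex_RInt_scal (V := R_NormedModule) _ _ _ k (I1 F' SF')).
Qed.

Lemma smooth_compact_support_comb (a b k : R) (U U' : R -> R3) :
  smooth_compact_support a b U -> smooth_compact_support a b U' ->
  smooth_compact_support a b (fun x => U x +v k *v U' x).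
Proof.
  intros [S [c [d [H1 [H2 [H3 H]]]]]] [S' [c' [d' [H1' [H2' [H3' H']]]]]].
  assert (Hab : a < b) by lra; split.
  - apply smooth3_add; [exact Hab|exact S|].
    apply smooth3_scale; [exact Hab|apply smooth_const, Hab|exact S'].
  - pose proof (Rmin_l c c'); pose proof (Rmin_r c c').
    pose proof (Rmax_l d d'); pose proof (Rmax_r d d').
    exists (Rmin c c'), (Rmax d d').
    split; [apply Rmin_glb_lt; assumption|split; [lra|split; [apply Rmax_lub_lt; assumption|]]].
    intros x Hx Hn; rewrite H, H' by (auto; intros Hcd; apply Hn; lra).
    apply eq3; unfold add3, scale3, zero3, c1, c2, c3; simpl; ring.
Qed.

(* Fundamental lemma of the calculus of variations with values in the planes orthogonal to [T]. *)
Lemma orthogonal_test_functions (a b : R) (T h : R -> R3) (x : R) : a < b ->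
  smooth3 a b T -> (forall x, a <= x <= b -> dot (T x) (T x) = 1) -> smooth3 a b h ->
  (forall U, smooth_compact_support a b U ->
     (forall x, a <= x <= b -> dot (U x) (T x) = 0) ->
     RInt (fun x => dot (h x) (U x)) a b = 0) ->
  a <= x <= b -> h x = dot (h x) (T x) *v T x.
Proof.
  intros Hab ST HT Sh H Hx.
  set (w := fun x => h x -v dot (h x) (T x) *v T x).
  assert (Sw : smooth3 a b w).
  { apply smooth3_sub; [exact Hab|exact Sh|].
    apply smooth3_scale; auto using smooth_dot. }
  assert (Sww : smooth a b (fun x => dot (w x) (w x))) by auto using smooth_dot.
  assert (HwT : forall x, a <= x <= b -> dot (w x) (T x) = 0).
  { intros y Hy.
    transitivity (dot (h y) (T y) * (1 - dot (T y) (T y))); [unfold w; unfold3; ring|].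
    rewrite HT by exact Hy; ring. }
  assert (E : dot (w x) (w x) = 0).
  (* Test fields vanish near the ends, so the interior is treated first and the end points follow by
     continuity. *)
  { apply (cont_zero_interior a b (fun x => dot (w x) (w x))); try assumption.
    { apply smooth_cont; assumption. }
    intros y Hy.
    (* The support reaches halfway from [y] to either end, hence stays compact in the open interval;
       the test field is the bump times the normal part [w] of [h]. *)
    destruct (bump_exists a b ((a + y) / 2) ((y + b) / 2) Hab)
      as [phi [Sphi [Hphi0 [Hphi1 Hphi2]]]].
    assert (E : RInt (fun x => phi x * dot (w x) (w x)) a b = 0).
    { rewrite <- (H (fun x => phi x *v w x)).
      - apply RInt_ext; rewrite Rmin_left, Rmax_right by lra; intros z Hz'.
        assert (Hz : a <= z <= b) by lra.
        change (phi z * dot (w z) (w z) = dot (h z) (phi z *v w z)).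
        transitivity (phi z * (dot (w z) (w z) + dot (h z) (T z) * dot (w z) (T z)));
          [rewrite HwT by exact Hz; ring|unfold w; unfold3; ring].
      - split; [apply smooth3_scale; assumption|].
        exists ((a + y) / 2), ((y + b) / 2).
        split; [lra|split; [lra|split; [lra|]]].
        intros z _ Hz; rewrite Hphi2 by exact Hz.
        apply eq3; unfold scale3, zero3, c1, c2, c3; simpl; ring.
      - intros z Hz; transitivity (phi z * dot (w z) (T z));
          [unfold dot, scale3, c1, c2, c3; simpl; ring|].
        rewrite HwT by exact Hz; ring. }
    assert (E' : phi y * dot (w y) (w y) = 0).
    { apply (RInt_nonneg_eq_0 a b (fun x => phi x * dot (w x) (w x))); auto; [| |lra].
      - apply smooth_cont; [exact Hab|apply smooth_mult; assumption].
      - intros z _; apply Rmult_le_pos; [apply Hphi0|unfold dot; nra]. }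
    assert (0 < phi y) by (apply Hphi1; lra).
    apply Rmult_integral in E'; destruct E'; [lra|assumption]. }
  assert (w x = zero3) as Hw by (apply NNPP; intros Hn; apply dot_pos in Hn; lra).
  unfold w in Hw; revert Hw; generalize (dot (h x) (T x) *v T x) (h x); intros v v' Hw.
  apply eq3; [apply (f_equal c1) in Hw|apply (f_equal c2) in Hw|apply (f_equal c3) in Hw];
    unfold3; lra.
Qed.

(* The Euler-Lagrange equation in integrated form: [(rho T')' - f T - mu T x T'] is constant. *)
Lemma elastic_iff (a b : R) (gamma : R -> R3) (rho : R -> R) :
  let T := deriv3 a b gamma in
  let T1 := deriv3 a b T in
  let Q := deriv3 a b (fun x => rho x *v T1 x) in
  a < b -> arclength_curve a b gamma -> smooth a b rho ->
  holonomy_constrained_elastic a b rho gamma <->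
  exists f mu, smooth a b f /\ forall x, a <= x <= b ->
    is_deriv3 a b (fun y => Q y -v f y *v T y -v mu *v cross (T y) (T1 y)) x zero3.
Proof.
  intros T T1 Q Hab Hg Srho.
  pose proof Hg as [[Sg _] Hg1].
  pose proof (smooth3_deriv a b gamma Sg) as ST; fold T in ST.
  pose proof (smooth3_deriv a b T ST) as ST1; fold T1 in ST1.
  assert (SR : smooth3 a b (fun x => rho x *v T1 x)) by (apply smooth3_scale; assumption).
  pose proof (smooth3_deriv a b _ SR) as SQ; fold Q in SQ.
  assert (DR : forall x, a <= x <= b -> is_deriv3 a b (fun x => rho x *v T1 x) x (Q x)).
  { intros x Hx; apply smooth_is_deriv3; assumption. }
  assert (STT1 : smooth3 a b (fun x => cross (T x) (T1 x))) by (apply smooth3_cross; assumption).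
  assert (HT : forall x, a <= x <= b -> dot (T x) (T x) = 1).
  { intros x Hx; apply norm3_eq_1, Hg1, Hx. }
  assert (Ia : a <= a <= b) by lra; assert (Ib : a <= b <= b) by lra.
  assert (Iint : forall h, smooth a b h -> ex_RInt h a b).
  { intros h Sh; apply (cont_ex_RInt a b); try lra; apply smooth_cont; assumption. }
  split.
  - intros Hel.
    set (D := fun U => smooth_compact_support a b U /\
                       forall x, a <= x <= b -> dot (U x) (T x) = 0).
    set (W := fun x => cross (T x) (T1 x)) in *.
    set (comb := fun (U U' : R -> R3) k x => U x +v k *v U' x).
    set (L := fun (F : R -> R3) (U : R -> R3) => RInt (fun x => dot (F x) (U x)) a b : R).
    set (e1 := fun _ : R => (1, 0, 0) : R3); set (e2 := fun _ : R => (0, 1, 0) : R3);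
      set (e3 := fun _ : R => (0, 0, 1) : R3).
    assert (S1 : smooth3 a b e1) by (apply smooth3_const, Hab).
    assert (S2 : smooth3 a b e2) by (apply smooth3_const, Hab).
    assert (S3 : smooth3 a b e3) by (apply smooth3_const, Hab).
    assert (Dcomb : forall U U' k, D U -> D U' -> D (comb U U' k)).
    { intros U U' k [H1 H2] [H1' H2']; split; [apply smooth_compact_support_comb; assumption|].
      intros x Hx; transitivity (dot (U x) (T x) + k * dot (U' x) (T x)).
      - unfold comb, dot, add3, scale3, c1, c2, c3; simpl; ring.
      - rewrite H2, H2' by exact Hx; ring. }
    assert (Lcomb : forall F, smooth3 a b F -> forall U U' k, D U -> D U' ->
              L F (comb U U' k) = L F U + k * L F U').
    { intros F SF U U' k [[SU _] _] [[SU' _] _].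
      assert (Ec : forall U'', L F U'' = RInt (fun x => dot (U'' x) (F x)) a b).
      { intros U''; apply RInt_ext; intros x _; apply dot_comm. }
      rewrite !Ec; apply RInt_dot_comb; assumption. }
    (* The first three conditions make [U] the derivative of an admissible [V]; the fourth says that
       the holonomy is stationary along every variation with field [V]. *)
    assert (Hkey : forall U, D U -> L e1 U = 0 -> L e2 U = 0 -> L e3 U = 0 -> L W U = 0 ->
              L Q U = 0).
    { intros U [HU HUT] E1 E2 E3 E4.
      pose proof (smooth_compact_support_ends a b U HU) as [Ua [Ub _]].
      destruct (primitive_compact_support a b U HU) as [V [HV DV]].
      { rewrite <- E1; apply RInt_ext; intros x _; unfold e1, dot, c1 at 2, c2 at 1, c3 at 1;
          simpl; symmetry; match goal with |- ?u = ?v => change (u = v :> R) end; ring. }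
      { rewrite <- E2; apply RInt_ext; intros x _; unfold e2, dot, c1 at 1, c2 at 2, c3 at 1;
          simpl; symmetry; match goal with |- ?u = ?v => change (u = v :> R) end; ring. }
      { rewrite <- E3; apply RInt_ext; intros x _; unfold e3, dot, c1 at 1, c2 at 1, c3 at 2;
          simpl; symmetry; match goal with |- ?u = ?v => change (u = v :> R) end; ring. }
      assert (EV : forall x, a <= x <= b -> deriv3 a b V x = U x).
      { intros x Hx; apply deriv3_eq; auto. }
      assert (HVT : forall x, a <= x <= b -> dot (deriv3 a b V x) (deriv3 a b gamma x) = 0).
      { intros x Hx; rewrite EV by exact Hx; apply HUT, Hx. }
      pose proof (linear_variation a b gamma V Hab Hg HV HVT) as HG.
      pose proof (bending_first_variation a b rho gamma V 1 _ Hab Hg Srho HG HVT) as DB.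
      assert (DB0 : is_dbending a b rho gamma V 0).
      { apply Hel; [exact HV|exact HVT|].
        intros Wa Wb HWa HWb e G HG'.
        destruct (holonomy_first_variation a b gamma V e G Wa Wb Hab Hg HG' HWa HWb)
          as [theta [Htheta Dtheta]].
        exists theta; split; [exact Htheta|].
        eapply is_deriv_eq_value; [exact Dtheta|].
        rewrite <- Ropp_0; f_equal; rewrite <- E4; apply RInt_ext.
        rewrite Rmin_left, Rmax_right by lra; intros x Hx; rewrite EV by lra; reflexivity. }
      pose proof (is_deriv_unique (-(1)) 1 _ 0 _ 0 ltac:(lra) ltac:(lra) DB (DB0 1 _ HG)) as E0.
      destruct HU as [SU _].
      pose proof (smooth3_deriv a b U SU) as SU1.
      set (U1 := deriv3 a b U) in *.
      assert (EU1 : forall x, a <= x <= b -> deriv3 a b (deriv3 a b V) x = U1 x).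
      { intros x Hx; apply deriv3_eq; [exact Hab|exact Hx|].
        apply (is_deriv3_ext a b U); [exact Hx|intros; symmetry; auto|].
        apply smooth_is_deriv3; assumption. }
      set (h := fun x => rho x * dot (T1 x) (U1 x)).
      assert (Sh : smooth a b h) by (apply smooth_mult; auto using smooth_dot).
      assert (Eh : RInt h a b = 0).
      { rewrite <- E0; apply RInt_ext; rewrite Rmin_left, Rmax_right by lra; intros x Hx.
        rewrite EU1 by lra; reflexivity. }
      (* Integration by parts: the integrand is the derivative of [<rho T', U>], and [U] vanishes at
         both ends. *)
      assert (E : RInt (fun x => dot (Q x) (U x) + h x) a b = 0).
      { rewrite (RInt_is_deriv a b (fun x => dot (rho x *v T1 x) (U x)) _ b Ib).
        - rewrite Ua, Ub; unfold dot, zero3, c1, c2, c3; simpl; ring.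
        - intros x Hx; eapply is_deriv_eq_value.
          + exact (is_deriv_dot _ _ _ _ _ _ _ Hx (DR x Hx) (smooth_is_deriv3 a b U x Hab Hx SU)).
          + fold U1; unfold h, dot, scale3, c1, c2, c3; simpl; ring.
        - apply smooth_cont; [exact Hab|].
          apply smooth_plus; [exact Hab|apply smooth_dot; assumption|exact Sh]. }
      assert (E' : RInt (fun x => dot (Q x) (U x) + h x) a b = L Q U + RInt h a b).
      { apply (RInt_plus (V := R_CompleteNormedModule)); apply Iint; auto using smooth_dot. }
      lra. }
    (* The four constraints are removed one at a time. Each application enlarges the space of test
       fields by dropping one condition and subtracts the corresponding multiplier from the
       functional. *)
    destruct (functional_multiple (R -> R3) comb
      (fun U => D U /\ L e1 U = 0 /\ L e2 U = 0 /\ L e3 U = 0) (L Q) (L W)) as [mu Hmu].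
    { intros U U' k [H0 [H1 [H2 H3]]] [H0' [H1' [H2' H3']]].
      split; [auto|]; rewrite !Lcomb, H1, H2, H3, H1', H2', H3' by assumption.
      repeat split; ring. }
    { intros U U' k [H0 _] [H0' _]; auto. }
    { intros U U' k [H0 _] [H0' _]; auto. }
    { intros U [H0 [H1 [H2 H3]]] H4; auto. }
    destruct (functional_multiple (R -> R3) comb
      (fun U => D U /\ L e1 U = 0 /\ L e2 U = 0)
      (fun U => L Q U - mu * L W U) (L e3)) as [k3 Hk3].
    { intros U U' k [H0 [H1 H2]] [H0' [H1' H2']].
      split; [auto|]; rewrite !Lcomb, H1, H2, H1', H2' by assumption; split; ring. }
    { intros U U' k [H0 _] [H0' _]; rewrite !Lcomb by assumption; ring. }
    { intros U U' k [H0 _] [H0' _]; auto. }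
    { intros U [H0 [H1 H2]] H3; auto. }
    destruct (functional_multiple (R -> R3) comb (fun U => D U /\ L e1 U = 0)
      (fun U => L Q U - mu * L W U - k3 * L e3 U) (L e2)) as [k2 Hk2].
    { intros U U' k [H0 H1] [H0' H1'].
      split; [auto|]; rewrite !Lcomb, H1, H1' by assumption; ring. }
    { intros U U' k [H0 _] [H0' _]; rewrite !Lcomb by assumption; ring. }
    { intros U U' k [H0 _] [H0' _]; auto. }
    { intros U [H0 H1] H2; auto. }
    destruct (functional_multiple (R -> R3) comb D
      (fun U => L Q U - mu * L W U - k3 * L e3 U - k2 * L e2 U) (L e1)) as [k1 Hk1].
    { exact Dcomb. }
    { intros U U' k H0 H0'; rewrite !Lcomb by assumption; ring. }
    { intros U U' k H0 H0'; auto. }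
    { intros U H0 H1; auto. }
    set (h := fun x => Q x +v (- mu) *v W x +v (- k3) *v e3 x +v (- k2) *v e2 x +v (- k1) *v e1 x).
    assert (Sadd : forall F F' k, smooth3 a b F -> smooth3 a b F' ->
              smooth3 a b (fun x => F x +v k *v F' x)).
    { intros F F' k SF SF'; apply smooth3_add; [exact Hab|exact SF|].
      apply smooth3_scale; [exact Hab|apply smooth_const, Hab|exact SF']. }
    assert (Sh1 : smooth3 a b (fun x => Q x +v (- mu) *v W x)) by auto.
    assert (Sh2 : smooth3 a b (fun x => Q x +v (- mu) *v W x +v (- k3) *v e3 x))
      by exact (Sadd _ _ _ Sh1 S3).
    assert (Sh3 : smooth3 a b (fun x => Q x +v (- mu) *v W x +v (- k3) *v e3 x +v (- k2) *v e2 x))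
      by exact (Sadd _ _ _ Sh2 S2).
    assert (Sh : smooth3 a b h) by exact (Sadd _ _ _ Sh3 S1).
    (* The fundamental lemma makes [h] equal to its tangential part [f T], that is, [Q - f T - mu W]
       is the constant vector of the multipliers [k1], [k2], [k3]. *)
    exists (fun x => dot (h x) (T x)), mu; split; [apply smooth_dot; assumption|].
    intros x Hx.
    apply (is_deriv3_ext a b (fun _ => (k1, k2, k3))); [exact Hx| |apply is_deriv3_const, Hx].
    intros y Hy.
    assert (Ey : h y = dot (h y) (T y) *v T y).
    { apply (orthogonal_test_functions a b T h y Hab ST HT Sh); [|exact Hy].
      intros U HU HUT; rewrite <- (Hk1 U (conj HU HUT)); destruct HU as [SU _].
      unfold h; rewrite (RInt_dot_comb a b _ _ _ U Hab Sh3 S1 SU),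
        (RInt_dot_comb a b _ _ _ U Hab Sh2 S2 SU), (RInt_dot_comb a b _ _ _ U Hab Sh1 S3 SU),
        (RInt_dot_comb a b _ _ _ U Hab SQ STT1 SU).
      unfold L; match goal with |- ?u = ?v => change (u = v :> R) end; ring. }
    revert Ey; generalize (dot (h y) (T y) *v T y); intros v <-; unfold h.
    change (cross (T y) (T1 y)) with (W y); generalize (W y) (Q y); intros.
    apply eq3; unfold3; ring.
  - intros [f [mu [Sf HK]]] V HV HVT Hhol e G HG.
    pose proof (smooth_compact_support_ends a b V HV) as [Va [Vb [V'a V'b]]].
    destruct HV as [SV _].
    set (U := deriv3 a b V) in *; set (U1 := deriv3 a b U).
    pose proof (smooth3_deriv a b V SV) as SU; fold U in SU.
    pose proof (smooth3_deriv a b U SU) as SU1; fold U1 in SU1.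
    (* One pair of end vectors and the given variation suffice to read the constraint as an integral
       condition on [V]. *)
    assert (E0 : RInt (fun x => dot (cross (T x) (T1 x)) (U x)) a b = 0).
    { destruct (exists_unit_orthogonal (tangent a b gamma a)) as [Wa HWa].
      destruct (exists_unit_orthogonal (tangent a b gamma b)) as [Wb HWb].
      destruct (Hhol Wa Wb HWa HWb e G HG) as [theta [Htheta Dtheta]].
      pose proof (holonomy_lift_derivative a b gamma V e G Wa Wb theta 0
        Hab Hg HG HWa HWb Htheta Dtheta) as E.
      unfold T1, T, U; lra. }
    set (K := fun y => Q y -v f y *v T y -v mu *v cross (T y) (T1 y)) in HK.
    set (h := fun x => rho x * dot (T1 x) (U1 x)).
    set (k := fun x => dot (cross (T x) (T1 x)) (U x)) in E0.
    assert (Sh : smooth a b h) by (apply smooth_mult; auto using smooth_dot).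
    assert (Sk : smooth a b k) by (apply smooth_dot; assumption).
    assert (Sk' : smooth a b (fun x => mu * k x)).
    { apply smooth_mult; [exact Hab|apply smooth_const, Hab|exact Sk]. }
    (* As [K] is constant, [<rho T', U> - <K, V>] has derivative [rho <T', U'> + <Q - K, U>]. Here
       [Q - K = f T + mu T x T'], and the [f]-term drops out because [U] is orthogonal to [T]. *)
    assert (E1 : RInt (fun x => h x + mu * k x) a b = 0).
    { rewrite (RInt_is_deriv a b
        (fun x => dot (rho x *v T1 x) (U x) - dot (K x) (V x)) _ b Ib).
      - rewrite Va, Vb, V'a, V'b; unfold dot, zero3, c1, c2, c3; simpl; ring.
      - intros x Hx; eapply is_deriv_eq_value.
        + exact (is_deriv_minus _ _ _ _ _ _ _ Hx
            (is_deriv_dot _ _ _ _ _ _ _ Hx (DR x Hx) (smooth_is_deriv3 a b U x Hab Hx SU))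
            (is_deriv_dot _ _ _ _ _ _ _ Hx (HK x Hx) (smooth_is_deriv3 a b V x Hab Hx SV))).
        + fold U U1; specialize (HVT x Hx); fold T in HVT; rewrite dot_comm in HVT.
          transitivity (h x + mu * k x + f x * dot (T x) (U x)); [|rewrite HVT; ring].
          unfold h, k, K; generalize (Q x) (T x) (T1 x) (U x) (U1 x) (V x); intros; unfold3; ring.
      - apply smooth_cont; [exact Hab|apply smooth_plus; assumption]. }
    assert (E2 : RInt (fun x => h x + mu * k x) a b = RInt h a b + mu * RInt k a b).
    { transitivity (RInt h a b + RInt (fun x => mu * k x) a b).
      - exact (RInt_plus (V := R_CompleteNormedModule) h _ a b (Iint _ Sh) (Iint _ Sk')).
      - f_equal; exact (RInt_scal (V := R_CompleteNormedModule) k a b mu (Iint _ Sk)). }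
    eapply is_deriv_eq_value; [exact (bending_first_variation a b rho gamma V e G Hab Hg Srho HG HVT)|].
    change (RInt h a b = 0); rewrite E0 in E2; lra.
Qed.

(** * From the integrated equation to the three differential equations *)

Lemma is_deriv3_euler_lagrange (a b : R) (rho f : R -> R) (T : R -> R3) (mu x : R) :
  let D := deriv a b in
  let T1 := deriv3 a b T in
  let T2 := deriv3 a b T1 in
  let T3 := deriv3 a b T2 in
  a < b -> a <= x <= b -> smooth a b rho -> smooth a b f -> smooth3 a b T ->
  is_deriv3 a b
    (fun y => deriv3 a b (fun z => rho z *v T1 z) y -v f y *v T y -v mu *v cross (T y) (T1 y)) x
    (D (D rho) x *v T1 x +v 2 * D rho x *v T2 x +v rho x *v T3 x
     -v D f x *v T x -v f x *v T1 x -v mu *v cross (T x) (T2 x)).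
Proof.
  intros D T1 T2 T3 Hab Hx Srho Sf ST.
  pose proof (smooth3_deriv a b T ST) as ST1; fold T1 in ST1.
  pose proof (smooth3_deriv a b T1 ST1) as ST2; fold T2 in ST2.
  pose proof (smooth_deriv a b rho Srho) as Srho1; fold D in Srho1.
  pose proof (smooth_is_deriv a b rho x Hab Hx Srho) as Drho.
  pose proof (smooth_is_deriv a b (D rho) x Hab Hx Srho1) as Drho1.
  pose proof (smooth_is_deriv a b f x Hab Hx Sf) as Df.
  pose proof (smooth_is_deriv3 a b T x Hab Hx ST) as DT.
  pose proof (smooth_is_deriv3 a b T1 x Hab Hx ST1) as DT1.
  pose proof (smooth_is_deriv3 a b T2 x Hab Hx ST2) as DT2.
  apply (is_deriv3_ext a b (fun y => D rho y *v T1 y +v rho y *v T2 y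
           -v f y *v T y -v mu *v cross (T y) (T1 y))); [exact Hx| |].
  - intros y Hy; f_equal; f_equal; symmetry; apply deriv3_eq; [exact Hab|exact Hy|].
    exact (is_deriv3_scale _ _ _ _ _ _ _ Hy (smooth_is_deriv a b rho y Hab Hy Srho)
      (smooth_is_deriv3 a b T1 y Hab Hy ST1)).
  - eapply is_deriv3_eq_value.
    + exact (is_deriv3_sub _ _ _ _ _ _ _ Hx (is_deriv3_sub _ _ _ _ _ _ _ Hx
        (is_deriv3_add _ _ _ _ _ _ _ Hx
          (is_deriv3_scale _ _ _ _ _ _ _ Hx Drho1 DT1)
          (is_deriv3_scale _ _ _ _ _ _ _ Hx Drho DT2))
        (is_deriv3_scale _ _ _ _ _ _ _ Hx Df DT))
        (is_deriv3_scale _ _ _ _ _ _ _ Hx (is_deriv_const a b mu x Hx)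
          (is_deriv3_cross _ _ _ _ _ _ _ Hx DT DT1))).
    + fold D T1 T2 T3.
      generalize (D (D rho) x) (D rho x) (rho x) (D f x) (f x) (T x) (T1 x) (T2 x) (T3 x).
      intros; apply eq3; unfold3; ring.
Qed.

(** Three differentiations of [<T, T> = 1] give [<T''', T> + 3 <T'', T'> = 0]. This converts the
    tangential term of the first equation into that of the second. *)
Lemma unit_field_third_derivative (a b : R) (T : R -> R3) (x : R) :
  let T1 := deriv3 a b T in
  let T2 := deriv3 a b T1 in
  let T3 := deriv3 a b T2 in
  a < b -> a <= x <= b -> smooth3 a b T ->
  (forall x, a <= x <= b -> dot (T x) (T x) = 1) ->
  dot (T3 x) (T x) = - 3 * dot (T2 x) (T1 x).
Proof.
  intros T1 T2 T3 Hab Hx ST HT.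
  pose proof (smooth3_deriv a b T ST) as ST1; fold T1 in ST1.
  pose proof (smooth3_deriv a b T1 ST1) as ST2; fold T2 in ST2.
  assert (Hzero : forall f f', (forall y, a <= y <= b -> f y = 0) ->
    (forall y, a <= y <= b -> is_deriv a b f y (f' y)) ->
    forall y, a <= y <= b -> f' y = 0).
  { intros f f' Hf Df y Hy; apply (is_deriv_unique a b f y); auto.
    apply (is_deriv_ext a b (fun _ => 0)); [exact Hy|intros; symmetry; auto|].
    apply is_deriv_const, Hy. }
  assert (D : forall F G, smooth3 a b F -> smooth3 a b G -> forall y, a <= y <= b ->
    is_deriv a b (fun y => dot (F y) (G y)) y
      (dot (deriv3 a b F y) (G y) + dot (F y) (deriv3 a b G y))).
  { intros F G SF SG y Hy; apply is_deriv_dot; auto using smooth_is_deriv3. }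
  assert (E1 : forall y, a <= y <= b -> dot (T1 y) (T y) = 0).
  { intros y Hy.
    assert (E : dot (T1 y) (T y) + dot (T y) (T1 y) - 0 = 0).
    { revert y Hy; apply (Hzero (fun y => dot (T y) (T y) - 1)).
      - intros y Hy; rewrite HT by exact Hy; ring.
      - intros y Hy; apply is_deriv_minus; [exact Hy|apply D; assumption|].
        apply is_deriv_const, Hy. }
    rewrite (dot_comm (T y)) in E; lra. }
  pose proof (Hzero _ _ E1 (D T1 T ST1 ST)) as E2; fold T1 T2 in E2.
  pose proof (Hzero _ _ E2 (fun y Hy => is_deriv_plus _ _ _ _ _ _ _ Hy
    (D T2 T ST2 ST y Hy) (D T1 T1 ST1 ST1 y Hy)) x Hx) as E3; cbv beta in E3.
  fold T1 T2 T3 in E3; rewrite (dot_comm (T1 x)) in E3; lra.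
Qed.

Theorem theorem3p7 (a b : R) (hab : a < b)
    (gamma : R -> R3) (hgamma : arclength_curve a b gamma)
    (rho : R -> R) (hrho : smooth a b rho)
    (hrho_pos : forall x, a <= x <= b -> 0 < rho x) :
  let D := deriv a b in
  let D3 := deriv3 a b in
  let g1 := D3 gamma in
  let g2 := D3 g1 in
  let g3 := D3 g2 in
  let g4 := D3 g3 in
  let T := D3 gamma in
  let T1 := D3 T in
  let T2 := D3 T1 in
  let T3 := D3 T2 in
  (holonomy_constrained_elastic a b rho gamma <->
   exists (Lambda : R -> R) (mu : R), smooth a b Lambda /\
     forall x, a <= x <= b ->
       bending_gradient a b rho T x
       -v 2 * D Lambda x *v T x
       -v 2 * Lambda x *v T1 x
       -v mu *v cross (T x) (T2 x) = zero3)
  /\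
  (holonomy_constrained_elastic a b rho gamma <->
   exists (Lambda : R -> R) (mu : R), smooth a b Lambda /\
     forall x, a <= x <= b ->
       rho x *v T3 x
       -v rho x * dot (T3 x) (T x) *v T x
       +v 3 / 2 * rho x * dot (T1 x) (T1 x) *v T1 x
       +v D (D rho) x *v T1 x
       +v D rho x *v (2 *v T2 x +v 3 / 2 * dot (T1 x) (T1 x) *v T x)
       -v D Lambda x *v T x
       -v Lambda x *v T1 x
       -v mu *v cross (T x) (T2 x) = zero3)
  /\
  (holonomy_constrained_elastic a b rho gamma <->
   exists (Lambda : R -> R) (mu : R), smooth a b Lambda /\
     forall x, a <= x <= b ->
       rho x *v g4 x
       -v rho x * dot (g4 x) (g1 x) *v g1 x
       +v 3 / 2 * rho x * dot (g2 x) (g2 x) *v g2 x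
       +v D (D rho) x *v g2 x
       +v D rho x *v (2 *v g3 x +v 3 / 2 * dot (g2 x) (g2 x) *v g1 x)
       -v D Lambda x *v g1 x
       -v Lambda x *v g2 x
       -v mu *v cross (g1 x) (g3 x) = zero3).
Proof.
  intros D D3 g1 g2 g3 g4 T T1 T2 T3.
  pose proof hgamma as [[Sg _] Hg1].
  pose proof (smooth3_deriv a b gamma Sg) as ST; change (smooth3 a b T) in ST.
  pose proof (smooth3_deriv a b T ST) as ST1; change (smooth3 a b T1) in ST1.
  assert (HT : forall x, a <= x <= b -> dot (T x) (T x) = 1).
  { intros x Hx; apply norm3_eq_1, Hg1, Hx. }
  (* With [c] denoting this function, [G^B = (rho T')'' + (c T)'], which is why [f] and [2 Lambda]
     differ by [c]. *)
  assert (Sc : smooth a b (fun x => 3 / 2 * rho x * dot (T1 x) (T1 x))).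
  { apply smooth_mult; [exact hab| |apply smooth_dot; assumption].
    apply smooth_mult; [exact hab|apply smooth_const, hab|exact hrho]. }
  assert (Dc : forall x, a <= x <= b ->
    is_deriv a b (fun x => 3 / 2 * rho x * dot (T1 x) (T1 x)) x
      (3 / 2 * D rho x * dot (T1 x) (T1 x) + 3 * rho x * dot (T2 x) (T1 x))).
  { intros x Hx; eapply is_deriv_eq_value.
    - exact (is_deriv_mult _ _ _ _ _ _ _ Hx
        (is_deriv_mult _ _ _ _ _ _ _ Hx (is_deriv_const a b (3 / 2) x Hx)
           (smooth_is_deriv a b rho x hab Hx hrho))
        (is_deriv_dot _ _ _ _ _ _ _ Hx (smooth_is_deriv3 a b T1 x hab Hx ST1)
           (smooth_is_deriv3 a b T1 x hab Hx ST1))).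
    - change (deriv3 a b T1 x) with (T2 x); fold D; rewrite (dot_comm (T1 x) (T2 x)); field. }
  assert (S2 : forall k f, smooth a b f -> smooth a b (fun x => k * f x)).
  { intros k f Sf; apply smooth_mult; [exact hab|apply smooth_const, hab|exact Sf]. }
  assert (D2 : forall k f x, a <= x <= b -> smooth a b f ->
            is_deriv a b (fun x => k * f x) x (k * D f x)).
  { intros k f x Hx Sf; eapply is_deriv_eq_value.
    - exact (is_deriv_mult _ _ _ _ _ _ _ Hx (is_deriv_const a b k x Hx)
        (smooth_is_deriv a b f x hab Hx Sf)).
    - fold D; cbv beta; ring. }
  assert (EG : forall x, bending_gradient a b rho T x
    = rho x *v T3 x +v 3 * rho x * dot (T2 x) (T1 x) *v T x
      +v 3 / 2 * rho x * dot (T1 x) (T1 x) *v T1 x +v D (D rho) x *v T1 x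
      +v D rho x *v (2 *v T2 x +v 3 / 2 * dot (T1 x) (T1 x) *v T x)) by reflexivity.
  assert (EL : forall f mu x, smooth a b f -> a <= x <= b -> is_deriv3 a b
    (fun y => deriv3 a b (fun z => rho z *v T1 z) y -v f y *v T y -v mu *v cross (T y) (T1 y)) x
    (D (D rho) x *v T1 x +v 2 * D rho x *v T2 x +v rho x *v T3 x
     -v D f x *v T x -v f x *v T1 x -v mu *v cross (T x) (T2 x))).
  { intros f mu x Sf Hx; exact (is_deriv3_euler_lagrange a b rho f T mu x hab Hx hrho Sf ST). }
  (* Only the first equation is compared with criticality; the second is derived from the first. *)
  match goal with |- (_ <-> ?A) /\ (_ <-> ?B) /\ _ =>
    assert (H1 : holonomy_constrained_elastic a b rho gamma <-> A);
    [|assert (H2 : A <-> B)] end.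
  - rewrite (elastic_iff a b gamma rho hab hgamma hrho); split.
    + intros [f [mu [Sf H]]].
      exists (fun x => / 2 * (f x + 3 / 2 * rho x * dot (T1 x) (T1 x))), mu.
      split; [apply S2, smooth_plus; assumption|].
      intros x Hx.
      pose proof (eq_trans (eq_sym (deriv3_eq a b _ x _ hab Hx (EL f mu x Sf Hx)))
        (deriv3_eq a b _ x _ hab Hx (H x Hx))) as E.
      replace (D (fun x => / 2 * (f x + 3 / 2 * rho x * dot (T1 x) (T1 x))) x)
        with (/ 2 * (D f x + (3 / 2 * D rho x * dot (T1 x) (T1 x)
                              + 3 * rho x * dot (T2 x) (T1 x)))).
      2: { symmetry; apply deriv_eq; [exact hab|exact Hx|].
        eapply is_deriv_eq_value.
        - apply D2; [exact Hx|apply smooth_plus; assumption].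
        - f_equal; apply deriv_eq; [exact hab|exact Hx|].
          apply is_deriv_plus; [exact Hx|apply smooth_is_deriv; assumption|apply Dc, Hx]. }
      rewrite <- E, EG.
      generalize (D (D rho) x) (D rho x) (rho x) (D f x) (f x) (T x) (T1 x) (T2 x) (T3 x).
      intros; apply eq3; unfold3; field.
    + intros [Lambda [mu [SL H]]].
      set (f := fun x => 2 * Lambda x - 3 / 2 * rho x * dot (T1 x) (T1 x)).
      assert (Sf : smooth a b f) by (apply smooth_minus; auto).
      exists f, mu; split; [exact Sf|].
      intros x Hx; eapply is_deriv3_eq_value.
      * exact (EL f mu x Sf Hx).
      * assert (Ef : D f x = 2 * D Lambda x - (3 / 2 * D rho x * dot (T1 x) (T1 x)
                              + 3 * rho x * dot (T2 x) (T1 x))).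
        { apply deriv_eq; [exact hab|exact Hx|].
          apply is_deriv_minus; [exact Hx|apply D2; assumption|apply Dc, Hx]. }
        rewrite Ef, <- (H x Hx), EG; unfold f.
        generalize (D (D rho) x) (D rho x) (rho x) (D Lambda x) (Lambda x)
          (T x) (T1 x) (T2 x) (T3 x).
        intros; apply eq3; unfold3; field.
  - assert (HT3 : forall x, a <= x <= b -> dot (T3 x) (T x) = - 3 * dot (T2 x) (T1 x)).
    { intros x Hx; exact (unit_field_third_derivative a b T x hab Hx ST HT). }
    split; intros [Lambda [mu [SL H]]].
    (* The second equation absorbs the factor 2 into the multiplier, and [HT3] accounts for the
       tangential term. *)
    + exists (fun x => 2 * Lambda x), mu; split; [apply S2, SL|].
      intros x Hx; rewrite <- (H x Hx).
      replace (D (fun x => 2 * Lambda x) x) with (2 * D Lambda x)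
        by (symmetry; apply deriv_eq; auto).
      rewrite EG, HT3 by exact Hx.
      generalize (D (D rho) x) (D rho x) (rho x) (D Lambda x) (Lambda x)
        (T x) (T1 x) (T2 x) (T3 x).
      intros; apply eq3; unfold3; field.
    + exists (fun x => / 2 * Lambda x), mu; split; [apply S2, SL|].
      intros x Hx; rewrite <- (H x Hx).
      replace (D (fun x => / 2 * Lambda x) x) with (/ 2 * D Lambda x)
        by (symmetry; apply deriv_eq; auto).
      rewrite EG, HT3 by exact Hx.
      generalize (D (D rho) x) (D rho x) (rho x) (D Lambda x) (Lambda x)
        (T x) (T1 x) (T2 x) (T3 x).
      intros; apply eq3; unfold3; field.
  (* The third equation is convertible with the second: [g1], [g2], [g3], [g4] unfold to the same
     terms as [T], [T1], [T2], [T3]. *)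
  - split; [exact H1|split; rewrite H1; exact H2].
Qed.
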